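(* Let $n\geq 1$ be an integer, and for integers $1\le p\le n$ define \[ a_{p,n}:=[z^{2n}](z^2-1)^{n-1}(\arcsin z)^{2p},\qquad b_{p,n}:=[z^{2n-1}](z^2-1)^{n-1}(\arcsin z)^{2p-1}. \] Then \[ \int_0^1 \frac{x^{2n-1}}{\operatorname{arctanh}x}\,dx=\sum_{p=1}^{n}(2^{2p+1}-1)\,a_{p,n}\,\frac{\zeta(2p+1)}{\pi^{2p}}, \] and \[ \int_0^1 \frac{x^{2n-1}}{\sqrt{1-x^2}\,\operatorname{arctanh}x}\,dx=\sum_{p=1}^{n}2^{2p}\,b_{p,n}\,\frac{\beta(2p)}{\pi^{2p-1}}. \] Moreover, for every $1\leq p\leq n$, \[ (-1)^{p-1}a_{p,n}>0\quad\text{and}\quad(-1)^{p-1}b_{p,n}>0 . \] Consequently, the summands (indexed by $p=1,\dots,n$) on the right-hand sides of both integral representations alternate strictly in sign, beginning with a positive term.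
   Context: $\zeta$ is the Riemann zeta function and $\beta(s)=\sum_{j=0}^\infty \frac{(-1)^j}{(2j+1)^s}$ is the Dirichlet beta function. For a power series or Laurent series $F$, $[z^r]F(z)$ denotes the coefficient of $z^r$ in the expansion of $F$ at the origin; $\arcsin z$ is expanded as its Taylor series at $0$ (with $\arcsin 0=0$). *)

(* Defs.v *)
From Stdlib Require Import Reals Factorial.
From Coquelicot Require Import Coquelicot.
Open Scope R_scope.

(** Agrees with the Dirichlet series of the Riemann zeta function on [1 < s]
    only (no analytic continuation is encoded). *)
Definition riemann_zeta (s : R) : R :=
  Series (fun j : nat => / Rpower (INR (j + 1)) s).

(** Meaningful for [0 < s], where the series converges. *)
Definition dirichlet_beta (s : R) : R :=
  Series (fun j : nat => (-1) ^ j / Rpower (INR (2 * j + 1)) s).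

(** [arctanh x] is used for [-1 < x < 1]. *)
Definition arctanh (x : R) : R := / 2 * ln ((1 + x) / (1 - x)).

(** [[z^r] F(z)]: the [r]-th Taylor coefficient of [F] at the origin. *)
Definition taylor_coef (r : nat) (F : R -> R) : R :=
  Derive_n F r 0 / INR (fact r).

Lemma taylor_coef_pseries (r : nat) (F : R -> R) (c : nat -> R) :
  Rbar_lt 0 (CV_radius c) ->
  locally 0 (fun z => F z = PSeries c z) ->
  taylor_coef r F = c r.
Proof.
intros Hc HF; unfold taylor_coef.
rewrite (Derive_n_ext_loc F (PSeries c) r 0 HF), (Derive_n_coef c r Hc).
field; apply INR_fact_neq_0.
Qed.

(** The exponents [n - 1] and [2 * p - 1], [2 * n - 1] below use truncated
    subtraction, which is exact since only [1 <= p <= n] is considered. *)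
Definition coef_a (p n : nat) : R :=
  taylor_coef (2 * n) (fun z => (z ^ 2 - 1) ^ (n - 1) * asin z ^ (2 * p)).

Definition coef_b (p n : nat) : R :=
  taylor_coef (2 * n - 1)
    (fun z => (z ^ 2 - 1) ^ (n - 1) * asin z ^ (2 * p - 1)).

Definition zeta_summand (n p : nat) : R :=
  (2 ^ (2 * p + 1) - 1) * coef_a p n
    * (riemann_zeta (INR (2 * p + 1)) / PI ^ (2 * p)).

Definition beta_summand (n p : nat) : R :=
  2 ^ (2 * p) * coef_b p n
    * (dirichlet_beta (INR (2 * p)) / PI ^ (2 * p - 1)).

Definition alternates_from_positive (u : nat -> R) (n : nat) : Prop :=
  0 < u 1%nat /\
  forall p : nat, (1 <= p)%nat -> (p + 1 <= n)%nat -> u p * u (p + 1)%nat < 0.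

(* Main.v *)
(** Substituting [x = tanh u], both integrals become
    [int_0^oo g_j(u) / u du] with [g_j = tanh^(2j+1) sech^q], [j = n - 1] and
    [q = 2] resp. [q = 1].  Since [g_j''] is a combination of [g_(j-1)], [g_j]
    and [g_(j+1)], the sine transforms [S_j(s) = int_0^oo g_j(u) sin(su) du]
    satisfy a three-term recursion in [j] with coefficients quadratic in [s].
    The ODE [(1 - z^2) F'' - z F' = e (e - 1) arcsin^(e-2)] for [F = arcsin^e]
    yields the same recursion for [[z^(2j+q)] (z^2 - 1)^j arcsin(z)^e], so
    [S_j(s)] is [sum_p [z^(2j+q)] (z^2 - 1)^j arcsin(z)^(q+2p) s^(q+2p)/(q+2p)!]
    times [(pi/2) / cosh(pi s/2)] resp. [(pi/2) / sinh(pi s/2)].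
    The case [j = 0] comes from the geometric expansions of [sech] and
    [1 - tanh] together with the partial fractions of [1/cosh] and [1/sinh],
    obtained from a Dirichlet kernel.  Finally
    [int_0^oo g_j(u) / u du = int_0^oo S_j(s) ds], and expanding [1/cosh] and
    [1/sinh] in exponentials turns the moments into beta and zeta values.  The
    signs follow from the recursion, by induction on the growth estimate
    [(2j+2+q) |a_(j+1)| >= (2j+2) |a_j|]. *)

Require Import Defs.
From Stdlib Require Import Reals Factorial Lra Lia Nsatz.
From Coquelicot Require Import Coquelicot.
Open Scope R_scope.

(** * Taylor coefficients of powers of arcsine *)

(** The two recursions agree because of a generating function: [exp (s arcsin z)] solves
    [(1 - z^2) F'' - z F' = s^2 F]. The inhomogeneous term [e (e - 1) arcsin^(e-2)], once divided by
    [e!], therefore acts as multiplication by [s^2], and this is also what [g_j''] becomes, up to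
    sign, after two integrations by parts against [sin (s u)]. The parameter [q], equal to 2 for the
    first integral and 1 for the second, lets one argument serve both.

    The obstacle is the exchange of limits. The double integral of [g_j(u) sin(su)] is not
    absolutely convergent, the geometric series diverge at the origin, and [1/sinh] has a pole
    there. No interchange theorem is used: series are cut after finitely many terms with their exact
    remainder, and integrating that remainder gives an error [C / (N + 1)]. Integrals of yet unknown
    value exist thanks to one exponential bound, and their values are identified afterwards by
    uniqueness. *)

Definition germ (F : R -> R) (c : nat -> R) : Prop :=
  Rbar_lt 0 (CV_radius c) /\ locally 0 (fun z => F z = PSeries c z).

(** Outside the closed disk of convergence the general term does not tend to 0, so a single nonzero
    point of convergence bounds the radius from below. This is how products and differences of
    series are shown to have positive radius. *)
Lemma CV_radius_pos (c : nat -> R) (x : R) :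
  x <> 0 -> ex_pseries c x -> Rbar_lt 0 (CV_radius c).
Proof.
intros Hx Hc.
assert (Hle : Rbar_le (Rabs x) (CV_radius c)).
{ destruct (Rbar_le_lt_dec (Rabs x) (CV_radius c)) as [h|h]; [exact h|].
  exfalso; apply (CV_disk_outside c x h).
  apply (is_lim_seq_ext (fun n => scal (pow_n x n) (c n))).
  { intros n; rewrite pow_n_pow; unfold scal; simpl; unfold mult; simpl; ring. }
  apply ex_series_lim_0; exact Hc. }
apply Rbar_lt_le_trans with (Rabs x); [|exact Hle].
simpl; apply Rabs_pos_lt; exact Hx.
Qed.

Lemma ball_0_iff (eps z : R) : ball 0 eps z <-> Rabs z < eps.
Proof.
unfold ball; simpl; unfold AbsRing_ball, abs, minus, plus, opp; simpl.
rewrite Ropp_0, Rplus_0_r; tauto.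
Qed.

Lemma locally_CV_disk (c : nat -> R) :
  Rbar_lt 0 (CV_radius c) ->
  locally 0 (fun z => Rbar_lt (Rabs z) (CV_radius c)).
Proof.
intros Hc.
destruct (CV_radius c) as [r| |] eqn:Er.
- simpl in Hc; exists (mkposreal r Hc); intros z Hz.
  exact (proj1 (ball_0_iff _ _) Hz).
- exists (mkposreal 1 Rlt_0_1); intros; exact I.
- destruct Hc.
Qed.

Lemma germ_mult (F G : R -> R) (c d : nat -> R) :
  germ F c -> germ G d -> germ (fun z => F z * G z) (PS_mult c d).
Proof.
intros [Rc HF] [Rd HG].
pose proof (filter_and _ _ (locally_CV_disk c Rc) (locally_CV_disk d Rd)) as Hcd.
split.
(* The point [eps / 2] is nonzero and lies in both disks of convergence, so the Cauchy product
   converges there. *)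
- destruct Hcd as [eps He].
  assert (Hb : ball 0 eps (eps / 2)).
  { apply ball_0_iff; pose proof (cond_pos eps); rewrite Rabs_pos_eq; lra. }
  destruct (He _ Hb) as [h1 h2].
  apply (CV_radius_pos _ (eps / 2)).
  + pose proof (cond_pos eps); lra.
  + apply ex_pseries_mult; assumption.
- generalize (filter_and _ _ Hcd (filter_and _ _ HF HG)); apply filter_imp.
  intros z [[h1 h2] [h3 h4]].
  rewrite PSeries_mult by assumption; rewrite h3, h4; reflexivity.
Qed.

Lemma germ_derive (F dF : R -> R) (c : nat -> R) :
  germ F c -> locally 0 (fun z => is_derive F z (dF z)) ->
  germ dF (PS_derive c).
Proof.
intros [Rc HF] HdF; split.
- rewrite CV_radius_derive; exact Rc.
- generalize (filter_and _ _ (locally_CV_disk c Rc)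
    (filter_and _ _ (locally_locally _ _ HF) HdF)); apply filter_imp.
  intros z [h1 [h2 h3]].
  rewrite <- (Derive_PSeries c z h1).
  rewrite <- (is_derive_unique _ _ _ h3); apply Derive_ext_loc; exact h2.
Qed.

Lemma germ_ext (F G : R -> R) (c d : nat -> R) :
  locally 0 (fun z => F z = G z) -> (forall k, c k = d k) ->
  germ F c -> germ G d.
Proof.
intros H Hcd [Rc HF]; split.
- rewrite <- (CV_radius_ext c d Hcd); exact Rc.
- generalize (filter_and _ _ H HF); apply filter_imp; intros z [h1 h2].
  rewrite <- h1, h2; apply PSeries_ext; exact Hcd.
Qed.

(** This is what turns a differential equation between functions into an identity between
    coefficients. *)
Lemma germ_unique (F : R -> R) (c d : nat -> R) :
  germ F c -> germ F d -> forall k, c k = d k.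
Proof.
intros [Rc HF] [Rd HG] k; apply PSeries_ext_recip; try assumption.
generalize (filter_and _ _ HF HG); apply filter_imp; intros z [h1 h2].
rewrite <- h1; exact h2.
Qed.

Lemma germ_minus (F G : R -> R) (c d : nat -> R) :
  germ F c -> germ G d -> germ (fun z => F z - G z) (PS_minus c d).
Proof.
intros [Rc HF] [Rd HG].
pose proof (filter_and _ _ (locally_CV_disk c Rc) (locally_CV_disk d Rd)) as Hcd.
split.
- destruct Hcd as [eps He].
  assert (Hb : ball 0 eps (eps / 2)).
  { apply ball_0_iff; pose proof (cond_pos eps); rewrite Rabs_pos_eq; lra. }
  destruct (He _ Hb) as [h1 h2].
  apply (CV_radius_pos _ (eps / 2)).
  + pose proof (cond_pos eps); lra.
  + apply ex_pseries_minus; apply CV_radius_inside; assumption.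
- generalize (filter_and _ _ Hcd (filter_and _ _ HF HG)); apply filter_imp.
  intros z [[h1 h2] [h3 h4]].
  rewrite PSeries_minus by (apply CV_radius_inside; assumption).
  rewrite h3, h4; reflexivity.
Qed.

Lemma germ_incr (F : R -> R) (c : nat -> R) :
  germ F c -> germ (fun z => z * F z) (PS_incr_1 c).
Proof.
intros [Rc HF]; split.
- rewrite CV_radius_incr_1; exact Rc.
- generalize HF; apply filter_imp; intros z h; rewrite PSeries_incr_1, h.
  reflexivity.
Qed.

Lemma germ_scal (a : R) (F : R -> R) (c : nat -> R) :
  germ F c -> germ (fun z => a * F z) (PS_scal a c).
Proof.
intros [Rc HF]; split.
- apply Rbar_lt_le_trans with (CV_radius c); [exact Rc|].
  destruct (Req_dec a 0) as [->|ha].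
  + rewrite (CV_radius_ext (PS_scal 0 c) (fun _ => 0)), CV_radius_const_0.
    * destruct (CV_radius c); exact I.
    * intros n; unfold PS_scal, scal; simpl; unfold mult; simpl; ring.
  + rewrite (CV_radius_scal a c ha); apply Rbar_le_refl.
- generalize HF; apply filter_imp; intros z h; rewrite PSeries_scal, h.
  reflexivity.
Qed.

Lemma locally_unit : locally 0 (fun z : R => -1 < z < 1).
Proof.
exists (mkposreal 1 Rlt_0_1); intros z Hz.
apply (proj1 (ball_0_iff _ _)) in Hz; simpl in Hz; apply Rabs_lt_between in Hz; lra.
Qed.

Lemma locally_of_unit (P : R -> Prop) :
  (forall z, -1 < z < 1 -> P z) -> locally 0 P.
Proof. intros H; generalize locally_unit; apply filter_imp; exact H. Qed.

(** Taylor coefficients of [1 / sqrt (1 - z ^ 2)], from [(1 - z ^ 2) y' = z y]. *)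
Fixpoint inv_sqrt_coef (k : nat) : R :=
  match k with
  | O => 1
  | S O => 0
  | S (S i) => INR (S i) / INR (S (S i)) * inv_sqrt_coef i
  end.

(** Each step multiplies by a ratio in [[0, 1]], so the coefficients never grow; radius at least 1
    follows without asymptotics. *)
Lemma inv_sqrt_coef_bound (k : nat) : Rabs (inv_sqrt_coef k) <= 1.
Proof.
cut (Rabs (inv_sqrt_coef k) <= 1 /\ Rabs (inv_sqrt_coef (S k)) <= 1); [tauto|].
induction k as [|k [h1 h2]].
- simpl; rewrite Rabs_R1, Rabs_R0; lra.
- split; [exact h2|].
  change (Rabs (INR (S k) / INR (S (S k)) * inv_sqrt_coef k) <= 1).
  rewrite Rabs_mult.
  assert (0 <= INR (S k) / INR (S (S k)) <= 1).
  { pose proof (pos_INR k); rewrite !S_INR; split.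
    - apply Rmult_le_pos; [lra|]; left; apply Rinv_0_lt_compat; lra.
    - apply Rle_div_l; lra. }
  rewrite (Rabs_pos_eq (_ / _)) by lra.
  pose proof (Rabs_pos (inv_sqrt_coef k)); nra.
Qed.

Lemma inv_sqrt_radius : Rbar_le 1 (CV_radius inv_sqrt_coef).
Proof.
destruct (CV_radius_bounded inv_sqrt_coef) as [h _]; apply h.
exists 1; intros n; rewrite pow1, Rmult_1_r; apply inv_sqrt_coef_bound.
Qed.

Lemma inv_sqrt_disk (z : R) :
  -1 < z < 1 -> Rbar_lt (Rabs z) (CV_radius inv_sqrt_coef).
Proof.
intros h; apply Rbar_lt_le_trans with 1; [|exact inv_sqrt_radius].
simpl; apply Rabs_lt_between; lra.
Qed.

Lemma inv_sqrt_ode (z : R) :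
  -1 < z < 1 ->
  (1 - z ^ 2) * PSeries (PS_derive inv_sqrt_coef) z
  = z * PSeries inv_sqrt_coef z.
Proof.
intros h; set (d := inv_sqrt_coef).
pose proof (inv_sqrt_disk z h) as hz; fold d in hz.
rewrite Rmult_minus_distr_r, Rmult_1_l.
replace (z ^ 2 * PSeries (PS_derive d) z)
  with (z * (z * PSeries (PS_derive d) z)) by ring.
rewrite <- !PSeries_incr_1.
assert (hd : ex_pseries (PS_derive d) z).
{ apply CV_radius_inside; rewrite CV_radius_derive; exact hz. }
rewrite <- PSeries_minus; [|exact hd|].
2: do 2 apply ex_pseries_incr_1; exact hd.
apply PSeries_ext; intros [|[|k]].
- change (INR 1 * d 1%nat - 0 = 0); unfold d; simpl; ring.
- change (INR 2 * d 2%nat - 0 = d 0%nat); unfold d; simpl; field.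
- change (INR (S (S (S k))) * d (S (S (S k))) - INR (S k) * d (S k) = d (S k)).
  change (d (S (S (S k)))) with (INR (S (S k)) / INR (S (S (S k))) * d (S k)).
  pose proof (pos_INR k); rewrite !S_INR; field; lra.
Qed.

Lemma one_sub_sq_pos (z : R) : -1 < z < 1 -> 0 < 1 - z ^ 2.
Proof. intros; nra. Qed.

Lemma is_derive_sqrt_one_sub_sq (z : R) :
  -1 < z < 1 ->
  is_derive (fun x => sqrt (1 - x ^ 2)) z (- z / sqrt (1 - z ^ 2)).
Proof.
intros h; pose proof (one_sub_sq_pos z h) as hp.
auto_derive.
- replace (1 + - (z * (z * 1))) with (1 - z ^ 2) by ring; exact hp.
- replace (1 + - (z * (z * 1))) with (1 - z ^ 2) by ring.
  field; apply Rgt_not_eq, sqrt_lt_R0; exact hp.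
Qed.

Lemma eq_of_derive_zero (f : R -> R) (a b : R) :
  (forall x, Rmin a b <= x <= Rmax a b -> is_derive f x 0) -> f b = f a.
Proof.
intros h; destruct (MVT_gen f a b (fun _ => 0)) as [c [_ hc]].
- intros x hx; apply h; lra.
- intros x hx; apply continuity_pt_filterlim.
  apply (ex_derive_continuous f x); exists 0; apply h; exact hx.
- lra.
Qed.

(** By the first-order equation [inv_sqrt_ode], the product of the series with [sqrt (1 - z ^ 2)]
    has zero derivative on the unit interval, and it equals 1 at the origin. *)
Lemma PSeries_inv_sqrt (z : R) :
  -1 < z < 1 -> PSeries inv_sqrt_coef z = / sqrt (1 - z ^ 2).
Proof.
intros h.
assert (E : PSeries inv_sqrt_coef z * sqrt (1 - z ^ 2) = 1).
{ transitivity (PSeries inv_sqrt_coef 0 * sqrt (1 - 0 ^ 2)).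
  2: { rewrite PSeries_0; replace (1 - 0 ^ 2) with 1 by ring; rewrite sqrt_1; simpl; ring. }
  apply (eq_of_derive_zero (fun x => PSeries inv_sqrt_coef x * sqrt (1 - x ^ 2))).
  intros x hx.
  assert (hx' : -1 < x < 1).
  { revert hx; unfold Rmin, Rmax; destruct (Rle_dec 0 z); lra. }
  pose proof (one_sub_sq_pos x hx') as hp.
  pose proof (sqrt_lt_R0 _ hp) as hs.
  evar_last.
  - apply (is_derive_mult (PSeries inv_sqrt_coef) (fun y => sqrt (1 - y ^ 2)) x).
    + apply is_derive_PSeries, inv_sqrt_disk, hx'.
    + apply is_derive_sqrt_one_sub_sq, hx'.
    + intros; apply Rmult_comm.
  - unfold plus, mult; simpl.
    pose proof (inv_sqrt_ode x hx') as hode.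
    pose proof (sqrt_sqrt _ (Rlt_le _ _ hp)) as hss.
    change (x * (x * 1)) with (x ^ 2).
    set (s := sqrt (1 - x ^ 2)) in *.
    apply (Rmult_eq_reg_r s); [|lra]. 
    field_simplify; [|lra].
    replace (s ^ 2) with (1 - x ^ 2) by (rewrite <- hss; ring).
    rewrite Rmult_comm, hode; ring. }
pose proof (sqrt_lt_R0 _ (one_sub_sq_pos z h)).
apply (Rmult_eq_reg_r (sqrt (1 - z ^ 2))); [|lra]; rewrite E; field; lra.
Qed.

Lemma is_derive_asin (z : R) :
  -1 < z < 1 -> is_derive asin z (/ sqrt (1 - z ^ 2)).
Proof.
intros h; apply is_derive_Reals.
replace (/ sqrt (1 - z ^ 2)) with (derive_pt asin z (derivable_pt_asin z h)).
- exact (proj2_sig (derivable_pt_asin z h)).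
- rewrite derive_pt_asin; unfold Rsqr, Rdiv; rewrite Rmult_1_l.
  do 3 f_equal; ring.
Qed.

Definition asin_coef : nat -> R := PS_Int inv_sqrt_coef.

Lemma germ_asin : germ asin asin_coef.
Proof.
split.
- unfold asin_coef; rewrite CV_radius_Int.
  apply Rbar_lt_le_trans with 1; [simpl; lra|exact inv_sqrt_radius].
- apply locally_of_unit; intros z hz.
  cut (asin z - PSeries asin_coef z = asin 0 - PSeries asin_coef 0).
  { rewrite asin_0, PSeries_0; change (asin_coef 0) with 0; lra. }
  apply (eq_of_derive_zero (fun x => asin x - PSeries asin_coef x)).
  intros x hx.
  assert (hx' : -1 < x < 1).
  { revert hx; unfold Rmin, Rmax; destruct (Rle_dec 0 z); lra. }
  evar_last.
  + apply (is_derive_minus asin (PSeries asin_coef) x).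
    * apply is_derive_asin, hx'.
    * apply is_derive_PSeries; unfold asin_coef; rewrite CV_radius_Int.
      apply inv_sqrt_disk, hx'.
  + rewrite <- (PSeries_inv_sqrt x hx').
    rewrite (PSeries_ext (PS_derive asin_coef) inv_sqrt_coef).
    * unfold minus, plus, opp; simpl; ring.
    * intros n; unfold PS_derive, asin_coef, PS_Int.
      field; apply not_0_INR; lia.
Qed.

Fixpoint asin_pow_coef (e : nat) : nat -> R :=
  match e with
  | O => fun k => match k with O => 1 | S _ => 0 end
  | S i => PS_mult asin_coef (asin_pow_coef i)
  end.

Lemma germ_asin_pow (e : nat) : germ (fun z => asin z ^ e) (asin_pow_coef e).
Proof.
induction e as [|e IH].
- assert (Hr : CV_radius (asin_pow_coef 0) = p_infty).
  { rewrite <- CV_radius_decr_1, <- CV_radius_const_0.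
    apply CV_radius_ext; intros n; reflexivity. }
  split; [rewrite Hr; exact I|].
  apply locally_of_unit; intros z _.
  rewrite PSeries_decr_1 by (apply CV_radius_inside; rewrite Hr; exact I).
  rewrite (PSeries_ext _ (fun _ => 0)) by (intros; reflexivity).
  rewrite PSeries_const_0; simpl; ring.
- exact (germ_mult asin (fun z => asin z ^ e) _ _ germ_asin IH).
Qed.

Lemma is_derive_pow_asin (e : nat) (z : R) :
  -1 < z < 1 ->
  is_derive (fun x => asin x ^ e) z
    (INR e * (asin z ^ (e - 1) * / sqrt (1 - z ^ 2))).
Proof.
intros h; evar_last.
- apply (is_derive_pow asin e z), is_derive_asin, h.
- simpl; replace (Nat.pred e) with (e - 1)%nat by lia; ring.
Qed.

Lemma is_derive_inv_sqrt (z : R) :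
  -1 < z < 1 ->
  is_derive (fun x => / sqrt (1 - x ^ 2)) z
    (z * (/ sqrt (1 - z ^ 2)) ^ 3).
Proof.
intros h; pose proof (one_sub_sq_pos z h) as hp; pose proof (sqrt_lt_R0 _ hp).
evar_last.
- apply (is_derive_inv _ z _ (is_derive_sqrt_one_sub_sq z h)); lra.
- field; lra.
Qed.

(** Coefficient of [z^k] in [(1 - z^2) F'' - z F'] for [F = arcsin^e]: the terms [z^2 F''] and
    [z F'] contribute [k (k - 1) + k = k^2]. Truncation in [e - 2] is harmless since [e (e - 1)]
    vanishes for [e <= 1]. *)
Lemma asin_pow_ode (e : nat) (k : nat) :
  INR (k + 2) * INR (k + 1) * asin_pow_coef e (k + 2)
    - INR k * INR k * asin_pow_coef e k
  = INR e * (INR e - 1) * asin_pow_coef (e - 2) k.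
Proof.
set (F1 := fun z => INR e * (asin z ^ (e - 1) * / sqrt (1 - z ^ 2))).
set (F2 := fun z => INR e * (INR (e - 1) * (asin z ^ (e - 1 - 1)
                        * / sqrt (1 - z ^ 2)) * / sqrt (1 - z ^ 2)
                    + asin z ^ (e - 1) * (z * (/ sqrt (1 - z ^ 2)) ^ 3))).
set (c := asin_pow_coef e).
assert (g0 : germ (fun z => asin z ^ e) c) by apply germ_asin_pow.
assert (g1 : germ F1 (PS_derive c)).
{ apply (germ_derive _ F1 _ g0); apply locally_of_unit.
  intros z hz; apply is_derive_pow_asin, hz. }
assert (g2 : germ F2 (PS_derive (PS_derive c))).
{ apply (germ_derive _ F2 _ g1); apply locally_of_unit; intros z hz.
  apply (is_derive_scal (fun x => asin x ^ (e - 1) * / sqrt (1 - x ^ 2))).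
  apply (is_derive_mult (fun x => asin x ^ (e - 1)) (fun x => / sqrt (1 - x ^ 2))).
  - apply is_derive_pow_asin, hz.
  - apply is_derive_inv_sqrt, hz.
  - intros; apply Rmult_comm. }
pose proof (germ_minus _ _ _ _ (germ_minus _ _ _ _ g2
  (germ_incr _ _ (germ_incr _ _ g2))) (germ_incr _ _ g1)) as gl.
pose proof (germ_scal (INR e * (INR e - 1)) _ _ (germ_asin_pow (e - 2))) as gr.
assert (E : germ (fun z => INR e * (INR e - 1) * asin z ^ (e - 2))
  (PS_minus (PS_minus (PS_derive (PS_derive c))
    (PS_incr_1 (PS_incr_1 (PS_derive (PS_derive c)))))
    (PS_incr_1 (PS_derive c)))).
{ revert gl; apply germ_ext; [|reflexivity].
  apply locally_of_unit; intros z hz; unfold F1, F2.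
  pose proof (one_sub_sq_pos z hz) as hp; pose proof (sqrt_lt_R0 _ hp).
  pose proof (sqrt_sqrt _ (Rlt_le _ _ hp)) as hss.
  set (s := sqrt (1 - z ^ 2)) in *.
  (* Arranged so that the square root enters through [(1 - z^2) / s^2 = 1]: the first term is then
     the right-hand side and the second, which collects [z F'], cancels. *)
  transitivity (INR e * INR (e - 1) * asin z ^ (e - 1 - 1) * ((1 - z ^ 2) / (s * s))
     + INR e * asin z ^ (e - 1) * z / s * ((1 - z ^ 2) / (s * s) - 1)).
  { field; lra. }
  rewrite hss; replace ((1 - z ^ 2) / (1 - z ^ 2)) with 1 by (field; lra).
  destruct e as [|e].
  - simpl; ring.
  - rewrite S_INR; replace (S e - 1)%nat with e by lia.
    replace (S e - 2)%nat with (e - 1)%nat by lia; ring. }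
transitivity (PS_minus (PS_minus (PS_derive (PS_derive c))
    (PS_incr_1 (PS_incr_1 (PS_derive (PS_derive c)))))
    (PS_incr_1 (PS_derive c)) k).
2: { rewrite (germ_unique _ _ _ E gr k); reflexivity. }
destruct k as [|[|k]].
- change (INR 2 * INR 1 * c 2%nat - INR 0 * INR 0 * c 0%nat
    = INR 1 * (INR 2 * c 2%nat) - 0 - 0); simpl; ring.
- change (INR 3 * INR 2 * c 3%nat - INR 1 * INR 1 * c 1%nat
    = INR 2 * (INR 3 * c 3%nat) - 0 - INR 1 * c 1%nat); simpl; ring.
- replace (S (S k) + 2)%nat with (S (S (S (S k)))) by lia.
  replace (S (S k) + 1)%nat with (S (S (S k))) by lia.
  change (INR (S (S (S (S k)))) * INR (S (S (S k))) * c (S (S (S (S k))))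
    - INR (S (S k)) * INR (S (S k)) * c (S (S k))
    = INR (S (S (S k))) * (INR (S (S (S (S k)))) * c (S (S (S (S k)))))
      - INR (S k) * (INR (S (S k)) * c (S (S k)))
      - INR (S (S k)) * c (S (S k))).
  rewrite !S_INR; ring.
Qed.

(** * Multiplication by powers of [z^2 - 1] on coefficients *)

Definition shift2 (c : nat -> R) (k : nat) : R :=
  match k with S (S i) => c i | _ => 0 end.

Definition mul_sq_sub_one (c : nat -> R) (k : nat) : R := shift2 c k - c k.

Definition mul_pow (j : nat) (c : nat -> R) : nat -> R :=
  Nat.iter j mul_sq_sub_one c.

Lemma germ_mul_pow (j : nat) (F : R -> R) (c : nat -> R) :
  germ F c -> germ (fun z => (z ^ 2 - 1) ^ j * F z) (mul_pow j c).
Proof.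
intros h; induction j as [|j IH].
- revert h; apply germ_ext; [|reflexivity].
  apply locally_of_unit; intros; simpl; ring.
- generalize (germ_minus _ _ _ _ (germ_incr _ _ (germ_incr _ _ IH)) IH).
  apply germ_ext.
  + apply locally_of_unit; intros; simpl; ring.
  + intros [|[|k]]; reflexivity.
Qed.

(** Coefficientwise form of
    [(Q^(j+1) F)'' = (4j+3) z (Q^j F)' + (2j+2) Q^j F
      - 2j(2j+1) z^2 Q^(j-1) F - Q^j S] for [Q = z^2 - 1] and
    [- Q F'' - z F' = S]. *)
Lemma mul_pow_rec (c d : nat -> R) :
  (forall k, INR (k + 2) * INR (k + 1) * c (k + 2)%nat - INR k * INR k * c k
             = d k) ->
  forall j k : nat,
  INR (k + 2) * INR (k + 1) * mul_pow (S j) c (k + 2)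
  = ((4 * INR j + 3) * INR k + 2 * INR j + 2) * mul_pow j c k
    - 2 * INR j * (2 * INR j + 1) * shift2 (mul_pow (j - 1) c) k
    - mul_pow j d k.
Proof.
intros H j; induction j as [|j IH]; intros k.
- replace (k + 2)%nat with (S (S k)) by lia; pose proof (H k) as Hk.
  replace (k + 2)%nat with (S (S k)) in Hk by lia.
  simpl mul_pow; unfold mul_sq_sub_one; simpl shift2; rewrite <- Hk.
  replace (k + 1)%nat with (S k) by lia; rewrite !S_INR; simpl INR; ring.
- replace (S j - 1)%nat with j by lia.
  (* Coefficient form of [z^2 Q Q^(j-1) = z^2 Q^j]. The prefactor [2 j] makes it true at [j = 0],
     where [j - 1] truncates. *)
  assert (HV : forall i, 2 * INR j * (2 * INR j + 1) *
     (shift2 (shift2 (mul_pow (j - 1) c)) i - shift2 (mul_pow (j - 1) c) i)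
     = 2 * INR j * (2 * INR j + 1) * shift2 (mul_pow j c) i).
  { intros i; destruct j as [|j]; [simpl; ring|].
    replace (S j - 1)%nat with j by lia; f_equal.
    destruct i as [|[|i]]; simpl; try ring; reflexivity. }
  specialize (HV k); pose proof (IH k) as E2.
  assert (EX : mul_pow (S (S j)) c (k + 2)
    = mul_pow (S j) c k - mul_pow (S j) c (k + 2)).
  { replace (k + 2)%nat with (S (S k)) by lia; reflexivity. }
  assert (ED : mul_pow (S j) d k = shift2 (mul_pow j d) k - mul_pow j d k)
    by reflexivity.
  assert (EC : mul_pow (S j) c k = shift2 (mul_pow j c) k - mul_pow j c k)
    by reflexivity.
  (* The induction hypothesis at [k - 2], written with [shift2] so that it also covers [k < 2],
     where both sides are 0. *)
  assert (E1 : INR k * (INR k - 1) * mul_pow (S j) c k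
    = ((4 * INR j + 3) * (INR k - 2) + 2 * INR j + 2) * shift2 (mul_pow j c) k
    - 2 * INR j * (2 * INR j + 1) * shift2 (shift2 (mul_pow (j - 1) c)) k
    - shift2 (mul_pow j d) k).
  { destruct k as [|[|k]].
    - simpl; ring.
    - simpl; ring.
    - pose proof (IH k) as E.
      replace (k + 2)%nat with (S (S k)) in E by lia.
      replace (k + 1)%nat with (S k) in E by lia.
      simpl shift2.
      transitivity (INR (S (S k)) * INR (S k) * mul_pow (S j) c (S (S k))).
      + rewrite !S_INR; ring.
      + rewrite E, !S_INR; ring. }
  rewrite EX, ED, Rmult_minus_distr_l, E2, S_INR.
  rewrite !plus_INR; simpl (INR 2); simpl (INR 1).
  set (x := INR k) in *; set (t := INR j) in *.
  set (A := mul_pow (S j) c k) in *.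
  set (B := mul_pow j c k) in *; set (C := shift2 (mul_pow j c) k) in *.
  set (D1 := mul_pow j d k) in *; set (D2 := shift2 (mul_pow j d) k) in *.
  set (V1 := shift2 (mul_pow (j - 1) c) k) in *.
  set (V2 := shift2 (shift2 (mul_pow (j - 1) c)) k) in *.
  (* With [(k + 2)(k + 1) = k (k - 1) + 4 k + 2], the goal is a combination of [E1], [HV] and [EC]
     with polynomial coefficients. *)
  nsatz.
Qed.

(** With [j = n - 1], the choice [q = 2], [e = 2p] gives [coef_a], and [q = 1], [e = 2p - 1] gives
    [coef_b]. *)
Definition asin_mix (q j e : nat) : R :=
  mul_pow j (asin_pow_coef e) (2 * j + q).

Lemma taylor_coef_asin_mix (q j e : nat) :
  taylor_coef (2 * j + q) (fun z => (z ^ 2 - 1) ^ j * asin z ^ e)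
  = asin_mix q j e.
Proof.
destruct (germ_mul_pow j _ _ (germ_asin_pow e)) as [h1 h2].
exact (taylor_coef_pseries _ _ _ h1 h2).
Qed.

Lemma mul_pow_scal (a : R) (c d : nat -> R) :
  (forall k, d k = a * c k) -> forall j k, mul_pow j d k = a * mul_pow j c k.
Proof.
intros H j; induction j as [|j IH]; intros k; [apply H|].
simpl; unfold mul_sq_sub_one; destruct k as [|[|k]]; simpl shift2;
  change (Nat.iter j mul_sq_sub_one d) with (mul_pow j d);
  change (Nat.iter j mul_sq_sub_one c) with (mul_pow j c);
  rewrite !IH; ring.
Qed.

(** The coefficient [(4j+3) k + 2j + 2] of [mul_pow_rec] at [k = 2j + q]. It is also minus the
    coefficient of [g_j] in [g_j''], and equals [(2j+1+q)(2j+2) + (2j+1)(2j+q)]. *)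
Definition mid_coef (q j : nat) : R :=
  (4 * INR j + 3) * (2 * INR j + INR q) + 2 * INR j + 2.

(** [mul_pow_rec] on the diagonal [k = 2j + q]. There the family closes up: [z^2 Q^(j-1)] at degree
    [2j + q] is [Q^(j-1)] at degree [2 (j - 1) + q]. *)
Lemma asin_mix_rec (q j e : nat) :
  (2 * INR j + INR q + 2) * (2 * INR j + INR q + 1) * asin_mix q (S j) e
  = mid_coef q j * asin_mix q j e
    - 2 * INR j * (2 * INR j + 1) * asin_mix q (j - 1) e
    - INR e * (INR e - 1) * asin_mix q j (e - 2).
Proof.
pose proof (mul_pow_rec _ _ (asin_pow_ode e) j (2 * j + q)) as H.
rewrite (mul_pow_scal (INR e * (INR e - 1)) (asin_pow_coef (e - 2)) _
  (fun _ => eq_refl)) in H.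
unfold asin_mix, mid_coef; replace (2 * S j + q)%nat with (2 * j + q + 2)%nat by lia.
replace (2 * INR j * (2 * INR j + 1)
  * mul_pow (j - 1) (asin_pow_coef e) (2 * (j - 1) + q))
 with (2 * INR j * (2 * INR j + 1)
  * shift2 (mul_pow (j - 1) (asin_pow_coef e)) (2 * j + q)).
- rewrite !plus_INR, !mult_INR in H; simpl (INR 2) in H; simpl (INR 1) in H.
  etransitivity; [|etransitivity; [exact H|]]; ring.
- destruct j as [|j]; [simpl; ring|].
  f_equal; replace (2 * S j + q)%nat with (S (S (2 * j + q))) by lia.
  simpl shift2; f_equal; lia.
Qed.

Lemma asin_pow_coef_low (e : nat) :
  asin_pow_coef e 0 = (if Nat.eq_dec e 0 then 1 else 0) /\
  asin_pow_coef e 1 = (if Nat.eq_dec e 1 then 1 else 0) /\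
  asin_pow_coef e 2 = (if Nat.eq_dec e 2 then 1 else 0).
Proof.
assert (h0 : asin_coef 0 = 0) by reflexivity.
assert (h1 : asin_coef 1 = 1) by (unfold asin_coef, PS_Int; simpl; field).
assert (h2 : asin_coef 2 = 0) by (unfold asin_coef, PS_Int; simpl; field).
induction e as [|e (i0 & i1 & i2)]; [repeat split|].
change (asin_pow_coef (S e)) with (PS_mult asin_coef (asin_pow_coef e)).
set (a := asin_coef) in *; set (b := asin_pow_coef e) in *; clearbody a b.
unfold PS_mult; simpl sum_f_R0.
rewrite h0, h1, h2, i0, i1, i2; repeat split;
  repeat destruct (Nat.eq_dec _ _); try lia; ring.
Qed.

(** [arcsin^e] starts with [z^e], so degree [q] only sees the exponent [e = q]. *)
Lemma asin_mix_base (q p : nat) :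
  (q = 1 \/ q = 2)%nat ->
  asin_mix q 0 (q + 2 * p) = match p with O => 1 | _ => 0 end.
Proof.
intros hq; destruct (asin_pow_coef_low (q + 2 * p)) as (_ & h1 & h2).
change (asin_pow_coef (q + 2 * p) q = match p with O => 1 | _ => 0 end).
destruct hq as [-> | ->].
- rewrite h1; destruct (Nat.eq_dec _ _), p; try lia; reflexivity.
- rewrite h2; destruct (Nat.eq_dec _ _), p; try lia; reflexivity.
Qed.

(** Here [p] and [j] stand for [p - 1] and [n - 1] of the statement. The sign is absorbed so that
    the inhomogeneous term of the recursion becomes nonnegative. *)
Definition signed_mix (q j p : nat) : R := (-1) ^ p * asin_mix q j (q + 2 * p).

(** This is the coefficient of [z^(2j+2)] in a polynomial of degree [2j]. The recursion reaches it
    at [q = 2], [p = 0], where the factor [e (e - 1) = 2] does not vanish. *)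
Lemma asin_mix_zero_exponent (j : nat) : asin_mix 2 j 0 = 0.
Proof.
cut (asin_mix 2 j 0 = 0 /\ asin_mix 2 (j - 1) 0 = 0); [tauto|].
induction j as [|j [i1 i2]].
- assert (h : asin_mix 2 0 0 = 0) by reflexivity; split; exact h.
- replace (S j - 1)%nat with j by lia; split; [|exact i1].
  pose proof (asin_mix_rec 2 j 0) as H; simpl (0 - 2)%nat in H.
  rewrite i1, i2 in H; simpl (INR 0) in H; simpl (INR 2) in H.
  pose proof (pos_INR j); nra.
Qed.

Definition prev_term (q j p : nat) : R :=
  match p with
  | O => 0
  | S p' => (INR q + 2 * INR p) * (INR q + 2 * INR p - 1) * signed_mix q j p'
  end.

(** At [p = 0] the term dies for two different reasons: for [q = 1] the factor [e (e - 1)] is 0, for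
    [q = 2] the coefficient is. For [p > 0] the minus sign is the sign change between [p - 1] and
    [p]. *)
Lemma asin_mix_prev (q j p : nat) :
  (q = 1 \/ q = 2)%nat ->
  - (INR (q + 2 * p) * (INR (q + 2 * p) - 1) * asin_mix q j (q + 2 * p - 2))
  = (-1) ^ p * prev_term q j p.
Proof.
intros hq; destruct p as [|p].
- destruct hq as [-> | ->].
  + simpl; ring.
  + simpl (2 + 2 * 0 - 2)%nat; rewrite asin_mix_zero_exponent; simpl; ring.
- unfold prev_term, signed_mix.
  replace (q + 2 * S p - 2)%nat with (q + 2 * p)%nat by lia.
  rewrite plus_INR, mult_INR; simpl (INR 2); rewrite <- tech_pow_Rmult.
  assert (h : (-1) ^ p * (-1) ^ p = 1).
  { rewrite <- Rpow_mult_distr; replace (-1 * -1) with 1 by ring; apply pow1. }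
  set (x := (-1) ^ p) in *; set (y := asin_mix _ _ _).
  set (z := INR q + _).
  transitivity (- (z * (z - 1) * y) * (x * x)); [rewrite h|]; ring.
Qed.

Lemma signed_mix_rec (q j p : nat) :
  (q = 1 \/ q = 2)%nat ->
  (2 * INR j + INR q + 2) * (2 * INR j + INR q + 1) * signed_mix q (S j) p
  = mid_coef q j * signed_mix q j p
    - 2 * INR j * (2 * INR j + 1) * signed_mix q (j - 1) p
    + prev_term q j p.
Proof.
intros hq; pose proof (asin_mix_rec q j (q + 2 * p)) as H.
pose proof (asin_mix_prev q j p hq) as H'.
assert (h : (-1) ^ p * (-1) ^ p = 1).
{ rewrite <- Rpow_mult_distr; replace (-1 * -1) with 1 by ring; apply pow1. }
transitivity ((-1) ^ p * ((2 * INR j + INR q + 2) * (2 * INR j + INR q + 1)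
  * asin_mix q (S j) (q + 2 * p))).
{ unfold signed_mix; ring. }
rewrite H; unfold signed_mix.
transitivity ((-1) ^ p * (mid_coef q j * asin_mix q j (q + 2 * p) -
   2 * INR j * (2 * INR j + 1) * asin_mix q (j - 1) (q + 2 * p)
   + (-1) ^ p * prev_term q j p)).
{ rewrite <- H'; ring. }
assert (hw : prev_term q j p = ((-1) ^ p * (-1) ^ p) * prev_term q j p).
{ rewrite h; ring. }
rewrite hw at 2; ring.
Qed.

(** Write [a_j] for [signed_mix q j p]. The splitting [mid_coef = (2j+1+q)(2j+2) + (2j+1)(2j+q)]
    turns the recursion into [(2j+q+1) [(2j+q+2) a_(j+1) - (2j+2) a_j] = (2j+1)
    [(2j+q) a_j - 2j a_(j-1)] + prev_term], so the bracket stays nonnegative. All [p] are treated at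
    once because [prev_term] needs the sign at [p - 1]. *)
Lemma signed_mix_mono (q : nat) :
  (q = 1 \/ q = 2)%nat -> forall j p,
  0 <= signed_mix q j p /\
  (2 * INR j + INR q) * signed_mix q j p
    >= 2 * INR j * signed_mix q (j - 1) p.
Proof.
intros hq.
assert (hq0 : 1 <= INR q <= 2) by (destruct hq as [-> | ->]; simpl; lra).
induction j as [|j IH]; intros p.
- assert (0 <= signed_mix q 0 p).
  { unfold signed_mix; rewrite asin_mix_base by exact hq.
    destruct p; simpl; lra. }
  split; [assumption|]; simpl INR; nra.
- replace (S j - 1)%nat with j by lia.
  pose proof (signed_mix_rec q j p hq) as E; destruct (IH p) as [h1 h2].
  assert (hp : 0 <= prev_term q j p).
  { destruct p as [|p]; [simpl; lra|]; unfold prev_term.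
    apply Rmult_le_pos; [|apply IH].
    pose proof (pos_INR p); rewrite S_INR; nra. }
  pose proof (pos_INR j) as hj; unfold mid_coef in E; rewrite S_INR.
  set (x := INR j) in *; set (r := INR q) in *.
  set (a := signed_mix q (S j) p) in *; set (b := signed_mix q j p) in *.
  set (c := signed_mix q (j - 1) p) in *.
  assert (h3 : (2 * x + r + 1) * ((2 * x + r + 2) * a - (2 * x + 2) * b) >= 0).
  { assert ((2 * x + 1) * ((2 * x + r) * b - 2 * x * c) >= 0).
    { apply Rle_ge, Rmult_le_pos; lra. }
    nra. }
  assert (h4 : (2 * x + r + 2) * a - (2 * x + 2) * b >= 0).
  { apply Rnot_lt_ge; intros h; apply (Rge_not_lt _ _ h3).
    rewrite Rmult_comm; apply Rmult_neg_pos; lra. }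
  split; [|lra].
  assert (0 <= (2 * x + r + 2) * a) by nra.
  apply Rnot_lt_le; intros h; assert ((2 * x + r + 2) * a < 0); [|lra].
  rewrite Rmult_comm; apply Rmult_neg_pos; lra.
Qed.

Lemma signed_mix_pos (q : nat) :
  (q = 1 \/ q = 2)%nat -> forall j p, (p <= j)%nat -> 0 < signed_mix q j p.
Proof.
intros hq.
assert (hq0 : 1 <= INR q <= 2) by (destruct hq as [-> | ->]; simpl; lra).
induction j as [|j IH]; intros p hp.
- replace p with 0%nat by lia; unfold signed_mix.
  rewrite asin_mix_base by exact hq; simpl; lra.
- pose proof (pos_INR j) as hj.
  (* The new entry [p = j + 1] gets its positivity from [prev_term], that is, from the entry [p = j]
     one level below; the older entries keep theirs by the growth estimate. *)
  destruct (Nat.eq_dec p (S j)) as [->|hne].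
  + pose proof (signed_mix_rec q j (S j) hq) as E.
    destruct (signed_mix_mono q hq j (S j)) as [h1 h2].
    destruct (signed_mix_mono q hq (S j) (S j)) as [h3 _].
    assert (hpos : 0 < prev_term q j (S j)).
    { unfold prev_term; apply Rmult_lt_0_compat; [|apply IH; lia].
      rewrite S_INR; nra. }
    (* If the entry were 0, the recursion with [mid_coef] split as above would write 0 as two
       nonnegative terms plus a positive one. *)
    destruct h3 as [h3|h3]; [exact h3|exfalso].
    rewrite <- h3 in E; unfold mid_coef in E.
    assert ((2 * INR j + 1) * ((2 * INR j + INR q) * signed_mix q j (S j)
      - 2 * INR j * signed_mix q (j - 1) (S j)) >= 0).
    { apply Rle_ge, Rmult_le_pos; lra. }
    assert (0 <= (2 * INR j + 1 + INR q) * (2 * INR j + 2) * signed_mix q j (S j)).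
    { apply Rmult_le_pos; [apply Rmult_le_pos; lra|exact h1]. }
    lra.
  + destruct (signed_mix_mono q hq (S j) p) as [_ h].
    replace (S j - 1)%nat with j in h by lia.
    pose proof (IH p ltac:(lia)) as h0; rewrite S_INR in h.
    apply Rnot_le_lt; intros h'; nra.
Qed.

(** [arcsin^(q+2p)] vanishes to order [q + 2p > 2j + q] at 0. The sums over [p] may therefore have
    any length exceeding [j]. *)
Lemma signed_mix_out (q : nat) :
  (q = 1 \/ q = 2)%nat -> forall j p, (j < p)%nat -> signed_mix q j p = 0.
Proof.
intros hq.
assert (hq0 : 1 <= INR q <= 2) by (destruct hq as [-> | ->]; simpl; lra).
cut (forall j p, (j < p)%nat ->
       signed_mix q j p = 0 /\ signed_mix q (j - 1) p = 0).
{ intros h j p hjp; apply h, hjp. }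
induction j as [|j IH]; intros p hp.
- assert (signed_mix q 0 p = 0).
  { unfold signed_mix; rewrite asin_mix_base by exact hq.
    destruct p; [lia|ring]. }
  split; assumption.
- replace (S j - 1)%nat with j by lia.
  destruct (IH p ltac:(lia)) as [i1 i2]; split; [|exact i1].
  pose proof (signed_mix_rec q j p hq) as E; rewrite i1, i2 in E.
  assert (hz : prev_term q j p = 0).
  { destruct p as [|p]; [lia|]; unfold prev_term.
    rewrite (proj1 (IH p ltac:(lia))); ring. }
  rewrite hz in E; pose proof (pos_INR j).
  apply (Rmult_eq_reg_l ((2 * INR j + INR q + 2) * (2 * INR j + INR q + 1))).
  + rewrite E; ring.
  + apply Rgt_not_eq, Rmult_lt_0_compat; lra.
Qed.

(** * Improper integrals over the positive half-line *)

Notation is_int f l := (is_RInt_gen (V := R_NormedModule) f (at_right 0) (Rbar_locally p_infty) l).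

Lemma at_right_0_between (d : R) : 0 < d -> at_right 0 (fun a => 0 < a < d).
Proof.
intros hd; exists (mkposreal d hd); intros y hy hy0.
unfold ball in hy; simpl in hy; unfold AbsRing_ball, abs, minus, plus, opp in hy.
simpl in hy; rewrite Ropp_0, Rplus_0_r in hy; apply Rabs_lt_between in hy; lra.
Qed.

Lemma filter_prod_0_infty (d B : R) (P : R * R -> Prop) :
  0 < d ->
  (forall a b, 0 < a < d -> B < b -> P (a, b)) ->
  filter_prod (at_right 0) (Rbar_locally p_infty) P.
Proof.
intros hd hP.
apply (Filter_prod _ _ _ (fun a => 0 < a < d) (fun b => B < b)).
- apply at_right_0_between, hd.
- exists B; trivial.
- exact hP.
Qed.

Lemma filter_prod_pos (P : R * R -> Prop) :
  (forall a b, 0 < a -> a <= b -> P (a, b)) ->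
  filter_prod (at_right 0) (Rbar_locally p_infty) P.
Proof.
intros hP; apply (filter_prod_0_infty 1 1); [lra|].
intros a b ha hb; apply hP; lra.
Qed.

Lemma is_int_ext (f g : R -> R) (l : R) :
  (forall u, 0 < u -> f u = g u) -> is_int f l -> is_int g l.
Proof.
intros h; apply is_RInt_gen_ext; apply filter_prod_pos.
intros a b ha hab x hx; simpl in hx.
rewrite Rmin_left, Rmax_right in hx by lra; apply h; lra.
Qed.

Lemma is_int_unique (f : R -> R) (l l' : R) : is_int f l -> is_int f l' -> l = l'.
Proof.
intros h h'; rewrite <- (is_RInt_gen_unique _ _ h).
exact (is_RInt_gen_unique _ _ h').
Qed.

Lemma is_int_plus (f g : R -> R) (l m : R) :
  is_int f l -> is_int g m -> is_int (fun u => f u + g u) (l + m).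
Proof. apply (is_RInt_gen_plus (V := R_NormedModule)). Qed.

Lemma is_int_minus (f g : R -> R) (l m : R) :
  is_int f l -> is_int g m -> is_int (fun u => f u - g u) (l - m).
Proof. apply (is_RInt_gen_minus (V := R_NormedModule)). Qed.

Lemma is_int_scal (c : R) (f : R -> R) (l : R) :
  is_int f l -> is_int (fun u => c * f u) (c * l).
Proof. apply (is_RInt_gen_scal (V := R_NormedModule)). Qed.

Lemma is_int_abs_le (f g : R -> R) (l m : R) :
  (forall u, 0 < u -> Rabs (f u) <= g u) -> is_int f l -> is_int g m ->
  Rabs l <= m.
Proof.
intros h hf hg.
apply (RInt_gen_norm (V := R_CompleteNormedModule) (Fa := at_right 0)
  (Fb := Rbar_locally p_infty) f g l m); [| |exact hf|exact hg].
- apply filter_prod_pos; intros a b; simpl; trivial.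
- apply filter_prod_pos; intros a b ha hab x hx; apply h; simpl in hx; lra.
Qed.

(** Only one-sided limits of the primitive are required, so integrands without a value at 0 are
    covered. *)
Lemma is_int_antiderivative (F f : R -> R) (l0 l1 : R) :
  (forall u, 0 < u -> is_derive F u (f u)) ->
  (forall u, 0 < u -> continuous f u) ->
  filterlim F (at_right 0) (locally l0) ->
  filterlim F (Rbar_locally p_infty) (locally l1) ->
  is_int f (l1 - l0).
Proof.
intros hd hc h0 h1 P hP.
assert (hl : filterlim (fun ab : R * R => F (snd ab) - F (fst ab))
  (filter_prod (at_right 0) (Rbar_locally p_infty)) (locally (l1 - l0))).
{ apply (filterlim_comp_2 (fun ab : R * R => F (snd ab))
    (fun ab => - F (fst ab)) (fun x y => x + y)
    (G := locally l1) (H := locally (- l0))).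
  - eapply filterlim_comp; [apply filterlim_snd|exact h1].
  - apply (filterlim_comp _ _ _ (fun ab : R * R => F (fst ab)) Ropp _ (locally l0)).
    + eapply filterlim_comp; [apply filterlim_fst|exact h0].
    + apply (filterlim_opp (V := R_NormedModule)).
  - apply (filterlim_plus (V := R_NormedModule)). }
assert (hpos : filter_prod (at_right 0) (Rbar_locally p_infty)
  (fun ab : R * R => 0 < fst ab <= snd ab)).
{ apply filter_prod_pos; intros a b ha hab; simpl; lra. }
assert (hP' : filter_prod (at_right 0) (Rbar_locally p_infty)
  (fun ab : R * R => P (F (snd ab) - F (fst ab)))) by exact (hl P hP).
unfold filtermapi; eapply filter_imp; [|exact (filter_and _ _ hpos hP')].
intros [a b] [hab hPab]; simpl in hab, hPab |- *.
exists (F b - F a); split; [|exact hPab].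
apply (is_RInt_derive F f); intros x hx;
  rewrite Rmin_left, Rmax_right in hx by lra; [apply hd|apply hc]; lra.
Qed.

Lemma filterlim_at_right_continuous (F : R -> R) (x : R) :
  continuous F x -> filterlim F (at_right x) (locally (F x)).
Proof.
intros h; eapply filterlim_filter_le_1; [|exact h].
apply filter_le_within.
Qed.

Lemma exp_neg_le (u : R) : 0 < u -> exp (- u / 2) <= 2 / u.
Proof.
intros hu; apply (Rmult_le_reg_r (u / 2)); [lra|].
apply (Rmult_le_reg_r (exp (u / 2))); [apply exp_pos|].
replace (exp (- u / 2) * (u / 2) * exp (u / 2))
  with (u / 2 * (exp (- u / 2) * exp (u / 2))) by ring.
rewrite <- exp_plus; replace (- u / 2 + u / 2) with 0 by field.
rewrite exp_0; pose proof (exp_ineq1_le (u / 2)).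
replace (2 / u * (u / 2)) with 1 by (field; lra); lra.
Qed.

Lemma filterlim_exp_bound (F : R -> R) (C : R) :
  (forall u, 0 < u -> Rabs (F u) <= C * exp (- u / 2)) ->
  filterlim F (Rbar_locally p_infty) (locally 0).
Proof.
intros h P [eps hP].
assert (hC : 0 <= C).
{ pose proof (h 1 Rlt_0_1); pose proof (Rabs_pos (F 1)).
  pose proof (exp_pos (- (1) / 2)); apply Rnot_lt_le; intros hC; nra. }
pose proof (cond_pos eps) as he.
exists (1 + 2 * C / eps); intros u hu; apply hP.
assert (hq : 0 <= 2 * C / eps).
{ apply Rmult_le_pos; [lra|]; left; apply Rinv_0_lt_compat, he. }
unfold ball; simpl; unfold AbsRing_ball, abs, minus, plus, opp; simpl.
rewrite Ropp_0, Rplus_0_r.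
apply Rle_lt_trans with (1 := h u ltac:(lra)).
apply Rle_lt_trans with (C * (2 / u)).
- apply Rmult_le_compat_l; [exact hC|apply exp_neg_le; lra].
- replace (C * (2 / u)) with (2 * C / u) by (field; lra).
  apply (Rmult_lt_reg_r u); [lra|]; unfold Rdiv at 1.
  rewrite Rmult_assoc, Rinv_l, Rmult_1_r by lra.
  apply Rle_lt_trans with (eps * (2 * C / eps)); [|nra].
  right; field; lra.
Qed.

Lemma is_derive_exp_half (C u : R) :
  is_derive (fun v => - 2 * C * exp (- v / 2)) u (C * exp (- u / 2)).
Proof. auto_derive; [trivial|unfold Rdiv; field]. Qed.

Lemma is_int_exp_half (C : R) :
  is_int (fun u => C * exp (- u / 2)) (2 * C).
Proof.
replace (2 * C) with (0 - (- 2 * C * exp (- 0 / 2))).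
2: { replace (- 0 / 2) with 0 by field; rewrite exp_0; ring. }
apply (is_int_antiderivative (fun u => - 2 * C * exp (- u / 2))).
- intros u _; apply is_derive_exp_half.
- intros u _; apply (ex_derive_continuous (fun v => C * exp (- v / 2))).
  auto_derive; trivial.
- apply (filterlim_at_right_continuous (fun u => - 2 * C * exp (- u / 2))).
  apply (ex_derive_continuous (fun v => - 2 * C * exp (- v / 2))).
  eexists; apply is_derive_exp_half.
- apply (filterlim_exp_bound _ (2 * Rabs C)); intros u _.
  rewrite !Rabs_mult, (Rabs_pos_eq (exp _)) by (left; apply exp_pos).
  rewrite (Rabs_left (-2)) by lra; right; ring.
Qed.

(** A class stable under sums and bounded continuous factors on which every integral exists. The
    rate [1/2] leaves room to absorb powers of [u] multiplied by [exp (- u)]. *)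
Definition decay (f : R -> R) : Prop :=
  (forall u, 0 < u -> continuous f u) /\
  exists C, forall u, 0 < u -> Rabs (f u) <= C * exp (- u / 2).

Lemma decay_RInt_le (f : R -> R) (C a b : R) :
  (forall u, 0 < u -> continuous f u) ->
  (forall u, 0 < u -> Rabs (f u) <= C * exp (- u / 2)) ->
  0 < a -> 0 < b ->
  Rabs (RInt f a b) <= 2 * C * Rabs (exp (- a / 2) - exp (- b / 2)).
Proof.
intros hc hb.
cut (forall a b, 0 < a -> a <= b ->
  Rabs (RInt f a b) <= 2 * C * Rabs (exp (- a / 2) - exp (- b / 2))).
{ intros H ha hb'; destruct (Rle_lt_dec a b) as [h|h]; [apply H; assumption|].
  rewrite <- opp_RInt_swap, Rabs_Ropp, Rabs_minus_sym; [apply H; lra|].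
  apply ex_RInt_continuous; intros z hz; apply hc.
  rewrite Rmin_left in hz by lra; lra. }
clear a b; intros a b ha hab.
assert (hC : 0 <= C).
{ pose proof (hb 1 Rlt_0_1); pose proof (Rabs_pos (f 1)).
  pose proof (exp_pos (- (1) / 2)); apply Rnot_lt_le; intros hC; nra. }
assert (he : exp (- b / 2) <= exp (- a / 2)).
{ destruct (Rle_lt_or_eq_dec a b hab) as [h| ->]; [|lra].
  left; apply exp_increasing; lra. }
rewrite (Rabs_pos_eq (_ - _)) by lra.
apply (norm_RInt_le (V := R_NormedModule) f (fun u => C * exp (- u / 2)) a b).
- exact hab.
- intros x hx; apply hb; lra.
- apply (RInt_correct (V := R_CompleteNormedModule)), ex_RInt_continuous; intros z hz; apply hc.
  rewrite Rmin_left in hz by lra; lra.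
- replace (2 * C * (exp (- a / 2) - exp (- b / 2)))
    with (- 2 * C * exp (- b / 2) - - 2 * C * exp (- a / 2)) by ring.
  apply (is_RInt_derive (fun v => - 2 * C * exp (- v / 2))).
  + intros u _; apply is_derive_exp_half.
  + intros u _; apply (ex_derive_continuous (fun v => C * exp (- v / 2))).
    auto_derive; trivial.
Qed.

Lemma exp_half_osc (d a a' : R) :
  0 < a < d -> 0 < a' < d -> Rabs (exp (- a / 2) - exp (- a' / 2)) <= d / 2.
Proof.
assert (H : forall v, 0 < v < d -> 1 - d / 2 <= exp (- v / 2) <= 1).
{ intros v hv; pose proof (exp_ineq1_le (- v / 2)).
  assert (exp (- v / 2) < exp 0) by (apply exp_increasing; lra).
  rewrite exp_0 in *; lra. }
intros h h'; apply H in h; apply H in h'; apply Rabs_le_between; lra.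
Qed.

Lemma decay_ex_int (f : R -> R) : decay f -> exists l : R, is_int f l.
Proof.
intros [hc [C hb]].
set (F := fun ab : R * R => RInt f (fst ab) (snd ab)).
assert (hC : 0 <= C).
{ pose proof (hb 1 Rlt_0_1); pose proof (Rabs_pos (f 1)).
  pose proof (exp_pos (- (1) / 2)); apply Rnot_lt_le; intros hC; nra. }
assert (hex : forall a b, 0 < a -> 0 < b -> ex_RInt f a b).
{ intros a b ha hb'; apply (ex_RInt_continuous (V := R_CompleteNormedModule)).
  intros z hz; apply hc; apply Rlt_le_trans with (2 := proj1 hz).
  apply Rmin_pos; assumption. }
assert (hF : exists l, filterlim F
  (filter_prod (at_right 0) (Rbar_locally p_infty)) (locally (T := R_UniformSpace) l)).
{ apply (filterlim_locally_cauchy (U := R_CompleteSpace)); intros eps.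
  pose proof (cond_pos eps) as he.
  (* Moving either endpoint costs at most [2 C (d / 2)], hence [2 C d < eps] in total. *)
  set (d := eps / (4 * (C + 1))).
  assert (hd : 0 < d) by (apply Rdiv_lt_0_compat; lra).
  exists (fun ab : R * R => 0 < fst ab < d /\ 0 < snd ab /\ exp (- snd ab / 2) < d / 2).
  split.
  (* Beyond [4 / d] the bound [exp (- b / 2) <= 2 / b] is below [d / 2]. *)
  - apply (filter_prod_0_infty d (4 / d)); [exact hd|].
    intros a b ha hbd; simpl.
    assert (hb0 : 0 < 4 / d) by (apply Rdiv_lt_0_compat; lra).
    repeat split; try lra.
    apply Rle_lt_trans with (1 := exp_neg_le b ltac:(lra)).
    apply (Rmult_lt_reg_r b); [lra|]; unfold Rdiv at 1.
    rewrite Rmult_assoc, Rinv_l by lra.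
    replace (2 * 1) with (d / 2 * (4 / d)) by (field; lra).
    apply Rmult_lt_compat_l; lra.
  - intros [a b] [a' b'] (ha & hb0 & hb1) (ha' & hb0' & hb1'); simpl in *.
    unfold ball; simpl; unfold AbsRing_ball, abs, minus, plus, opp; simpl.
    unfold F; simpl.
    assert (E : RInt f a' b' + - RInt f a b = RInt f a' a + RInt f b b').
    { rewrite <- (RInt_Chasles f a' a b') by (apply hex; lra).
      rewrite <- (RInt_Chasles f a b b') by (apply hex; lra).
      unfold plus; simpl; ring. }
    rewrite E; eapply Rle_lt_trans; [apply Rabs_triang|].
    pose proof (decay_RInt_le f C a' a hc hb ltac:(lra) ltac:(lra)) as h1.
    pose proof (decay_RInt_le f C b b' hc hb hb0 hb0') as h2.
    pose proof (exp_half_osc d a' a ha' ha) as h3.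
    assert (h4 : Rabs (exp (- b / 2) - exp (- b' / 2)) <= d / 2).
    { pose proof (exp_pos (- b / 2)); pose proof (exp_pos (- b' / 2)).
      apply Rabs_le_between; lra. }
    assert (h5 : 4 * (C + 1) * d = eps) by (unfold d; field; lra).
    set (e1 := Rabs (exp _ - exp _)) in h1, h3.
    set (e2 := Rabs (exp _ - exp _)) in h2, h4.
    assert (2 * C * e1 <= 2 * C * (d / 2)) by (apply Rmult_le_compat_l; lra).
    assert (2 * C * e2 <= 2 * C * (d / 2)) by (apply Rmult_le_compat_l; lra).
    nra. }
destruct hF as [l hl]; exists l; intros P hP.
assert (hpos : filter_prod (at_right 0) (Rbar_locally p_infty)
  (fun ab : R * R => 0 < fst ab <= snd ab)).
{ apply filter_prod_pos; intros a b ha hab; simpl; lra. }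
assert (hP' : filter_prod (at_right 0) (Rbar_locally p_infty)
  (fun ab : R * R => P (F ab))) by exact (hl P hP).
unfold filtermapi; eapply filter_imp; [|exact (filter_and _ _ hpos hP')].
intros [a b] [hab hPab]; simpl in hab, hPab |- *.
exists (RInt f a b); split; [|exact hPab].
apply (RInt_correct (V := R_CompleteNormedModule)), hex; lra.
Qed.

Lemma is_int_le_exp (f : R -> R) (C l : R) :
  (forall u, 0 < u -> Rabs (f u) <= C * exp (- u / 2)) ->
  is_int f l -> Rabs l <= 2 * C.
Proof.
intros h hf; exact (is_int_abs_le f _ l _ h hf (is_int_exp_half C)).
Qed.

Lemma decay_mult (f g : R -> R) (B : R) :
  decay f -> (forall u, 0 < u -> continuous g u) ->
  (forall u, 0 < u -> Rabs (g u) <= B) -> decay (fun u => f u * g u).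
Proof.
intros [hc [C hb]] hg hB; split.
- intros u hu; apply (continuous_mult f g); [apply hc|apply hg]; exact hu.
- exists (C * B); intros u hu; rewrite Rabs_mult.
  replace (C * B * exp (- u / 2)) with (C * exp (- u / 2) * B) by ring.
  apply Rmult_le_compat; try apply Rabs_pos; [apply hb|apply hB]; exact hu.
Qed.

Lemma decay_plus (f g : R -> R) : decay f -> decay g -> decay (fun u => f u + g u).
Proof.
intros [hf [C hC]] [hg [D hD]]; split.
- intros u hu; apply (continuous_plus f g); auto.
- exists (C + D); intros u hu; pose proof (hC u hu); pose proof (hD u hu).
  pose proof (Rabs_triang (f u) (g u)); lra.
Qed.

(** * Partial fractions of hyperbolic functions *)

(** Sums the [N] terms below index [N], so that the empty sum is available as the base of
    inductions; [sum_n a N] is [psum a (S N)]. *)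
Fixpoint psum (f : nat -> R) (N : nat) : R :=
  match N with O => 0 | S n => psum f n + f n end.

Lemma psum_ext (f g : nat -> R) (N : nat) :
  (forall k, (k < N)%nat -> f k = g k) -> psum f N = psum g N.
Proof.
induction N as [|N IH]; intros h; [reflexivity|].
simpl; rewrite IH by (intros; apply h; lia); f_equal; apply h; lia.
Qed.

Lemma psum_scal (c : R) (f : nat -> R) (N : nat) :
  psum (fun k => c * f k) N = c * psum f N.
Proof. induction N as [|N IH]; simpl; [|rewrite IH]; ring. Qed.

Lemma psum_shift (f : nat -> R) (N : nat) :
  psum f (S N) = f 0%nat + psum (fun k => f (S k)) N.
Proof.
induction N as [|N IH]; [simpl; ring|].
change (psum f (S N) + f (S N) = f 0%nat + (psum (fun k => f (S k)) N + f (S N))).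
rewrite IH; ring.
Qed.

(** From [sin y >= y - y^3 / 6] and [y <= PI / 2 <= 2], since [1 - 4/6 = 1/3]. *)
Lemma sin_ge_third (y : R) : 0 <= y <= PI / 2 -> y / 3 <= sin y.
Proof.
intros hy; pose proof PI_4 as h4; pose proof PI_RGT_0.
destruct (sin_bound y 0) as [h _]; [lra|lra|].
apply Rle_trans with (2 := h).
unfold sin_approx, sin_term; simpl.
assert (y * y <= 4) by nra.
assert (0 <= y * (4 - y * y)) by (apply Rmult_le_pos; lra).
lra.
Qed.

Lemma sin_half_ge (x : R) : 0 <= x <= PI -> x / 6 <= sin (x / 2).
Proof. intros h; pose proof (sin_ge_third (x / 2)); lra. Qed.

Lemma abs_le_of_derive (f df : R -> R) (A x : R) :
  0 <= x -> (forall y, 0 <= y <= x -> is_derive f y (df y)) ->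
  (forall y, 0 <= y <= x -> Rabs (df y) <= A) -> f 0 = 0 ->
  Rabs (f x) <= A * x.
Proof.
intros hx hd hA h0.
destruct (MVT_gen f 0 x df) as [c [hc E]].
- intros y hy; rewrite Rmin_left, Rmax_right in hy by lra; apply hd; lra.
- intros y hy; rewrite Rmin_left, Rmax_right in hy by lra.
  apply continuity_pt_filterlim, (ex_derive_continuous f y).
  exists (df y); apply hd; lra.
- rewrite Rmin_left, Rmax_right in hc by lra.
  replace (f x) with (df c * (x - 0)) by lra.
  rewrite Rabs_mult, (Rabs_pos_eq (x - 0)) by lra.
  replace (x - 0) with x by ring; apply Rmult_le_compat_r; [lra|apply hA; lra].
Qed.

Lemma abs_RInt_le_const (f : R -> R) (a b M : R) :
  a <= b -> (forall x, a <= x <= b -> continuous f x) ->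
  (forall x, a <= x <= b -> Rabs (f x) <= M) ->
  Rabs (RInt f a b) <= M * (b - a).
Proof.
intros hab hc hM; rewrite Rmult_comm.
apply (norm_RInt_le_const (V := R_NormedModule) f a b).
- exact hab.
- exact hM.
- apply (RInt_correct (V := R_CompleteNormedModule)), ex_RInt_continuous.
  intros z hz; rewrite Rmin_left, Rmax_right in hz by lra; apply hc, hz.
Qed.

(** Riemann-Lebesgue for [f / sin (x / 2)], integrating by parts on [[eps, PI]]
    against the antiderivative [- cos (lam x) / lam]; [f] vanishes to second
    order at [0], which bounds the derivative of the quotient. *)
Lemma dirichlet_kernel_bound (f f1 f2 D : R -> R) (A lam : R) :
  0 < lam ->
  (forall x, is_derive f x (f1 x)) -> (forall x, is_derive f1 x (f2 x)) ->
  f 0 = 0 -> f1 0 = 0 -> (forall x, 0 <= x <= PI -> Rabs (f2 x) <= A) ->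
  (forall x, continuous D x) ->
  (forall x, sin (x / 2) * D x = sin (lam * x)) ->
  Rabs (RInt (fun x => f x * D x) 0 PI) <= 144 * A / lam.
Proof.
intros hl hf hf1 h0 h10 hA hD hsin.
pose proof PI_RGT_0 as hPI; pose proof PI_4 as hPI4.
assert (hA0 : 0 <= A) by (pose proof (hA 0 ltac:(lra)); pose proof (Rabs_pos (f2 0)); lra).
assert (b1 : forall x, 0 <= x <= PI -> Rabs (f1 x) <= A * x).
{ intros x hx; apply (abs_le_of_derive f1 f2); auto; try lra.
  intros y hy; apply hA; lra. }
assert (b0 : forall x, 0 <= x <= PI -> Rabs (f x) <= A * x * x).
{ intros x hx; apply (abs_le_of_derive f f1); auto; try lra.
  intros y hy; apply Rle_trans with (1 := b1 y ltac:(lra)).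
  apply Rmult_le_compat_l; lra. }
assert (hcf : forall x, continuous f x).
{ intros x; apply (ex_derive_continuous f x); eexists; apply hf. }
assert (hcf1 : forall x, continuous f1 x).
{ intros x; apply (ex_derive_continuous f1 x); eexists; apply hf1. }
assert (hcfD : forall x, continuous (fun x => f x * D x) x).
{ intros x; apply (continuous_mult f D); auto. }
assert (hex : forall a b, ex_RInt (fun x => f x * D x) a b).
{ intros a b; apply (ex_RInt_continuous (V := R_CompleteNormedModule)); auto. }
assert (hs : forall x, 0 < x <= PI -> 0 < sin (x / 2)).
{ intros x hx; pose proof (sin_half_ge x ltac:(lra)); lra. }
assert (hfs : forall x, 0 < x <= PI -> Rabs (f x / sin (x / 2)) <= 6 * A * x).
{ intros x hx; pose proof (hs x hx) as hsx.
  pose proof (sin_half_ge x ltac:(lra)) as hg.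
  rewrite Rabs_div by lra; rewrite (Rabs_pos_eq (sin _)) by lra.
  apply Rle_div_l; [lra|]; apply Rle_trans with (1 := b0 x ltac:(lra)).
  assert (0 <= A * x) by (apply Rmult_le_pos; lra); nra. }
(* The bound does not involve [D] or [lam]: [f D] is [f / sin (x / 2)] times a sine, and the
   quotient is at most [6 A x <= 24 A]. *)
assert (near : forall eps, 0 < eps <= PI ->
  Rabs (RInt (fun x => f x * D x) 0 eps) <= 24 * A * eps).
{ intros eps he.
  replace (24 * A * eps) with (24 * A * (eps - 0)) by ring.
  apply abs_RInt_le_const; [lra|intros; apply hcfD|].
  intros x hx; destruct (Rle_lt_or_eq_dec 0 x (proj1 hx)) as [hx0| <-].
  - replace (f x * D x) with (f x / sin (x / 2) * sin (lam * x)).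
    2: { rewrite <- hsin; field; apply Rgt_not_eq, hs; lra. }
    rewrite Rabs_mult; pose proof (hfs x ltac:(lra)).
    assert (Rabs (sin (lam * x)) <= 1) by (apply Rabs_le_between, SIN_bound).
    assert (A * x <= A * 4) by (apply Rmult_le_compat_l; lra).
    pose proof (Rabs_pos (f x / sin (x / 2))); pose proof (Rabs_pos (sin (lam * x))).
    nra.
  - rewrite h0, Rmult_0_l, Rabs_R0; lra. }
(* [H] is the boundary term of the integration by parts and [h] the integrand that remains, so that
   [H' = f D - h]. *)
set (H := fun x => - (f x / sin (x / 2)) * cos (lam * x) / lam).
set (h := fun x => (f1 x / sin (x / 2)
  - f x / sin (x / 2) * (cos (x / 2) / (2 * sin (x / 2)))) * cos (lam * x) / lam).
assert (hsd : forall x, is_derive (fun x => sin (x / 2)) x (cos (x / 2) / 2)).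
{ intros x; auto_derive; [trivial|unfold Rdiv; ring]. }
assert (hcd : forall x, is_derive (fun x => cos (lam * x)) x (- lam * sin (lam * x))).
{ intros x; auto_derive; [trivial|ring]. }
assert (hH : forall x, 0 < x <= PI -> is_derive H x (f x * D x - h x)).
{ intros x hx; pose proof (hs x hx) as hsx.
  unfold H; evar_last.
  - apply (is_derive_ext (fun x => scal (- / lam) (f x * / sin (x / 2) * cos (lam * x)))).
    { intros t; unfold scal; simpl; unfold mult; simpl; unfold Rdiv; ring. }
    apply (is_derive_scal (fun x => f x * / sin (x / 2) * cos (lam * x))).
    apply (is_derive_mult (fun x => f x * / sin (x / 2)) (fun x => cos (lam * x))).
    + apply (is_derive_mult f (fun x => / sin (x / 2))).
      * apply hf.
      * apply (is_derive_inv (fun x => sin (x / 2)) x _ (hsd x)); lra.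
      * intros; apply Rmult_comm.
    + apply hcd.
    + intros; apply Rmult_comm.
  - unfold plus, mult, scal; simpl; unfold mult; simpl.
    replace (D x) with (sin (lam * x) / sin (x / 2)).
    2: { rewrite <- hsin; field; lra. }
    unfold h; field; split; lra. }
assert (hch : forall x, 0 < x <= PI -> continuous h x).
{ intros x hx; pose proof (hs x hx) as hsx.
  assert (cs : continuous (fun x => / sin (x / 2)) x).
  { apply (ex_derive_continuous (fun x => / sin (x / 2))).
    eexists; apply (is_derive_inv (fun x => sin (x / 2)) x _ (hsd x)); lra. }
  assert (cc : continuous (fun x => cos (x / 2) / 2) x).
  { apply (ex_derive_continuous (fun x => cos (x / 2) / 2)); auto_derive; trivial. }
  assert (eh : forall y, (f1 y * / sin (y / 2)
    - f y * / sin (y / 2) * (cos (y / 2) / 2 * / sin (y / 2))) * (cos (lam * y) / lam)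
    = h y).
  { intros y; unfold h, Rdiv; rewrite Rinv_mult; ring. }
  apply (continuous_ext _ _ _ eh).
  apply (continuous_mult (fun x => f1 x * / sin (x / 2)
    - f x * / sin (x / 2) * (cos (x / 2) / 2 * / sin (x / 2))) (fun x => cos (lam * x) / lam)).
  - apply (continuous_minus (fun x => f1 x * / sin (x / 2))
      (fun x => f x * / sin (x / 2) * (cos (x / 2) / 2 * / sin (x / 2)))).
    + apply (continuous_mult f1 (fun x => / sin (x / 2))); auto.
    + apply (continuous_mult (fun x => f x * / sin (x / 2))
       (fun x => cos (x / 2) / 2 * / sin (x / 2))).
      * apply (continuous_mult f (fun x => / sin (x / 2))); auto.
      * apply (continuous_mult (fun x => cos (x / 2) / 2) (fun x => / sin (x / 2))); auto.
  - apply (ex_derive_continuous (fun x => cos (lam * x) / lam)); auto_derive; lra. }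
(* [24 = 6 + 18]: the first quotient is at most [A x / (x / 6)], the second at most [6 A x] times
   [3 / x]. *)
assert (bh : forall x, 0 < x <= PI -> Rabs (h x) <= 24 * A / lam).
{ intros x hx; pose proof (hs x hx) as hsx.
  pose proof (sin_half_ge x ltac:(lra)) as hg; pose proof (hfs x hx) as hq.
  unfold h; unfold Rdiv at 1; rewrite Rabs_mult, (Rabs_pos_eq (/ lam)).
  2: { left; apply Rinv_0_lt_compat, hl. }
  apply Rmult_le_compat_r; [left; apply Rinv_0_lt_compat, hl|].
  assert (c1 : Rabs (cos (lam * x)) <= 1) by (apply Rabs_le_between, COS_bound).
  assert (c2 : Rabs (cos (x / 2)) <= 1) by (apply Rabs_le_between, COS_bound).
  assert (d1 : Rabs (f1 x / sin (x / 2)) <= 6 * A).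
  { rewrite Rabs_div by lra; rewrite (Rabs_pos_eq (sin _)) by lra.
    apply Rle_div_l; [lra|]; apply Rle_trans with (1 := b1 x ltac:(lra)); nra. }
  assert (d2 : Rabs (cos (x / 2) / (2 * sin (x / 2))) <= 3 / x).
  { rewrite Rabs_div by lra; rewrite (Rabs_pos_eq (2 * _)) by lra.
    apply Rle_div_l; [lra|]; apply Rle_trans with (1 := c2).
    apply (Rmult_le_reg_r x); [lra|].
    replace (3 / x * (2 * sin (x / 2)) * x) with (6 * sin (x / 2)) by (field; lra).
    lra. }
  assert (d3 : Rabs (f x / sin (x / 2) * (cos (x / 2) / (2 * sin (x / 2)))) <= 18 * A).
  { rewrite Rabs_mult; replace (18 * A) with (6 * A * x * (3 / x)) by (field; lra).
    apply Rmult_le_compat; auto using Rabs_pos. }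
  rewrite Rabs_mult.
  set (u := _ - _).
  assert (Rabs u <= 24 * A).
  { unfold u; apply Rabs_le_between; apply Rabs_le_between in d1, d3; lra. }
  pose proof (Rabs_pos u); pose proof (Rabs_pos (cos (lam * x))); nra. }
assert (bH : forall x, 0 < x <= PI -> Rabs (H x) <= 24 * A / lam).
{ intros x hx; pose proof (hfs x hx) as hq.
  unfold H; unfold Rdiv at 1; rewrite Rabs_mult, (Rabs_pos_eq (/ lam)).
  2: { left; apply Rinv_0_lt_compat, hl. }
  apply Rmult_le_compat_r; [left; apply Rinv_0_lt_compat, hl|].
  assert (c1 : Rabs (cos (lam * x)) <= 1) by (apply Rabs_le_between, COS_bound).
  rewrite Rabs_mult, Rabs_Ropp.
  assert (6 * A * x <= 6 * A * 4) by (apply Rmult_le_compat_l; lra).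
  pose proof (Rabs_pos (f x / sin (x / 2))); pose proof (Rabs_pos (cos (lam * x))).
  nra. }
(* [144 = 24 + 24 + 24 * 4]: two boundary values of [H], and the integral of [h] over a length below
   [PI <= 4]. *)
assert (far : forall eps, 0 < eps <= PI ->
  Rabs (RInt (fun x => f x * D x) eps PI) <= 144 * A / lam).
{ intros eps he.
  assert (E : RInt (fun x => f x * D x) eps PI = H PI - H eps + RInt h eps PI).
  { assert (I1 : is_RInt (fun x => f x * D x - h x) eps PI (H PI - H eps)).
    { apply (is_RInt_derive H); intros x hx;
        rewrite Rmin_left, Rmax_right in hx by lra.
      - apply hH; lra.
      - apply (continuous_minus (fun x => f x * D x) h); [apply hcfD|apply hch; lra]. }
    assert (I2 : ex_RInt h eps PI).
    { apply (ex_RInt_continuous (V := R_CompleteNormedModule)); intros x hx.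
      rewrite Rmin_left, Rmax_right in hx by lra; apply hch; lra. }
    pose proof (is_RInt_unique _ _ _ _ I1) as U.
    rewrite (RInt_minus (V := R_CompleteNormedModule) (fun x => f x * D x) h) in U
      by (first [apply hex | exact I2]).
    unfold minus, plus, opp in U; simpl in U; lra. }
  rewrite E.
  pose proof (abs_RInt_le_const h eps PI (24 * A / lam) ltac:(lra)
    ltac:(intros; apply hch; lra) ltac:(intros; apply bh; lra)) as B1.
  pose proof (bH PI ltac:(lra)) as B2; pose proof (bH eps ltac:(lra)) as B3.
  replace (144 * A / lam) with (6 * (24 * A / lam)) by (field; lra).
  assert (0 <= 24 * A / lam) by (pose proof (Rabs_pos (H PI)); lra).
  set (w := 24 * A / lam) in *.
  assert (w * (PI - eps) <= w * 4) by (apply Rmult_le_compat_l; lra).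
  apply Rabs_le_between in B1, B2, B3; apply Rabs_le_between; lra. }
(* The far bound is uniform in [eps], so any excess of the full integral over it would have to come
   from [[0, eps]]; with this [eps] that piece is smaller than the excess. *)
apply Rnot_lt_le; intros hlt.
set (I := RInt (fun x => f x * D x) 0 PI) in *.
set (gap := Rabs I - 144 * A / lam); assert (hgap : 0 < gap) by (unfold gap; lra).
set (eps := Rmin PI (gap / (48 * (A + 1)))).
assert (he : 0 < eps <= PI).
{ split; [|apply Rmin_l]; apply Rmin_pos; [lra|]; apply Rdiv_lt_0_compat; lra. }
assert (he2 : 24 * A * eps < gap).
{ assert (eps <= gap / (48 * (A + 1))) by apply Rmin_r.
  assert (48 * (A + 1) * eps <= gap).
  { rewrite Rmult_comm; apply Rle_div_r; lra. }
  assert (0 <= A * eps) by (apply Rmult_le_pos; lra); lra. }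
assert (EI : I = RInt (fun x => f x * D x) 0 eps + RInt (fun x => f x * D x) eps PI).
{ unfold I; rewrite <- (RInt_Chasles _ 0 eps PI) by apply hex; reflexivity. }
pose proof (near eps he); pose proof (far eps he).
pose proof (Rabs_triang (RInt (fun x => f x * D x) 0 eps)
  (RInt (fun x => f x * D x) eps PI)) as T.
rewrite <- EI in T; unfold gap in he2; lra.
Qed.

Lemma is_RInt_psum (F : nat -> R -> R) (l : nat -> R) (a b : R) (N : nat) :
  (forall k, is_RInt (F k) a b (l k)) ->
  is_RInt (fun x => psum (fun k => F k x) N) a b (psum l N).
Proof.
intros h; induction N as [|N IH].
- replace (psum l 0) with (scal (b - a) 0); [apply (is_RInt_const a b 0)|].
  unfold scal; simpl; unfold mult; simpl; ring.
- apply (is_RInt_plus (V := R_NormedModule)); [exact IH|apply h].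
Qed.

Lemma continuous_psum (F : nat -> R -> R) (x : R) (N : nat) :
  (forall k, continuous (F k) x) -> continuous (fun y => psum (fun k => F k y) N) x.
Proof.
intros h; induction N as [|N IH]; [apply continuous_const|].
apply (continuous_plus (fun y => psum (fun k => F k y) N) (F N)); auto.
Qed.

Lemma cos_sin_nat_PI (k : nat) :
  cos (INR k * PI) = (-1) ^ k /\ sin (INR k * PI) = 0.
Proof.
induction k as [|k [h1 h2]].
- simpl INR; rewrite Rmult_0_l, cos_0, sin_0; split; reflexivity.
- rewrite S_INR, Rmult_plus_distr_r, Rmult_1_l, cos_plus, sin_plus, h1, h2.
  rewrite cos_PI, sin_PI; simpl; split; ring.
Qed.

Lemma cos_sin_half_PI (k : nat) :
  cos ((INR k + / 2) * PI) = 0 /\ sin ((INR k + / 2) * PI) = (-1) ^ k.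
Proof.
destruct (cos_sin_nat_PI k) as [h1 h2].
replace ((INR k + / 2) * PI) with (INR k * PI + PI / 2) by field.
rewrite cos_plus, sin_plus, h1, h2, cos_PI2, sin_PI2; split; ring.
Qed.

Lemma is_RInt_cosh_cos (t a : R) : 0 < t ->
  is_RInt (fun x => cosh (t * x) * cos (a * x)) 0 PI
    ((t * sinh (t * PI) * cos (a * PI) + a * cosh (t * PI) * sin (a * PI))
      / (t ^ 2 + a ^ 2)).
Proof.
intros ht; assert (hta : 0 < t ^ 2 + a ^ 2) by nra.
set (F := fun x => (t * sinh (t * x) * cos (a * x) + a * cosh (t * x) * sin (a * x))
      / (t ^ 2 + a ^ 2)).
replace (_ / _) with (F PI - F 0).
2: { unfold F; rewrite !Rmult_0_r, sin_0, sinh_0; field; lra. }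
apply (is_RInt_derive F); intros x _.
- unfold F, cosh, sinh; auto_derive; [simpl in hta; lra|].
  field; simpl in hta |- *; lra.
- apply (ex_derive_continuous (fun x => cosh (t * x) * cos (a * x))).
  unfold cosh; auto_derive; trivial.
Qed.

Lemma is_RInt_cos (a : R) : a <> 0 ->
  is_RInt (fun x => cos (a * x)) 0 PI (sin (a * PI) / a).
Proof.
intros ha; set (F := fun x => sin (a * x) / a).
replace (_ / _) with (F PI - F 0).
2: { unfold F; rewrite !Rmult_0_r, sin_0; field; lra. }
apply (is_RInt_derive F); intros x _.
- unfold F; auto_derive; [trivial|field; lra].
- apply (ex_derive_continuous (fun x => cos (a * x))); auto_derive; trivial.
Qed.

(** The Dirichlet kernel [sin ((N + 1/2) x) / sin (x / 2)], given as a cosine sum to have it at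
    [x = 0] as well. *)
Definition kernel_int (N : nat) (x : R) : R :=
  1 + 2 * psum (fun k => cos ((INR k + 1) * x)) N.

(** The half-integer analogue [sin (N x) / sin (x / 2)]. At [PI] its cosines vanish and its sines
    are [1] or [-1], which leaves [cosh] instead of [sinh] in the Fourier coefficients. *)
Definition kernel_half (N : nat) (x : R) : R :=
  2 * psum (fun k => cos ((INR k + / 2) * x)) N.

Lemma sin_half_mul_cos (a x : R) :
  sin (x / 2) * (2 * cos (a * x)) = sin ((a + / 2) * x) - sin ((a - / 2) * x).
Proof.
replace ((a + / 2) * x) with (a * x + x / 2) by field.
replace ((a - / 2) * x) with (a * x - x / 2) by field.
rewrite sin_plus, sin_minus; ring.
Qed.

Lemma sin_kernel_int (N : nat) (x : R) :
  sin (x / 2) * kernel_int N x = sin ((INR N + / 2) * x).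
Proof.
induction N as [|N IH].
- unfold kernel_int; simpl; replace ((0 + / 2) * x) with (x / 2) by field; ring.
- replace (kernel_int (S N) x)
    with (kernel_int N x + 2 * cos ((INR N + 1) * x)) by (unfold kernel_int; simpl psum; ring).
  rewrite Rmult_plus_distr_l, IH, sin_half_mul_cos, S_INR.
  replace (INR N + 1 - / 2) with (INR N + / 2) by field; ring.
Qed.

Lemma sin_kernel_half (N : nat) (x : R) :
  sin (x / 2) * kernel_half N x = sin (INR N * x).
Proof.
induction N as [|N IH].
- unfold kernel_half; simpl; rewrite Rmult_0_l, sin_0; ring.
- replace (kernel_half (S N) x)
    with (kernel_half N x + 2 * cos ((INR N + / 2) * x)) by (unfold kernel_half; simpl psum; ring).
  rewrite Rmult_plus_distr_l, IH, sin_half_mul_cos, S_INR.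
  replace (INR N + / 2 - / 2) with (INR N) by field.
  replace (INR N + / 2 + / 2) with (INR N + 1) by field; ring.
Qed.

Lemma continuous_cos_mul (a x : R) : continuous (fun y => cos (a * y)) x.
Proof. apply (ex_derive_continuous (fun y => cos (a * y))); auto_derive; trivial. Qed.

Lemma continuous_kernel_int (N : nat) (x : R) : continuous (kernel_int N) x.
Proof.
apply (continuous_plus (fun _ => 1) (fun y => 2 * psum (fun k => cos ((INR k + 1) * y)) N)).
- apply continuous_const.
- apply (continuous_scal_r 2 (fun y => psum (fun k => cos ((INR k + 1) * y)) N)).
  apply continuous_psum; intros; apply continuous_cos_mul.
Qed.

Lemma continuous_kernel_half (N : nat) (x : R) : continuous (kernel_half N) x.
Proof.
apply (continuous_scal_r 2 (fun y => psum (fun k => cos ((INR k + / 2) * y)) N)).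
apply continuous_psum; intros; apply continuous_cos_mul.
Qed.

Lemma is_RInt_kernel_int (f : R -> R) (l0 : R) (l : nat -> R) (N : nat) :
  is_RInt f 0 PI l0 ->
  (forall k, is_RInt (fun x => f x * cos ((INR k + 1) * x)) 0 PI (l k)) ->
  is_RInt (fun x => f x * kernel_int N x) 0 PI (l0 + 2 * psum l N).
Proof.
intros h0 h.
apply (is_RInt_ext (fun x => f x + 2 * psum (fun k => f x * cos ((INR k + 1) * x)) N)).
{ intros x _; rewrite (psum_scal (f x)); unfold kernel_int.
  change (@eq R (f x + 2 * (f x * psum (fun k => cos ((INR k + 1) * x)) N))
    (f x * (1 + 2 * psum (fun k => cos ((INR k + 1) * x)) N))); ring. }
apply (is_RInt_plus (V := R_NormedModule)); [exact h0|].
apply (is_RInt_scal (V := R_NormedModule)), is_RInt_psum, h.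
Qed.

Lemma is_RInt_kernel_half (f : R -> R) (l : nat -> R) (N : nat) :
  (forall k, is_RInt (fun x => f x * cos ((INR k + / 2) * x)) 0 PI (l k)) ->
  is_RInt (fun x => f x * kernel_half N x) 0 PI (2 * psum l N).
Proof.
intros h.
apply (is_RInt_ext (fun x => 2 * psum (fun k => f x * cos ((INR k + / 2) * x)) N)).
{ intros x _; rewrite (psum_scal (f x)); unfold kernel_half.
  change (@eq R (2 * (f x * psum (fun k => cos ((INR k + / 2) * x)) N))
    (f x * (2 * psum (fun k => cos ((INR k + / 2) * x)) N))); ring. }
apply (is_RInt_scal (V := R_NormedModule)), is_RInt_psum, h.
Qed.

Lemma cosh_le (x y : R) : 0 <= x <= y -> cosh x <= cosh y.
Proof.
intros h; unfold cosh.
assert (exp x <= exp y).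
{ destruct (Req_dec x y) as [->|]; [lra|]; left; apply exp_increasing; lra. }
pose proof (exp_pos x); assert (1 <= exp x) by (pose proof (exp_ineq1_le x); lra).
assert (E : exp x + exp (- x) <= exp y + exp (- y)).
{ rewrite !exp_Ropp; set (a := exp x) in *; set (b := exp y) in *.
  assert (b + / b - (a + / a) = (b - a) * (1 - / (a * b))) by (field; lra).
  assert (/ (a * b) <= 1) by (rewrite <- Rinv_1; apply Rinv_le_contravar; nra).
  assert (0 <= (b - a) * (1 - / (a * b))) by (apply Rmult_le_pos; lra); lra. }
lra.
Qed.

Lemma psum_zero (l : nat -> R) (N : nat) : (forall k, l k = 0) -> psum l N = 0.
Proof. intros h; induction N as [|N IH]; simpl; [|rewrite IH, h]; ring. Qed.

(** Quantitative form of the partial fractions of [PI / (t sinh (PI t))]. The quantity inside the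
    absolute value is the integral of [(cosh (t x) - 1) kernel_int] over [[0, PI]]: the cosine
    coefficients of [cosh (t x)] give the fractions, and the subtracted 1, needed for second-order
    vanishing at 0, integrates to exactly [PI]. *)
Lemma sinh_partial_fractions (t : R) : 0 < t ->
  exists C, forall N : nat,
  Rabs (t * sinh (t * PI)
    * (/ t ^ 2 - 2 * psum (fun k => (-1) ^ k / (t ^ 2 + (INR k + 1) ^ 2)) N) - PI)
  <= C / (INR N + 1).
Proof.
intros ht; pose proof PI_RGT_0 as hPI.
(* [A] bounds the second derivative; the factor 2 comes from [N + 1/2 >= (N + 1) / 2]. *)
set (A := t * t * cosh (t * PI)); exists (2 * (144 * A)); intros N.
pose proof (pos_INR N) as hN.
assert (hA : 0 <= A).
{ unfold A, cosh; pose proof (exp_pos (t * PI)); pose proof (exp_pos (- (t * PI))).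
  apply Rmult_le_pos; nra. }
pose proof (dirichlet_kernel_bound (fun x => cosh (t * x) - 1)
  (fun x => t * sinh (t * x)) (fun x => t * t * cosh (t * x))
  (kernel_int N) A (INR N + / 2)) as H.
assert (I : is_RInt (fun x => (cosh (t * x) - 1) * kernel_int N x) 0 PI
  (t * sinh (t * PI)
    * (/ t ^ 2 - 2 * psum (fun k => (-1) ^ k / (t ^ 2 + (INR k + 1) ^ 2)) N) - PI)).
{ apply (is_RInt_ext (fun x => cosh (t * x) * kernel_int N x - 1 * kernel_int N x)).
  { intros x _; change (@eq R (cosh (t * x) * kernel_int N x - 1 * kernel_int N x)
      ((cosh (t * x) - 1) * kernel_int N x)); ring. }
  evar_last.
  - apply (is_RInt_minus (V := R_NormedModule)); apply is_RInt_kernel_int.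
    + pose proof (is_RInt_cosh_cos t 0 ht) as J.
      eapply is_RInt_ext; [|exact J]; intros x _; simpl.
      change (@eq R (cosh (t * x) * cos (0 * x)) (cosh (t * x))).
      rewrite Rmult_0_l, cos_0; ring.
    + intros k; apply is_RInt_cosh_cos, ht.
    + apply (is_RInt_const (V := R_NormedModule)).
    + intros k; pose proof (pos_INR k).
      pose proof (is_RInt_cos (INR k + 1) ltac:(lra)) as J.
      eapply is_RInt_ext; [|exact J]; intros x _; simpl.
      change (@eq R (cos ((INR k + 1) * x)) (1 * cos ((INR k + 1) * x))); ring.
  - rewrite (psum_ext _ (fun k => - t * sinh (t * PI) *
      ((-1) ^ k / (t ^ 2 + (INR k + 1) ^ 2)))), psum_scal.
    2: { intros k _; rewrite <- S_INR; destruct (cos_sin_nat_PI (S k)) as [-> ->].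
         pose proof (pos_INR (S k)); simpl pow; field; nra. }
    rewrite (psum_zero (fun k => sin ((INR k + 1) * PI) / (INR k + 1))).
    2: { intros k; rewrite <- S_INR; destruct (cos_sin_nat_PI (S k)) as [_ ->].
         unfold Rdiv; ring. }
    unfold minus, plus, opp, scal; simpl; unfold mult; simpl.
    rewrite !Rmult_0_l, cos_0; field; lra. }
cbv beta in H; rewrite (is_RInt_unique _ _ _ _ I) in H.
apply Rle_trans with (144 * A / (INR N + / 2)).
- apply H; clear H I.
  + lra.
  + intros x; unfold cosh, sinh; auto_derive; [trivial|field].
  + intros x; unfold cosh, sinh; auto_derive; [trivial|field].
  + rewrite Rmult_0_r, cosh_0; ring.
  + rewrite Rmult_0_r, sinh_0; ring.
  + intros x hx; unfold A.
    assert (0 < cosh (t * x)) by (unfold cosh; pose proof (exp_pos (t * x));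
      pose proof (exp_pos (- (t * x))); lra).
    rewrite Rabs_pos_eq by nra.
    apply Rmult_le_compat_l; [nra|apply cosh_le; split; nra].
  + intros; apply continuous_kernel_int.
  + intros; apply sin_kernel_int.
- apply Rle_div_l; [lra|]; unfold Rdiv; rewrite (Rmult_assoc _ (/ _)).
  apply (Rmult_le_reg_r (INR N + 1)); [lra|].
  replace (2 * (144 * A) * (/ (INR N + 1) * (INR N + / 2)) * (INR N + 1))
    with (288 * A * (INR N + / 2)) by (field; lra).
  nra.
Qed.

(** Here [cos (x / 2)] is subtracted instead of 1: it also restores second-order vanishing at 0, and
    being one of the frequencies of [kernel_half] it integrates to exactly [PI] by orthogonality,
    whereas the constant 1 would leave a partial sum. *)
Lemma cosh_partial_fractions (t : R) : 0 < t ->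
  exists C, forall N : nat,
  Rabs (2 * cosh (t * PI)
    * psum (fun k => (-1) ^ k * (INR k + / 2) / (t ^ 2 + (INR k + / 2) ^ 2)) (S N) - PI)
  <= C / (INR N + 1).
Proof.
intros ht; pose proof PI_RGT_0 as hPI.
(* The extra 1 covers the term [cos (x / 2) / 4] of the second derivative. *)
set (A := t * t * cosh (t * PI) + 1); exists (144 * A); intros N.
pose proof (pos_INR N) as hN.
pose proof (dirichlet_kernel_bound (fun x => cosh (t * x) - cos (x / 2))
  (fun x => t * sinh (t * x) + sin (x / 2) / 2)
  (fun x => t * t * cosh (t * x) + cos (x / 2) / 4)
  (kernel_half (S N)) A (INR (S N))) as H.
assert (I : is_RInt (fun x => (cosh (t * x) - cos (x / 2)) * kernel_half (S N) x) 0 PI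
  (2 * cosh (t * PI)
    * psum (fun k => (-1) ^ k * (INR k + / 2) / (t ^ 2 + (INR k + / 2) ^ 2)) (S N) - PI)).
{ apply (is_RInt_ext (fun x => cosh (t * x) * kernel_half (S N) x
     - cos (x / 2) * kernel_half (S N) x)).
  { intros x _; change (@eq R (cosh (t * x) * kernel_half (S N) x
      - cos (x / 2) * kernel_half (S N) x)
      ((cosh (t * x) - cos (x / 2)) * kernel_half (S N) x)); ring. }
  evar_last.
  - apply (is_RInt_minus (V := R_NormedModule)); apply is_RInt_kernel_half.
    + intros k; apply is_RInt_cosh_cos, ht.
    + intros k.
      assert (J : is_RInt (fun x => cos (x / 2) * cos ((INR k + / 2) * x)) 0 PI
        (match k with O => PI / 2 | _ => 0 end)).
      { pose proof (pos_INR k) as hk.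
        pose proof (is_RInt_cos (INR k + 1) ltac:(lra)) as J1.
        rewrite <- S_INR in J1; destruct (cos_sin_nat_PI (S k)) as [_ h].
        rewrite h in J1.
        assert (J2 : is_RInt (fun x => cos (INR k * x)) 0 PI
          (match k with O => PI | _ => 0 end)).
        { destruct k as [|k].
          - apply (is_RInt_ext (fun _ => 1)).
            + intros x _; simpl INR; rewrite Rmult_0_l, cos_0; reflexivity.
            + evar_last; [apply (is_RInt_const (V := R_NormedModule))|].
              unfold scal; simpl; unfold mult; simpl; ring.
          - assert (hk0 : INR (S k) <> 0) by (apply not_0_INR; lia).
            pose proof (is_RInt_cos (INR (S k)) hk0) as J2.
            destruct (cos_sin_nat_PI (S k)) as [_ h'].
            rewrite h' in J2; unfold Rdiv in J2; rewrite Rmult_0_l in J2; exact J2. }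
        apply (is_RInt_ext (fun x => / 2 * (cos (INR (S k) * x) + cos (INR k * x)))).
        { intros x _.
          change (@eq R (/ 2 * (cos (INR (S k) * x) + cos (INR k * x)))
            (cos (x / 2) * cos ((INR k + / 2) * x))).
          rewrite S_INR.
          replace ((INR k + 1) * x) with ((INR k + / 2) * x + x / 2) by field.
          replace (INR k * x) with ((INR k + / 2) * x - x / 2) by field.
          rewrite cos_plus, cos_minus; field. }
        evar_last.
        - apply (is_RInt_scal (V := R_NormedModule)).
          apply (is_RInt_plus (V := R_NormedModule)); [exact J1|exact J2].
        - unfold scal, plus; simpl; unfold mult; simpl; destruct k; unfold Rdiv; ring. }
      exact J.
  - rewrite (psum_ext _ (fun k => cosh (t * PI) *
      ((-1) ^ k * (INR k + / 2) / (t ^ 2 + (INR k + / 2) ^ 2)))), psum_scal.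
    2: { intros k _; destruct (cos_sin_half_PI k) as [-> ->].
         pose proof (pos_INR k); field; nra. }
    rewrite (psum_shift (fun k => match k with O => PI / 2 | _ => 0 end)).
    rewrite (psum_zero (fun k => 0)) by reflexivity.
    set (w := psum _ (S N)); unfold minus, plus, opp; simpl; field. }
cbv beta in H; rewrite (is_RInt_unique _ _ _ _ I) in H; rewrite S_INR in H.
apply H; clear H I.
- lra.
- intros x; unfold cosh, sinh; auto_derive; [trivial|unfold Rdiv; field].
- intros x; unfold cosh, sinh; auto_derive; [trivial|unfold Rdiv; field].
- replace (0 / 2) with 0 by field; rewrite Rmult_0_r, cosh_0, cos_0; ring.
- replace (0 / 2) with 0 by field; rewrite Rmult_0_r, sinh_0, sin_0; field.
- intros x hx; unfold A.
  assert (0 < cosh (t * x)) by (unfold cosh; pose proof (exp_pos (t * x));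
    pose proof (exp_pos (- (t * x))); lra).
  assert (t * t * cosh (t * x) <= t * t * cosh (t * PI)).
  { apply Rmult_le_compat_l; [nra|apply cosh_le; split; nra]. }
  assert (0 <= t * t * cosh (t * x)) by nra.
  pose proof (COS_bound (x / 2)); apply Rabs_le_between; lra.
- intros; apply continuous_kernel_half.
- intros x; rewrite sin_kernel_half, S_INR; reflexivity.
Qed.

(** * Sine transforms of hyperbolic functions *)

Definition sech (u : R) : R := / cosh u.

Lemma cosh_gt_0 (u : R) : 0 < cosh u.
Proof. unfold cosh; pose proof (exp_pos u); pose proof (exp_pos (- u)); lra. Qed.

Lemma sech_gt_0 (u : R) : 0 < sech u.
Proof. apply Rinv_0_lt_compat, cosh_gt_0. Qed.

Lemma is_derive_cosh (u : R) : is_derive cosh u (sinh u).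
Proof. apply is_derive_Reals, derivable_pt_lim_cosh. Qed.

Lemma is_derive_sinh (u : R) : is_derive sinh u (cosh u).
Proof. apply is_derive_Reals, derivable_pt_lim_sinh. Qed.

Lemma sech_sqr (u : R) : sech u * sech u = 1 - tanh u * tanh u.
Proof.
unfold sech, tanh; pose proof (cosh_gt_0 u).
assert (E : cosh u * cosh u - sinh u * sinh u = 1).
{ unfold cosh, sinh; rewrite exp_Ropp; pose proof (exp_pos u); field; lra. }
apply (Rmult_eq_reg_r (cosh u * cosh u)); [|nra].
replace (/ cosh u * / cosh u * (cosh u * cosh u)) with 1 by (field; lra).
rewrite <- E at 1; field; lra.
Qed.

Lemma is_derive_sech (u : R) : is_derive sech u (- tanh u * sech u).
Proof.
pose proof (cosh_gt_0 u); evar_last.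
- apply (is_derive_inv cosh u _ (is_derive_cosh u)); lra.
- unfold tanh, sech; field; lra.
Qed.

Lemma is_derive_tanh (u : R) : is_derive tanh u (1 - tanh u * tanh u).
Proof.
pose proof (cosh_gt_0 u); evar_last.
- apply (is_derive_mult sinh sech u _ _ (is_derive_sinh u) (is_derive_sech u)).
  intros; apply Rmult_comm.
- unfold plus, mult; simpl; unfold sech, tanh; field; lra.
Qed.

Lemma tanh_0 : tanh 0 = 0.
Proof. unfold tanh; rewrite sinh_0; unfold Rdiv; ring. Qed.

Lemma sech_le_1 (u : R) : sech u <= 1.
Proof. pose proof (sech_sqr u); pose proof (sech_gt_0 u); nra. Qed.

Lemma tanh_abs_lt (u : R) : -1 < tanh u < 1.
Proof. pose proof (sech_sqr u); pose proof (sech_gt_0 u); split; nra. Qed.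

Lemma tanh_bounds (u : R) : 0 < u -> 0 < tanh u <= u.
Proof.
intros hu.
destruct (MVT_gen tanh 0 u (fun x => 1 - tanh x * tanh x)) as [c [hc E]].
- intros x _; apply is_derive_tanh.
- intros x _; apply continuity_pt_filterlim, (ex_derive_continuous tanh x).
  eexists; apply is_derive_tanh.
- rewrite tanh_0, Rminus_0_r, Rminus_0_r in E; rewrite E, <- sech_sqr.
  pose proof (sech_gt_0 c); pose proof (sech_le_1 c).
  assert (0 < sech c * sech c <= 1) by nra; split; nra.
Qed.

Lemma exp_le (x y : R) : x <= y -> exp x <= exp y.
Proof.
intros h; destruct (Req_dec x y) as [->|]; [lra|]; left; apply exp_increasing; lra.
Qed.

Lemma sech_le_exp (u : R) : sech u <= 2 * exp (- u).
Proof.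
unfold sech; rewrite exp_Ropp.
replace (2 * / exp u) with (/ (exp u / 2)) by (pose proof (exp_pos u); field; lra).
apply Rinv_le_contravar; unfold cosh;
  pose proof (exp_pos u); pose proof (exp_pos (- u)); lra.
Qed.

Definition hyp (q m : nat) (u : R) : R := tanh u ^ m * sech u ^ q.

(** Writing [tanh'] as [1 - tanh^2] keeps the exponent of [sech] fixed, so derivatives stay in the
    family with the same [q]. *)
Lemma is_derive_hyp (q m : nat) (u : R) :
  is_derive (hyp q m) u
    (INR m * hyp q (m - 1) u - (INR m + INR q) * hyp q (m + 1) u).
Proof.
evar_last.
- apply (is_derive_mult (fun v => tanh v ^ m) (fun v => sech v ^ q)).
  + apply (is_derive_pow tanh m u), is_derive_tanh.
  + apply (is_derive_pow sech q u), is_derive_sech.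
  + intros; apply Rmult_comm.
- unfold plus, mult; simpl; unfold hyp.
  rewrite (Nat.add_1_r m); destruct m as [|m], q as [|q]; rewrite ?S_INR;
    simpl; rewrite ?Nat.sub_0_r; ring.
Qed.

Lemma continuous_hyp (q m : nat) (u : R) : continuous (hyp q m) u.
Proof. apply (ex_derive_continuous (hyp q m)); eexists; apply is_derive_hyp. Qed.

Lemma hyp_le (q m : nat) (u : R) :
  (1 <= q)%nat -> 0 < u -> Rabs (hyp q m u) <= 2 * exp (- u).
Proof.
intros hq hu; unfold hyp; destruct q as [|q]; [lia|].
pose proof (tanh_abs_lt u) as ht; pose proof (sech_gt_0 u); pose proof (sech_le_1 u).
rewrite Rabs_mult, <- !RPow_abs, (Rabs_pos_eq (sech u)) by lra.
assert (h1 : forall x n, 0 <= x <= 1 -> 0 <= x ^ n <= 1).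
{ intros x n hx; induction n as [|n IH]; simpl; [lra|]; nra. }
pose proof (h1 (Rabs (tanh u)) m) as a1; pose proof (h1 (sech u) q ltac:(lra)) as a2.
assert (0 <= Rabs (tanh u) <= 1).
{ split; [apply Rabs_pos|apply Rabs_le_between; lra]. }
pose proof (sech_le_exp u); simpl pow.
assert (sech u * sech u ^ q <= sech u) by nra.
assert (0 <= sech u * sech u ^ q) by nra.
specialize (a1 ltac:(assumption)).
apply Rle_trans with (sech u); [nra|assumption].
Qed.

Lemma exp_neg_le_half (u : R) : 0 < u -> exp (- u) <= exp (- u / 2).
Proof. intros; apply exp_le; lra. Qed.

Lemma decay_hyp (q m : nat) : (1 <= q)%nat -> decay (hyp q m).
Proof.
intros hq; split; [intros; apply continuous_hyp|]; exists 2; intros u hu.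
pose proof (hyp_le q m u hq hu); pose proof (exp_neg_le_half u hu); lra.
Qed.

Lemma decay_lim (f : R -> R) : decay f -> filterlim f (Rbar_locally p_infty) (locally 0).
Proof. intros [_ [C h]]; exact (filterlim_exp_bound f C h). Qed.

Lemma decay_scal (c : R) (f : R -> R) : decay f -> decay (fun u => c * f u).
Proof.
intros [hc [C hC]]; split.
- intros u hu; apply (continuous_scal_r c f), hc, hu.
- exists (Rabs c * C); intros u hu; rewrite Rabs_mult, Rmult_assoc.
  apply Rmult_le_compat_l; [apply Rabs_pos|apply hC, hu].
Qed.

Lemma decay_minus (f g : R -> R) : decay f -> decay g -> decay (fun u => f u - g u).
Proof.
intros hf hg; destruct (decay_plus f (fun u => -1 * g u) hf (decay_scal _ _ hg)) as [h1 [C h2]].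
assert (E : forall u, f u + -1 * g u = f u - g u) by (intros; ring).
split.
- intros u hu; apply (continuous_ext _ _ _ E), h1, hu.
- exists C; intros u hu; rewrite <- E; apply h2, hu.
Qed.

Lemma continuous_sin_mul (a x : R) : continuous (fun y => sin (a * y)) x.
Proof. apply (ex_derive_continuous (fun y => sin (a * y))); auto_derive; trivial. Qed.

Lemma abs_sin_le (x : R) : Rabs (sin x) <= 1.
Proof. apply Rabs_le_between, SIN_bound. Qed.

Lemma abs_cos_le (x : R) : Rabs (cos x) <= 1.
Proof. apply Rabs_le_between, COS_bound. Qed.

Lemma decay_sin (f : R -> R) (s : R) : decay f -> decay (fun u => f u * sin (s * u)).
Proof.
intros h; apply (decay_mult f (fun u => sin (s * u)) 1 h); intros.
- apply continuous_sin_mul.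
- apply abs_sin_le.
Qed.

Lemma decay_cos (f : R -> R) (s : R) : decay f -> decay (fun u => f u * cos (s * u)).
Proof.
intros h; apply (decay_mult f (fun u => cos (s * u)) 1 h); intros.
- apply continuous_cos_mul.
- apply abs_cos_le.
Qed.

Lemma decay_exp (a : R) : / 2 <= a -> decay (fun u => exp (- a * u)).
Proof.
intros ha; split.
- intros u _; apply (ex_derive_continuous (fun v => exp (- a * v))); auto_derive; trivial.
- exists 1; intros u hu; rewrite Rabs_pos_eq by (left; apply exp_pos).
  rewrite Rmult_1_l; apply exp_le; nra.
Qed.

Lemma is_int_exp_cos (a s : R) : / 2 <= a ->
  is_int (fun u => exp (- a * u) * cos (s * u)) (a / (a ^ 2 + s ^ 2)).
Proof.
intros ha; assert (hp : 0 < a ^ 2 + s ^ 2) by nra.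
set (F := fun u => (- a / (a ^ 2 + s ^ 2)) * (exp (- a * u) * cos (s * u))
   + s / (a ^ 2 + s ^ 2) * (exp (- a * u) * sin (s * u))).
assert (hF : forall u, is_derive F u (exp (- a * u) * cos (s * u))).
{ intros u; unfold F; auto_derive; [trivial|field; simpl in hp |- *; lra]. }
replace (a / _) with (0 - F 0).
2: { unfold F; rewrite !Rmult_0_r, exp_0, cos_0, sin_0; field; lra. }
apply (is_int_antiderivative F).
- intros; apply hF.
- intros u _; apply (ex_derive_continuous (fun u => exp (- a * u) * cos (s * u))).
  auto_derive; trivial.
- apply filterlim_at_right_continuous, (ex_derive_continuous F); eexists; apply hF.
- apply decay_lim, decay_plus; apply decay_scal;
    [apply decay_cos|apply decay_sin]; apply decay_exp, ha.
Qed.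

Lemma is_int_exp_sin (a s : R) : / 2 <= a ->
  is_int (fun u => exp (- a * u) * sin (s * u)) (s / (a ^ 2 + s ^ 2)).
Proof.
intros ha; assert (hp : 0 < a ^ 2 + s ^ 2) by nra.
set (F := fun u => (- a / (a ^ 2 + s ^ 2)) * (exp (- a * u) * sin (s * u))
   - s / (a ^ 2 + s ^ 2) * (exp (- a * u) * cos (s * u))).
assert (hF : forall u, is_derive F u (exp (- a * u) * sin (s * u))).
{ intros u; unfold F; auto_derive; [trivial|field; simpl in hp |- *; lra]. }
replace (s / _) with (0 - F 0).
2: { unfold F; rewrite !Rmult_0_r, exp_0, cos_0, sin_0; field; lra. }
apply (is_int_antiderivative F).
- intros; apply hF.
- intros u _; apply (ex_derive_continuous (fun u => exp (- a * u) * sin (s * u))).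
  auto_derive; trivial.
- apply filterlim_at_right_continuous, (ex_derive_continuous F); eexists; apply hF.
- apply decay_lim, decay_minus; apply decay_scal;
    [apply decay_sin|apply decay_cos]; apply decay_exp, ha.
Qed.

Lemma is_int_exp (a : R) : / 2 <= a -> is_int (fun u => exp (- a * u)) (/ a).
Proof.
intros ha; replace (/ a) with (a / (a ^ 2 + 0 ^ 2)) by (field; lra).
apply (is_int_ext (fun u => exp (- a * u) * cos (0 * u))).
- intros u _; rewrite Rmult_0_l, cos_0; ring.
- apply is_int_exp_cos, ha.
Qed.

Lemma is_int_zero : is_int (fun _ => 0) 0.
Proof.
pose proof (is_int_scal 0 _ _ (is_int_exp 1 ltac:(lra))) as H.
rewrite Rmult_0_l in H; revert H; apply is_int_ext; intros; ring.
Qed.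

Lemma is_int_psum (F : nat -> R -> R) (l : nat -> R) (N : nat) :
  (forall k, is_int (F k) (l k)) ->
  is_int (fun x => psum (fun k => F k x) N) (psum l N).
Proof.
intros h; induction N as [|N IH]; [exact is_int_zero|].
apply is_int_plus; [exact IH|apply h].
Qed.

(** Serves to compare an integral with a closed form through common finite sums, whose convergence
    need not be established separately. *)
Lemma eq_of_approx (x y C D : R) (a : nat -> R) :
  (forall N, Rabs (x - a N) <= C / (INR N + 1)) ->
  (forall N, Rabs (y - a N) <= D / (INR N + 1)) -> x = y.
Proof.
intros hx hy; apply Rminus_diag_uniq.
destruct (Req_dec (x - y) 0) as [h|h]; [exact h|exfalso].
apply Rabs_pos_lt in h; set (d := Rabs (x - y)) in *.
destruct (INR_unbounded ((C + D) / d)) as [N hN].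
pose proof (pos_INR N) as h0; specialize (hx N); specialize (hy N).
assert (hd : d <= (C + D) / (INR N + 1)).
{ unfold d, Rdiv; rewrite Rmult_plus_distr_r; apply Rabs_le_between.
  apply Rabs_le_between in hx, hy; unfold Rdiv in hx, hy; lra. }
apply Rle_div_r in hd; [|lra].
apply Rlt_div_l in hN; [|exact h]; nra.
Qed.

(** The remainder is kept exactly because the series diverges at [u = 0]. *)
Lemma geometric_expansion (h : R -> R) (eps b u : R) (N : nat) :
  h u * (1 - eps * exp (- 2 * u)) = 2 * exp (- b * u) ->
  h u = psum (fun k => 2 * eps ^ k * exp (- (2 * INR k + b) * u)) N
        + eps ^ N * (exp (- (2 * INR N) * u) * h u).
Proof.
intros E; induction N as [|N IH].
- simpl; replace (- (2 * 0) * u) with 0 by ring; rewrite exp_0; ring.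
- rewrite IH at 1; simpl psum.
  cut (exp (- (2 * INR N) * u) * h u = 2 * exp (- (2 * INR N + b) * u)
       + eps * (exp (- (2 * INR (S N)) * u) * h u)).
  { intros ->; simpl; ring. }
  replace (- (2 * INR N + b) * u) with (- (2 * INR N) * u + - b * u) by ring.
  replace (- (2 * INR (S N)) * u) with (- (2 * INR N) * u + - 2 * u)
    by (rewrite S_INR; ring).
  rewrite !exp_plus.
  set (e := exp (- (2 * INR N) * u)).
  transitivity (e * (2 * exp (- b * u)) + eps * (e * exp (- 2 * u) * h u)); [|ring].
  rewrite <- E; ring.
Qed.

(** The exact remainder after [N + 1] terms is at most [exp (- 2 (N + 1) u)], whose integral is the
    stated error. *)
Lemma is_int_geometric (h w : R -> R) (b l : R) (v : nat -> R) :
  (forall u, 0 < u -> h u * (1 - -1 * exp (- 2 * u)) = 2 * exp (- b * u)) ->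
  (forall u, 0 < u -> Rabs (h u) <= 1) -> (forall u, Rabs (w u) <= 1) ->
  (forall k, is_int (fun u => exp (- (2 * INR k + b) * u) * w u) (v k)) ->
  is_int (fun u => h u * w u) l ->
  forall N, Rabs (l - 2 * psum (fun k => (-1) ^ k * v k) (S N)) <= / 2 / (INR N + 1).
Proof.
intros E hh hw hv hl N; pose proof (pos_INR N).
assert (I : is_int (fun u => (-1) ^ (S N) * (exp (- (2 * INR (S N)) * u) * h u) * w u)
  (l - 2 * psum (fun k => (-1) ^ k * v k) (S N))).
{ apply (is_int_ext (fun u => h u * w u - 2 * psum (fun k => (-1) ^ k *
    (exp (- (2 * INR k + b) * u) * w u)) (S N))).
  - intros u hu; rewrite (geometric_expansion h (-1) b u (S N) (E u hu)) at 1.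
    rewrite Rmult_plus_distr_r.
    set (r := (-1) ^ (S N) * _).
    cut (psum (fun k => 2 * (-1) ^ k * exp (- (2 * INR k + b) * u)) (S N) * w u
      = 2 * psum (fun k => (-1) ^ k * (exp (- (2 * INR k + b) * u) * w u)) (S N)).
    { intros ->; ring. }
    rewrite Rmult_comm, <- !psum_scal; apply psum_ext; intros; ring.
  - apply is_int_minus; [exact hl|]; apply is_int_scal, is_int_psum.
    intros k; apply is_int_scal, hv. }
replace (/ 2 / (INR N + 1)) with (/ (2 * INR (S N))).
2: { rewrite S_INR; field; lra. }
refine (is_int_abs_le _ (fun u => exp (- (2 * INR (S N)) * u)) _ _ _ I _).
- intros u hu; rewrite !Rabs_mult, pow_1_abs, (Rabs_pos_eq (exp _)) by (left; apply exp_pos).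
  pose proof (exp_pos (- (2 * INR (S N)) * u)); pose proof (hh u hu); pose proof (hw u).
  pose proof (Rabs_pos (h u)); pose proof (Rabs_pos (w u)).
  set (e := exp _) in *.
  assert (Rabs (h u) * Rabs (w u) <= 1) by nra.
  replace (1 * (e * Rabs (h u)) * Rabs (w u)) with (e * (Rabs (h u) * Rabs (w u))) by ring.
  nra.
- apply is_int_exp; rewrite S_INR; lra.
Qed.

Lemma sech_geometric (u : R) : sech u * (1 - -1 * exp (- 2 * u)) = 2 * exp (- (1) * u).
Proof.
unfold sech, cosh; pose proof (exp_pos u); pose proof (exp_pos (- u)).
replace (- 2 * u) with (- u + - u) by ring; replace (- (1) * u) with (- u) by ring.
rewrite exp_plus, exp_Ropp; field; nra.
Qed.

Lemma one_sub_tanh_geometric (u : R) :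
  (1 - tanh u) * (1 - -1 * exp (- 2 * u)) = 2 * exp (- 2 * u).
Proof.
unfold tanh, cosh, sinh; pose proof (exp_pos u); pose proof (exp_pos (- u)).
replace (- 2 * u) with (- u + - u) by ring.
rewrite exp_plus, exp_Ropp; field; nra.
Qed.

(** The argument is written [s / 2 * PI] to match the partial fractions at [t = s / 2]. *)
Definition hyp_kernel (q : nat) (s : R) : R :=
  match q with
  | 1%nat => PI / 2 / cosh (s / 2 * PI)
  | _ => PI / 2 / sinh (s / 2 * PI)
  end.

(** The integral (by the geometric expansion) and the closed form (by partial fractions) are both
    within [O(1 / (N + 1))] of the same finite sums. *)
Lemma is_int_sech_cos (s : R) : 0 < s ->
  is_int (fun u => sech u * cos (s * u)) (hyp_kernel 1 s).
Proof.
intros hs.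
assert (hd : decay (fun u => sech u * cos (s * u))).
{ apply decay_cos; split.
  - intros u _; apply (ex_derive_continuous sech); eexists; apply is_derive_sech.
  - exists 2; intros u hu; rewrite Rabs_pos_eq by (left; apply sech_gt_0).
    pose proof (sech_le_exp u); pose proof (exp_neg_le_half u hu); lra. }
destruct (decay_ex_int _ hd) as [l hl].
replace (hyp_kernel 1 s) with l; [exact hl|].
destruct (cosh_partial_fractions (s / 2) ltac:(lra)) as [C hC].
apply (eq_of_approx _ _ (/ 2) (C / (2 * cosh (s / 2 * PI))) (fun N => 2 * psum
  (fun k => (-1) ^ k * ((2 * INR k + 1) / ((2 * INR k + 1) ^ 2 + s ^ 2))) (S N))).
- apply (is_int_geometric sech (fun u => cos (s * u)) 1 l).
  + intros u _; apply sech_geometric.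
  + intros u _; rewrite Rabs_pos_eq by (left; apply sech_gt_0); apply sech_le_1.
  + intros; apply abs_cos_le.
  + intros k; apply is_int_exp_cos; pose proof (pos_INR k); lra.
  + exact hl.
- intros N; pose proof (cosh_gt_0 (s / 2 * PI)) as hp; pose proof (pos_INR N).
  specialize (hC N).
  rewrite (psum_ext _ (fun k => 2 * ((-1) ^ k * ((2 * INR k + 1)
     / ((2 * INR k + 1) ^ 2 + s ^ 2))))), psum_scal in hC.
  2: { intros k _; pose proof (pos_INR k); field; repeat split; nra. }
  set (w := psum _ (S N)) in *; set (c := cosh _) in *.
  unfold hyp_kernel; fold c; rewrite Rabs_minus_sym.
  replace (2 * w - PI / 2 / c) with ((2 * c * (2 * w) - PI) * / (2 * c)) by (field; lra).
  rewrite Rabs_mult, (Rabs_pos_eq (/ _)) by (left; apply Rinv_0_lt_compat; lra).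
  replace (C / (2 * c) / (INR N + 1)) with (C / (INR N + 1) * / (2 * c)) by (field; lra).
  apply Rmult_le_compat_r; [left; apply Rinv_0_lt_compat; lra|exact hC].
Qed.

Lemma sinh_gt_0 (u : R) : 0 < u -> 0 < sinh u.
Proof.
intros hu; unfold sinh; assert (exp (- u) < exp u) by (apply exp_increasing; lra); lra.
Qed.

Lemma decay_one_sub_tanh : decay (fun u => 1 - tanh u).
Proof.
split.
- intros u _; apply (ex_derive_continuous (fun v => 1 - tanh v)).
  eexists; apply (is_derive_minus (fun _ => 1) tanh);
    [apply is_derive_const|apply is_derive_tanh].
- exists 2; intros u hu; pose proof (tanh_abs_lt u); rewrite Rabs_pos_eq by lra.
  pose proof (one_sub_tanh_geometric u); pose proof (exp_pos (- 2 * u)).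
  assert (exp (- 2 * u) <= exp (- u / 2)) by (apply exp_le; lra); nra.
Qed.

(** Same comparison, with [1 - tanh] because [tanh] itself does not decay. The term [/ s] is the
    pole [/ t ^ 2] of the partial fractions. *)
Lemma is_int_tanh_sin (s : R) : 0 < s ->
  is_int (fun u => (1 - tanh u) * sin (s * u)) (/ s - hyp_kernel 2 s).
Proof.
intros hs.
pose proof (decay_sin _ s decay_one_sub_tanh) as hd.
destruct (decay_ex_int _ hd) as [l hl].
replace (/ s - hyp_kernel 2 s) with l; [exact hl|].
destruct (sinh_partial_fractions (s / 2) ltac:(lra)) as [C hC].
assert (hp : 0 < sinh (s / 2 * PI)).
{ apply sinh_gt_0; pose proof PI_RGT_0; nra. }
apply (eq_of_approx _ _ (/ 2) (C / (2 * sinh (s / 2 * PI))) (fun N => 2 * psum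
  (fun k => (-1) ^ k * (s / ((2 * INR k + 2) ^ 2 + s ^ 2))) (S N))).
- apply (is_int_geometric (fun u => 1 - tanh u) (fun u => sin (s * u)) 2 l).
  + intros u _; apply one_sub_tanh_geometric.
  + intros u hu; pose proof (tanh_abs_lt u); pose proof (tanh_bounds u hu).
    rewrite Rabs_pos_eq; lra.
  + intros; apply abs_sin_le.
  + intros k; apply is_int_exp_sin; pose proof (pos_INR k); lra.
  + exact hl.
- intros N; pose proof (pos_INR N) as hN.
  (* The geometric side sums [N + 1] terms, hence the shift. The resulting [C / (N + 2)] is weakened
     to [C / (N + 1)], which needs [0 <= C], read off from the bound itself. *)
  specialize (hC (S N)).
  rewrite (psum_ext _ (fun k => 4 / s * ((-1) ^ k * (s
     / ((2 * INR k + 2) ^ 2 + s ^ 2))))), psum_scal in hC.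
  2: { intros k _; pose proof (pos_INR k); field; repeat split; nra. }
  set (w := psum _ (S N)) in *; set (c := sinh _) in *.
  unfold hyp_kernel; fold c.
  replace (/ s - PI / 2 / c - 2 * w)
    with ((s / 2 * c * (/ (s / 2) ^ 2 - 2 * (4 / s * w)) - PI) * / (2 * c)) by (field; lra).
  rewrite Rabs_mult, (Rabs_pos_eq (/ _)) by (left; apply Rinv_0_lt_compat; lra).
  replace (C / (2 * c) / (INR N + 1)) with (C / (INR N + 1) * / (2 * c)) by (field; lra).
  apply Rmult_le_compat_r; [left; apply Rinv_0_lt_compat; lra|].
  apply Rle_trans with (1 := hC).
  assert (hC0 : 0 <= C).
  { rewrite S_INR in hC; match type of hC with Rabs ?x <= _ => pose proof (Rabs_pos x) end.
    assert (0 <= C / (INR N + 1 + 1)) by lra.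
    apply Rle_div_r in H0; lra. }
  unfold Rdiv; apply Rmult_le_compat_l; [exact hC0|].
  apply Rinv_le_contravar; rewrite ?S_INR; lra.
Qed.

Lemma is_derive_sin_mul (s u : R) : is_derive (fun v => sin (s * v)) u (s * cos (s * u)).
Proof. auto_derive; [trivial|ring]. Qed.

Lemma is_derive_cos_mul (s u : R) : is_derive (fun v => cos (s * v)) u (- s * sin (s * u)).
Proof. auto_derive; [trivial|ring]. Qed.

Lemma is_derive_mult_R (f g : R -> R) (x df dg : R) :
  is_derive f x df -> is_derive g x dg ->
  is_derive (fun y => f y * g y) x (df * g x + f x * dg).
Proof. intros hf hg; apply (is_derive_mult f g); auto; intros; apply Rmult_comm. Qed.

Lemma is_derive_minus_R (f g : R -> R) (x df dg : R) :
  is_derive f x df -> is_derive g x dg ->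
  is_derive (fun y => f y - g y) x (df - dg).
Proof. apply (is_derive_minus f g). Qed.

Lemma is_derive_scal_R (c : R) (f : R -> R) (x df : R) :
  is_derive f x df -> is_derive (fun y => c * f y) x (c * df).
Proof. apply (is_derive_scal f x c). Qed.

(** Two integrations by parts; the boundary terms vanish since [g 0 = 0]. *)
Lemma is_int_second_derivative_sin (g g1 g2 : R -> R) (s : R) :
  (forall u, is_derive g u (g1 u)) -> (forall u, is_derive g1 u (g2 u)) ->
  (forall u, continuous g2 u) -> g 0 = 0 -> decay g -> decay g1 ->
  is_int (fun u => (g2 u + s ^ 2 * g u) * sin (s * u)) 0.
Proof.
intros h1 h2 hc h0 d0 d1.
set (F := fun u => g1 u * sin (s * u) - s * (g u * cos (s * u))).
assert (hF : forall u, is_derive F u ((g2 u + s ^ 2 * g u) * sin (s * u))).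
{ intros u; unfold F; evar_last.
  - apply is_derive_minus_R.
    + apply is_derive_mult_R; [apply h2|apply is_derive_sin_mul].
    + apply is_derive_scal_R, is_derive_mult_R; [apply h1|apply is_derive_cos_mul].
  - cbv beta; ring. }
assert (I : is_int (fun u => (g2 u + s ^ 2 * g u) * sin (s * u)) (0 - F 0)).
{ apply (is_int_antiderivative F).
  - intros; apply hF.
  - intros u _; apply (continuous_mult (fun u => g2 u + s ^ 2 * g u) (fun u => sin (s * u))).
    + apply (continuous_plus g2 (fun u => s ^ 2 * g u)); [apply hc|].
      apply (continuous_scal_r (s ^ 2) g), (ex_derive_continuous g u); eexists; apply h1.
    + apply continuous_sin_mul.
  - apply filterlim_at_right_continuous, (ex_derive_continuous F); eexists; apply hF.
  - apply decay_lim, decay_minus; [apply decay_sin, d1|apply decay_scal, decay_cos, d0]. }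
replace (0 - F 0) with 0 in I; [exact I|].
unfold F; rewrite Rmult_0_r, sin_0, h0; ring.
Qed.

(** Summed over [p], these give the coefficient of [z^(2j+q)] in [(z^2 - 1)^j] times
    [sinh (s arcsin z)] for [q = 1], or times [cosh (s arcsin z) - 1] for [q = 2]. *)
Definition mix_term (q j : nat) (s : R) (p : nat) : R :=
  asin_mix q j (q + 2 * p) * (s ^ (q + 2 * p) / INR (fact (q + 2 * p))).

(** Dividing by [e!] cancels the factor [e (e - 1)] and leaves [s^2] times the term of index
    [p - 1]; this shift is why the last sum has one term fewer. *)
Lemma mix_term_rec (q j N : nat) (s : R) :
  (q = 1 \/ q = 2)%nat ->
  (2 * INR j + INR q + 2) * (2 * INR j + INR q + 1) * psum (mix_term q (S j) s) (S N)
  = mid_coef q j * psum (mix_term q j s) (S N)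
    - 2 * INR j * (2 * INR j + 1) * psum (mix_term q (j - 1) s) (S N)
    - s ^ 2 * psum (mix_term q j s) N.
Proof.
intros hq.
set (T := fun p => match p with O => 0 | S p' => s ^ 2 * mix_term q j s p' end).
assert (HT : s ^ 2 * psum (mix_term q j s) N = psum T (S N)).
{ rewrite psum_shift; simpl T; rewrite Rplus_0_l; symmetry; apply psum_scal. }
rewrite HT.
rewrite <- !psum_scal.
set (n := S N); clearbody n; clear HT N.
induction n as [|n IH]; [simpl; ring|]; simpl psum.
cut ((2 * INR j + INR q + 2) * (2 * INR j + INR q + 1) * mix_term q (S j) s n
  = mid_coef q j * mix_term q j s n
    - 2 * INR j * (2 * INR j + 1) * mix_term q (j - 1) s n - T n).
{ intros E; rewrite IH, E; ring. }
unfold mix_term; rewrite <- Rmult_assoc, asin_mix_rec.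
set (w := s ^ _ / _).
assert (E : INR (q + 2 * n) * (INR (q + 2 * n) - 1) * asin_mix q j (q + 2 * n - 2) * w = T n).
{ destruct n as [|n].
  - pose proof (asin_mix_prev q j 0 hq) as P; simpl prev_term in P; simpl T.
    rewrite Rmult_0_r in P.
    apply (f_equal Ropp) in P; rewrite Ropp_involutive, Ropp_0 in P.
    rewrite P; ring.
  - simpl T; unfold mix_term, w.
    replace (q + 2 * S n - 2)%nat with (q + 2 * n)%nat by lia.
    replace (q + 2 * S n)%nat with (S (S (q + 2 * n))) by lia.
    rewrite !fact_simpl, !mult_INR, <- !tech_pow_Rmult.
    pose proof (INR_fact_neq_0 (q + 2 * n)); pose proof (pos_INR (q + 2 * n)).
    rewrite !S_INR; field; repeat split; lra. }
rewrite <- E; ring.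
Qed.

Lemma mix_term_out (q j p : nat) (s : R) :
  (q = 1 \/ q = 2)%nat -> (j < p)%nat -> mix_term q j s p = 0.
Proof.
intros hq hp; pose proof (signed_mix_out q hq j p hp) as h; unfold signed_mix in h.
apply Rmult_integral in h; destruct h as [h|h].
- exfalso; revert h; apply pow_nonzero; lra.
- unfold mix_term; rewrite h; ring.
Qed.

Lemma is_int_base (q : nat) (s : R) : (q = 1 \/ q = 2)%nat -> 0 < s ->
  is_int (fun u => hyp q 1 u * sin (s * u)) (hyp_kernel q s * (s ^ q / INR (fact q))).
Proof.
intros [-> | ->] hs.
(* [tanh sech] is the derivative of [- sech], so one integration by parts leads to the cosine
   transform of [sech]. *)
- set (F := fun u => - 1 * (hyp 1 0 u * sin (s * u))).
  assert (hF : forall u, is_derive F u (hyp 1 1 u * sin (s * u) - s * (sech u * cos (s * u)))).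
  { intros u; unfold F; evar_last.
    - apply is_derive_scal_R, is_derive_mult_R; [apply is_derive_hyp|apply is_derive_sin_mul].
    - cbv beta; unfold hyp; simpl; ring. }
  assert (I : is_int (fun u => hyp 1 1 u * sin (s * u) - s * (sech u * cos (s * u))) (0 - F 0)).
  { apply (is_int_antiderivative F).
    - intros; apply hF.
    - intros u _; apply (continuous_minus (fun u => hyp 1 1 u * sin (s * u))
        (fun u => s * (sech u * cos (s * u)))).
      + apply (continuous_mult (hyp 1 1) (fun u => sin (s * u)));
          [apply continuous_hyp|apply continuous_sin_mul].
      + apply (continuous_scal_r s (fun u => sech u * cos (s * u))).
        apply (continuous_mult sech (fun u => cos (s * u))); [|apply continuous_cos_mul].
        apply (ex_derive_continuous sech); eexists; apply is_derive_sech.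
    - apply filterlim_at_right_continuous, (ex_derive_continuous F); eexists; apply hF.
    - apply decay_lim, decay_scal, decay_sin, decay_hyp; lia. }
  pose proof (is_int_plus _ _ _ _ I (is_int_scal s _ _ (is_int_sech_cos s hs))) as J.
  replace (hyp_kernel 1 s * (s ^ 1 / INR (fact 1))) with (0 - F 0 + s * hyp_kernel 1 s).
  + revert J; apply is_int_ext; intros; ring.
  + unfold F; rewrite Rmult_0_r, sin_0; simpl (INR (fact 1)); field.
(* Two integrations by parts, through the primitives [- sech^2 / 2] of [tanh sech^2] and [tanh - 1]
   of [sech^2]. The boundary value [s / 2] at 0 cancels the part of the transform of [1 - tanh]
   coming from [/ s]. *)
- set (F := fun u => - / 2 * (hyp 2 0 u * sin (s * u))
      - s / 2 * ((1 - tanh u) * cos (s * u))).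
  assert (hF : forall u, is_derive F u
    (hyp 2 1 u * sin (s * u) + s ^ 2 / 2 * ((1 - tanh u) * sin (s * u)))).
  { intros u; unfold F; evar_last.
    - apply is_derive_minus_R; apply is_derive_scal_R, is_derive_mult_R.
      + apply is_derive_hyp.
      + apply is_derive_sin_mul.
      + apply is_derive_minus_R; [apply is_derive_const|apply is_derive_tanh].
      + apply is_derive_cos_mul.
    - cbv beta; rewrite <- sech_sqr; unfold hyp, zero; simpl; field. }
  assert (I : is_int (fun u => hyp 2 1 u * sin (s * u)
     + s ^ 2 / 2 * ((1 - tanh u) * sin (s * u))) (0 - F 0)).
  { apply (is_int_antiderivative F).
    - intros; apply hF.
    - intros u _; apply (continuous_plus (fun u => hyp 2 1 u * sin (s * u))
        (fun u => s ^ 2 / 2 * ((1 - tanh u) * sin (s * u)))).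
      + apply (continuous_mult (hyp 2 1) (fun u => sin (s * u)));
          [apply continuous_hyp|apply continuous_sin_mul].
      + apply (continuous_scal_r (s ^ 2 / 2) (fun u => (1 - tanh u) * sin (s * u))).
        apply (continuous_mult (fun u => 1 - tanh u) (fun u => sin (s * u)));
          [|apply continuous_sin_mul].
        apply (ex_derive_continuous (fun u => 1 - tanh u)); eexists.
        apply is_derive_minus_R; [apply is_derive_const|apply is_derive_tanh].
    - apply filterlim_at_right_continuous, (ex_derive_continuous F); eexists; apply hF.
    - apply decay_lim, decay_minus; apply decay_scal;
        [apply decay_sin, decay_hyp; lia|apply decay_cos, decay_one_sub_tanh]. }
  pose proof (is_int_minus _ _ _ _ I
    (is_int_scal (s ^ 2 / 2) _ _ (is_int_tanh_sin s hs))) as J.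
  replace (hyp_kernel 2 s * (s ^ 2 / INR (fact 2)))
    with (0 - F 0 - s ^ 2 / 2 * (/ s - hyp_kernel 2 s)).
  + revert J; apply is_int_ext; intros; ring.
  + unfold F; rewrite Rmult_0_r, sin_0, cos_0, tanh_0; simpl (INR (fact 2)).
    set (x := hyp_kernel 2 s); field; lra.
Qed.

Lemma continuous_hyp_comb (q m n : nat) (a b u : R) :
  continuous (fun v => a * hyp q m v - b * hyp q n v) u.
Proof.
apply (continuous_minus (fun v => a * hyp q m v) (fun v => b * hyp q n v)).
- apply (continuous_scal_r a (hyp q m)), continuous_hyp.
- apply (continuous_scal_r b (hyp q n)), continuous_hyp.
Qed.

(** Differentiating twice gives [K g_(j+1) = g_j'' + mid_coef g_j - 2j (2j+1) g_(j-1)]. Under the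
    sine transform [g_j''] becomes [- s^2 g_j], and what remains is [mix_term_rec]. *)
Lemma sine_transform (q : nat) (s : R) : (q = 1 \/ q = 2)%nat -> 0 < s ->
  forall j N, (j < N)%nat ->
  is_int (fun u => hyp q (2 * j + 1) u * sin (s * u))
    (hyp_kernel q s * psum (mix_term q j s) N).
Proof.
intros hq hs.
assert (hq1 : (1 <= q)%nat) by lia.
cut (forall j, (forall N, (j < N)%nat ->
  is_int (fun u => hyp q (2 * j + 1) u * sin (s * u))
    (hyp_kernel q s * psum (mix_term q j s) N)) /\
  (forall N, (j < N)%nat ->
  is_int (fun u => hyp q (2 * (j - 1) + 1) u * sin (s * u))
    (hyp_kernel q s * psum (mix_term q (j - 1) s) N))).
{ intros H j; apply H. }
induction j as [|j [IH1 IH2]].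
- assert (B : forall N, (0 < N)%nat ->
    is_int (fun u => hyp q (2 * 0 + 1) u * sin (s * u))
      (hyp_kernel q s * psum (mix_term q 0 s) N)).
  { intros [|N] hN; [lia|].
    rewrite psum_shift, (psum_zero (fun k => mix_term q 0 s (S k))).
    2: { intros k; apply mix_term_out; [exact hq|lia]. }
    unfold mix_term; rewrite asin_mix_base by exact hq.
    rewrite Nat.mul_0_r, Nat.add_0_r, Rmult_1_l, Rplus_0_r.
    apply is_int_base; assumption. }
  split; exact B.
- split; [|intros N hN; replace (S j - 1)%nat with j by lia; apply IH1; lia].
  intros [|N] hN; [lia|].
  set (m := (2 * j + 1)%nat) in *.
  pose proof (pos_INR j) as hj; pose proof (pos_INR q).
  set (K := (2 * INR j + INR q + 2) * (2 * INR j + INR q + 1)).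
  assert (hK : 0 < K) by (apply Rmult_lt_0_compat; lra).
  set (g1 := fun u => INR m * hyp q (m - 1) u - (INR m + INR q) * hyp q (m + 1) u).
  set (g2 := fun u =>
    INR m * (INR (m - 1) * hyp q (m - 1 - 1) u - (INR (m - 1) + INR q) * hyp q (m - 1 + 1) u)
    - (INR m + INR q) * (INR (m + 1) * hyp q (m + 1 - 1) u
                         - (INR (m + 1) + INR q) * hyp q (m + 1 + 1) u)).
  assert (Z : is_int (fun u => (g2 u + s ^ 2 * hyp q m u) * sin (s * u)) 0).
  { apply (is_int_second_derivative_sin (hyp q m) g1 g2).
    - intros; apply is_derive_hyp.
    - intros u; apply is_derive_minus_R; apply is_derive_scal_R, is_derive_hyp.
    - intros u; apply (continuous_minus
        (fun u => INR m * (INR (m - 1) * hyp q (m - 1 - 1) u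
          - (INR (m - 1) + INR q) * hyp q (m - 1 + 1) u))
        (fun u => (INR m + INR q) * (INR (m + 1) * hyp q (m + 1 - 1) u
                         - (INR (m + 1) + INR q) * hyp q (m + 1 + 1) u)));
      [apply (continuous_scal_r (INR m) (fun u => INR (m - 1) * hyp q (m - 1 - 1) u
          - (INR (m - 1) + INR q) * hyp q (m - 1 + 1) u))
      |apply (continuous_scal_r (INR m + INR q) (fun u => INR (m + 1) * hyp q (m + 1 - 1) u
                         - (INR (m + 1) + INR q) * hyp q (m + 1 + 1) u))];
      apply continuous_hyp_comb.
    - unfold hyp, m; rewrite tanh_0, Nat.add_1_r; simpl; ring.
    - apply decay_hyp, hq1.
    - apply decay_minus; apply decay_scal, decay_hyp, hq1. }
  pose proof (is_int_plus _ _ _ _ Z (is_int_minus _ _ _ _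
    (is_int_scal (mid_coef q j - s ^ 2) _ _ (IH1 (S N) ltac:(lia)))
    (is_int_scal (2 * INR j * (2 * INR j + 1)) _ _ (IH2 (S N) ltac:(lia))))) as J.
  pose proof (is_int_scal (/ K) _ _ J) as J'.
  replace (hyp_kernel q s * psum (mix_term q (S j) s) (S N)) with
    (/ K * (0 + ((mid_coef q j - s ^ 2) * (hyp_kernel q s * psum (mix_term q j s) (S N))
     - 2 * INR j * (2 * INR j + 1) * (hyp_kernel q s * psum (mix_term q (j - 1) s) (S N))))).
  + revert J'; apply is_int_ext; intros u hu.
    apply (Rmult_eq_reg_l K); [|lra].
    rewrite <- Rmult_assoc, Rinv_r, Rmult_1_l by lra.
    unfold g2.
    replace (m - 1 + 1)%nat with m by lia; replace (m + 1 - 1)%nat with m by lia.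
    replace (m + 1 + 1)%nat with (2 * S j + 1)%nat by lia.
    assert (Em : INR m = 2 * INR j + 1).
    { unfold m; rewrite plus_INR, mult_INR; simpl; ring. }
    assert (Em1 : INR (m - 1) = 2 * INR j).
    { unfold m; replace (2 * j + 1 - 1)%nat with (2 * j)%nat by lia.
      rewrite mult_INR; simpl; ring. }
    assert (Ep : INR (m + 1) = 2 * INR j + 2).
    { rewrite plus_INR, Em; simpl; ring. }
    rewrite Em, Em1, Ep.
    (* At [j = 0] both truncated exponents are meaningless, but the factor [2 j] removes them. *)
    assert (V : 2 * INR j * hyp q (m - 1 - 1) u = 2 * INR j * hyp q (2 * (j - 1) + 1) u).
    { destruct j as [|j]; [simpl; ring|]; do 2 f_equal; lia. }
    rewrite V; unfold K, mid_coef; ring.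
  + apply (Rmult_eq_reg_l K); [|lra].
    rewrite <- Rmult_assoc, Rinv_r, Rmult_1_l by lra.
    pose proof (mix_term_rec q j N s hq) as R; fold K in R.
    transitivity (hyp_kernel q s * (K * psum (mix_term q (S j) s) (S N))); [rewrite R|ring].
    (* The sums of lengths [N] and [N + 1] agree because the term of index [N > j] is 0. *)
    simpl psum; rewrite (mix_term_out q j N s hq) by lia; ring.
Qed.

(** * Inversion at the origin *)

Lemma filterlim_linear_0 (F : R -> R) (l C : R) :
  (forall u, 0 < u < 1 -> Rabs (F u - l) <= C * u) ->
  filterlim F (at_right 0) (locally l).
Proof.
intros h P [eps hP]; pose proof (cond_pos eps) as he.
assert (hC : 0 <= C).
{ pose proof (h (/ 2) ltac:(lra)) as h2; pose proof (Rabs_pos (F (/ 2) - l)); lra. }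
unfold filtermap; eapply filter_imp; [|apply (at_right_0_between (Rmin 1 (eps / (C + 1))))].
- intros u [hu0 hu]; apply hP.
  change (Rabs (F u - l) < eps).
  pose proof (Rmin_l 1 (eps / (C + 1))); pose proof (Rmin_r 1 (eps / (C + 1))).
  apply Rle_lt_trans with (1 := h u ltac:(lra)).
  assert (hlt : u < eps / (C + 1)) by lra.
  apply Rlt_div_r in hlt; [nra|lra].
- apply Rmin_pos; [lra|apply Rdiv_lt_0_compat; lra].
Qed.

Lemma filterlim_inv_infty (F : R -> R) (C : R) :
  (forall u, 0 < u -> Rabs (F u) <= C / u) ->
  filterlim F (Rbar_locally p_infty) (locally 0).
Proof.
intros h P [eps hP]; pose proof (cond_pos eps) as he.
assert (hC : 0 <= C).
{ pose proof (h 1 ltac:(lra)) as h2; pose proof (Rabs_pos (F 1)).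
  unfold Rdiv in h2; rewrite Rinv_1, Rmult_1_r in h2; lra. }
assert (hq : 0 <= C / eps) by (apply Rmult_le_pos; [lra|left; apply Rinv_0_lt_compat, he]).
exists (1 + C / eps); intros u hu; apply hP.
change (Rabs (F u - 0) < eps); rewrite Rminus_0_r.
apply Rle_lt_trans with (1 := h u ltac:(lra)).
apply Rlt_div_l; [lra|].
apply Rle_lt_trans with (eps * (C / eps)); [right; field; lra|].
apply Rmult_lt_compat_l; lra.
Qed.

(** Two uses of the mean value bound give the constant 1 instead of [1/2], which is enough here. *)
Lemma cos_taylor (a b : R) : Rabs (cos (a + b) - cos a + b * sin a) <= b ^ 2.
Proof.
assert (H : forall a b, 0 <= b -> Rabs (cos (a + b) - cos a + b * sin a) <= b ^ 2).
{ clear a b; intros a b hb.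
  replace (b ^ 2) with (b * b) by ring.
  apply (abs_le_of_derive (fun t => cos (a + t) - cos a + t * sin a)
    (fun t => sin a - sin (a + t)) b b hb).
  - intros y _; auto_derive; [trivial|ring].
  - intros y hy; apply Rle_trans with (1 * y); [|lra].
    apply (abs_le_of_derive (fun t => sin a - sin (a + t)) (fun t => - cos (a + t)) 1 y).
    + lra.
    + intros; auto_derive; [trivial|ring].
    + intros; rewrite Rabs_Ropp; apply abs_cos_le.
    + rewrite Rplus_0_r; ring.
  - rewrite Rplus_0_r; ring. }
destruct (Rle_lt_dec 0 b) as [hb|hb]; [apply H, hb|].
pose proof (H (- a) (- b) ltac:(lra)) as h.
replace (- a + - b) with (- (a + b)) in h by ring.
rewrite !cos_neg, sin_neg in h.
replace (- b * - sin a) with (b * sin a) in h by ring.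
replace ((- b) ^ 2) with (b ^ 2) in h by ring; exact h.
Qed.

(** [G M = int k cos (M u)] satisfies [G' = - S] and tends to [0] at infinity,
    so integrating the sine transform [S] over [(0, oo)] recovers [G 0]. *)
Lemma is_int_sine_transform (k k1 S : R -> R) (B l : R) :
  (forall u, 0 < u -> is_derive k u (k1 u)) -> decay k -> decay k1 ->
  (forall u, 0 < u -> Rabs (k u * u ^ 2) <= B * exp (- u / 2)) ->
  (forall s, 0 < s -> is_int (fun u => k u * u * sin (s * u)) (S s)) ->
  (forall s, 0 < s -> continuous S s) ->
  is_int k l -> is_int S l.
Proof.
intros hk dk dk1 hB hS hcS hl.
set (G := fun M => RInt_gen (V := R_CompleteNormedModule)
  (fun u => k u * cos (M * u)) (at_right 0) (Rbar_locally p_infty)).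
assert (HG : forall M, is_int (fun u => k u * cos (M * u)) (G M)).
{ intros M; apply (RInt_gen_correct (V := R_CompleteNormedModule)).
  apply (decay_ex_int _ (decay_cos k M dk)). }
(* A second-order expansion of [G] with explicit remainder, the [u^2] being paid for by the bound on
   [k u * u ^ 2]. It yields both the derivative for [M > 0] and the limit at 0. *)
assert (Q : forall M h L, is_int (fun u => k u * u * sin (M * u)) L ->
  Rabs (G (M + h) - G M + h * L) <= 2 * (h ^ 2 * B)).
{ intros M h L hL.
  pose proof (is_int_plus _ _ _ _ (is_int_minus _ _ _ _ (HG (M + h)) (HG M))
    (is_int_scal h _ _ hL)) as J.
  refine (is_int_le_exp _ (h ^ 2 * B) _ _ J); intros u hu.
  replace (k u * cos ((M + h) * u) - k u * cos (M * u) + h * (k u * u * sin (M * u)))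
    with (k u * (cos (M * u + h * u) - cos (M * u) + h * u * sin (M * u))).
  2: { replace ((M + h) * u) with (M * u + h * u) by ring; ring. }
  rewrite Rabs_mult.
  apply Rle_trans with (Rabs (k u) * (h * u) ^ 2).
  - apply Rmult_le_compat_l; [apply Rabs_pos|apply cos_taylor].
  - pose proof (hB u hu) as b; rewrite Rabs_mult, (Rabs_pos_eq (u ^ 2)) in b by nra.
    replace (Rabs (k u) * (h * u) ^ 2) with (h ^ 2 * (Rabs (k u) * u ^ 2)) by ring.
    rewrite Rmult_assoc; apply Rmult_le_compat_l; [nra|exact b]. }
assert (hB0 : 0 <= B).
{ pose proof (hB 1 Rlt_0_1) as b; pose proof (Rabs_pos (k 1 * 1 ^ 2)).
  pose proof (exp_pos (- (1) / 2)); apply Rnot_lt_le; intros hb; nra. }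
assert (hG0 : G 0 = l).
{ apply (is_int_unique k); [|exact hl].
  apply (is_int_ext (fun u => k u * cos (0 * u))); [|apply HG].
  intros; rewrite Rmult_0_l, cos_0; ring. }
rewrite <- hG0; replace (G 0) with (0 - - G 0) by ring.
apply (is_int_antiderivative (fun M => - G M)).
- intros M hM; apply is_derive_Reals; intros eps heps.
  assert (hd : 0 < eps / (2 * B + 1)) by (apply Rdiv_lt_0_compat; lra).
  exists (mkposreal _ hd); intros h hh0 hh; simpl in hh.
  pose proof (Q M h _ (hS M hM)) as q.
  replace ((- G (M + h) - - G M) / h - S M)
    with (- (G (M + h) - G M + h * S M) * / h) by (field; exact hh0).
  rewrite Rabs_mult, Rabs_Ropp, Rabs_inv.
  pose proof (Rabs_pos_lt h hh0) as hp.
  apply (Rmult_lt_reg_r (Rabs h)); [exact hp|].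
  rewrite Rmult_assoc, Rinv_l, Rmult_1_r by lra.
  apply Rle_lt_trans with (1 := q).
  replace (h ^ 2) with (Rabs h * Rabs h) by (rewrite <- Rabs_mult, Rabs_pos_eq; nra).
  apply Rlt_div_r in hh; [|lra]; nra.
- exact hcS.
(* At [M = 0] the first-order term is 0, so [G h - G 0] is [O(h^2)]. *)
- apply (filterlim_linear_0 _ _ (2 * B)); intros h hh.
  assert (J : is_int (fun u => k u * u * sin (0 * u)) 0).
  { apply (is_int_ext (fun _ => 0)); [|exact is_int_zero].
    intros u _; rewrite Rmult_0_l, sin_0; ring. }
  pose proof (Q 0 h 0 J) as q; rewrite Rplus_0_l, Rmult_0_r, Rplus_0_r in q.
  replace (- G h - - G 0) with (- (G h - G 0)) by ring; rewrite Rabs_Ropp.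
  apply Rle_trans with (1 := q).
  assert (0 <= B * (h * (1 - h))) by (apply Rmult_le_pos; nra); nra.
- pose proof dk1 as [hc1 [C1 b1]].
  apply (filterlim_inv_infty _ (2 * C1)); intros M hM; rewrite Rabs_Ropp.
  (* Integrating [F'] over the half-line, with both boundary limits 0, gives
     [M G(M) = - int k1 sin (M u)], whence [G(M) = O(1 / M)]. *)
  set (F := fun u => k u * sin (M * u)).
  assert (I : is_int (fun u => k1 u * sin (M * u) + M * (k u * cos (M * u))) (0 - 0)).
  { apply (is_int_antiderivative F).
    - intros u hu; unfold F; evar_last.
      + apply is_derive_mult_R; [apply hk, hu|apply is_derive_sin_mul].
      + cbv beta; ring.
    - intros u hu; apply (continuous_plus (fun u => k1 u * sin (M * u))
        (fun u => M * (k u * cos (M * u)))).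
      + apply (continuous_mult k1 (fun u => sin (M * u))); [apply hc1, hu|].
        apply continuous_sin_mul.
      + apply (continuous_scal_r M (fun u => k u * cos (M * u))).
        apply (continuous_mult k (fun u => cos (M * u))); [apply dk, hu|].
        apply continuous_cos_mul.
    - destruct dk as [_ [C0 b0]].
      apply (filterlim_linear_0 _ _ (C0 * M)); intros u hu.
      rewrite Rminus_0_r; unfold F; rewrite Rabs_mult, Rmult_assoc.
      apply Rmult_le_compat; try apply Rabs_pos.
      + apply Rle_trans with (1 := b0 u ltac:(lra)).
        assert (exp (- u / 2) <= 1) by (rewrite <- exp_0; apply exp_le; lra).
        assert (0 <= C0).
        { pose proof (b0 u ltac:(lra)); pose proof (Rabs_pos (k u)).
          pose proof (exp_pos (- u / 2)); apply Rnot_lt_le; intros hb; nra. }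
        nra.
      + apply Rle_trans with (1 * (M * u)); [|lra].
        apply (abs_le_of_derive sin cos 1 (M * u)).
        * nra.
        * intros; auto_derive; [trivial|ring].
        * intros; apply abs_cos_le.
        * exact sin_0.
    - apply decay_lim, decay_sin, dk. }
  assert (J : is_int (fun u => k1 u * sin (M * u)) (0 - 0 - M * G M)).
  { pose proof (is_int_minus _ _ _ _ I (is_int_scal M _ _ (HG M))) as J.
    revert J; apply is_int_ext; intros; ring. }
  assert (b : Rabs (0 - 0 - M * G M) <= 2 * C1).
  { refine (is_int_le_exp _ C1 _ _ J); intros u hu; rewrite Rabs_mult.
    pose proof (b1 u hu); pose proof (abs_sin_le (M * u)).
    pose proof (Rabs_pos (k1 u)); pose proof (Rabs_pos (sin (M * u))); nra. }
  apply Rle_div_r; [lra|].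
  replace (0 - 0 - M * G M) with (- (M * G M)) in b by ring.
  rewrite Rabs_Ropp, Rabs_mult, (Rabs_pos_eq M) in b by lra; lra.
Qed.

(** * The integrand [g_j(u) / u = hyp q (2 j) u * tanhc u] *)

Definition tanhc (u : R) : R := tanh u / u.

Definition tanhc1 (u : R) : R := ((1 - tanh u * tanh u) * u - tanh u) / u ^ 2.

Lemma is_derive_tanhc (u : R) : 0 < u -> is_derive tanhc u (tanhc1 u).
Proof.
intros hu; evar_last.
- apply (is_derive_div tanh (fun v => v)); [apply is_derive_tanh|apply is_derive_id|lra].
- unfold tanhc1, one; simpl; field; lra.
Qed.

Lemma tanhc_le (u : R) : 0 < u -> Rabs (tanhc u) <= 1.
Proof.
intros hu; unfold tanhc; pose proof (tanh_bounds u hu).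
rewrite Rabs_div, !Rabs_pos_eq by lra; apply Rle_div_l; lra.
Qed.

Lemma tanhc1_le (u : R) : 0 < u -> Rabs (tanhc1 u) <= 2.
Proof.
intros hu; unfold tanhc1; rewrite Rabs_div by nra.
rewrite (Rabs_pos_eq (u ^ 2)) by nra; apply Rle_div_l; [nra|].
pose proof (tanh_bounds u hu) as hb; pose proof (tanh_abs_lt u) as hl.
assert (h : Rabs (u - tanh u) <= u * u).
{ apply (abs_le_of_derive (fun v => v - tanh v) (fun v => tanh v * tanh v)).
  - lra.
  - intros y _; evar_last.
    + apply is_derive_minus_R; [apply is_derive_id|apply is_derive_tanh].
    + unfold one; simpl; ring.
  - intros y hy; pose proof (tanh_abs_lt y).
    rewrite Rabs_pos_eq by nra.
    destruct (Req_dec y 0) as [->|hy0]; [rewrite tanh_0; nra|].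
    pose proof (tanh_bounds y ltac:(lra)); nra.
  - rewrite tanh_0; ring. }
apply Rabs_le_between in h.
assert (0 <= u * (tanh u * tanh u) <= u * u).
{ assert (tanh u * tanh u <= u) by nra; split; nra. }
apply Rabs_le_between; simpl; lra.
Qed.

Lemma continuous_tanhc (u : R) : 0 < u -> continuous tanhc u.
Proof.
intros hu; apply (ex_derive_continuous tanhc u); eexists; apply is_derive_tanhc, hu.
Qed.

Lemma continuous_tanhc1 (u : R) : 0 < u -> continuous tanhc1 u.
Proof.
intros hu.
apply (ex_derive_continuous tanhc1 u); eexists.
apply (is_derive_div (fun v => (1 - tanh v * tanh v) * v - tanh v) (fun v => v ^ 2)).
- apply is_derive_minus_R; [|apply is_derive_tanh].
  apply is_derive_mult_R; [|apply is_derive_id].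
  apply is_derive_minus_R; [apply is_derive_const|].
  apply is_derive_mult_R; apply is_derive_tanh.
- apply (is_derive_pow (fun v => v) 2), is_derive_id.
- nra.
Qed.

Lemma continuous_hyp_kernel (q : nat) (s : R) :
  (q = 1 \/ q = 2)%nat -> 0 < s -> continuous (hyp_kernel q) s.
Proof.
intros hq hs; pose proof PI_RGT_0.
assert (hsp : 0 < s / 2 * PI) by (apply Rmult_lt_0_compat; lra).
pose proof (sinh_gt_0 _ hsp) as h1; pose proof (cosh_gt_0 (s / 2 * PI)) as h2.
apply (ex_derive_continuous (hyp_kernel q) s).
destruct hq as [-> | ->]; unfold hyp_kernel, cosh, sinh in *; auto_derive; lra.
Qed.

Lemma continuous_mix (q j N : nat) (s : R) : continuous (fun s => psum (mix_term q j s) N) s.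
Proof.
apply (continuous_psum (fun p s => mix_term q j s p)); intros p.
apply (continuous_scal_r (asin_mix q j (q + 2 * p))
  (fun s => s ^ (q + 2 * p) / INR (fact (q + 2 * p)))).
apply (ex_derive_continuous (fun s => s ^ (q + 2 * p) / INR (fact (q + 2 * p)))).
auto_derive; exact I.
Qed.

Lemma decay_hyp_div (q m : nat) : (1 <= q)%nat ->
  decay (fun u => hyp q m u * tanhc u).
Proof.
intros hq; apply (decay_mult (hyp q m) tanhc 1 (decay_hyp q m hq)).
- apply continuous_tanhc.
- apply tanhc_le.
Qed.

Lemma is_int_hyp_div (q j N : nat) (l : R) : (q = 1 \/ q = 2)%nat -> (j < N)%nat ->
  is_int (fun u => hyp q (2 * j) u * tanhc u) l ->
  is_int (fun s => hyp_kernel q s * psum (mix_term q j s) N) l.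
Proof.
intros hq hN; assert (hq1 : (1 <= q)%nat) by lia.
set (m := (2 * j)%nat).
(* The constant 4: with [k = g_j / u], [k u^2 = g_j u] is at most [2 u exp (- u)], and
   [u exp (- u / 2) <= 2]. *)
apply (is_int_sine_transform _ (fun u =>
  (INR m * hyp q (m - 1) u - (INR m + INR q) * hyp q (m + 1) u) * tanhc u
   + hyp q m u * tanhc1 u) _ 4).
- intros u hu; apply is_derive_mult_R; [apply is_derive_hyp|apply is_derive_tanhc, hu].
- apply decay_hyp_div, hq1.
- apply decay_plus.
  + apply (decay_mult (fun u => INR m * hyp q (m - 1) u - (INR m + INR q) * hyp q (m + 1) u)
      tanhc 1); [|apply continuous_tanhc|apply tanhc_le].
    apply decay_minus; apply decay_scal, decay_hyp, hq1.
  + apply (decay_mult (hyp q m) tanhc1 2); [|apply continuous_tanhc1|apply tanhc1_le].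
    apply decay_hyp, hq1.
- intros u hu.
  replace (hyp q m u * tanhc u * u ^ 2) with (hyp q (m + 1) u * u).
  2: { unfold hyp, tanhc; rewrite Nat.add_1_r; simpl; field; lra. }
  rewrite Rabs_mult, (Rabs_pos_eq u) by lra.
  apply Rle_trans with (2 * exp (- u) * u).
  + apply Rmult_le_compat_r; [lra|apply hyp_le; assumption].
  + replace (exp (- u)) with (exp (- u / 2) * exp (- u / 2)).
    2: { rewrite <- exp_plus; f_equal; field. }
    pose proof (exp_neg_le u hu) as h; apply Rle_div_r in h; [|exact hu].
    pose proof (exp_pos (- u / 2)); set (e := exp (- u / 2)) in *.
    assert (0 <= e * (2 - e * u)) by (apply Rmult_le_pos; lra); nra.
- intros s hs; pose proof (sine_transform q s hq hs j N hN) as J.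
  revert J; apply is_int_ext; intros u hu.
  fold m; unfold hyp, tanhc; rewrite Nat.add_1_r, <- tech_pow_Rmult; field; lra.
- intros s hs; apply (continuous_mult (hyp_kernel q) (fun s => psum (mix_term q j s) N)).
  + apply continuous_hyp_kernel; assumption.
  + apply continuous_mix.
Qed.

(** * Moments of the kernels *)

Lemma exp_pow_nat (x : R) (n : nat) : exp x ^ n = exp (INR n * x).
Proof.
induction n as [|n IH].
- simpl; rewrite Rmult_0_l, exp_0; reflexivity.
- rewrite <- tech_pow_Rmult, IH, <- exp_plus, S_INR; f_equal; ring.
Qed.

Lemma pow_exp_bound (e : nat) :
  exists C, 0 <= C /\ forall s, 0 < s -> s ^ e * exp (- s) <= C * exp (- s / 2).
Proof.
(* [s <= 2 n exp (s / (2 n))] raised to the power [e] costs only [exp (s / 2)] because [e <= n];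
   taking [e + 1] avoids dividing by 0 at [e = 0]. *)
set (n := INR (S e)); assert (hn : 0 < n) by (apply lt_0_INR; lia).
exists ((2 * n) ^ e); split; [apply pow_le; lra|]; intros s hs.
assert (h : s <= 2 * n * exp (s / (2 * n))).
{ pose proof (exp_ineq1_le (s / (2 * n))).
  assert (s / (2 * n) * (2 * n) = s) by (field; lra); nra. }
assert (h2 : s ^ e <= (2 * n) ^ e * exp (s / 2)).
{ apply Rle_trans with ((2 * n * exp (s / (2 * n))) ^ e).
  - apply pow_incr; lra.
  - rewrite Rpow_mult_distr, exp_pow_nat.
    apply Rmult_le_compat_l; [apply pow_le; lra|]; apply exp_le.
    unfold n; rewrite S_INR; pose proof (pos_INR e).
    apply (Rmult_le_reg_r (2 * (INR e + 1))); [lra|].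
    replace (INR e * (s / (2 * (INR e + 1))) * (2 * (INR e + 1))) with (INR e * s) by (field; lra).
    nra. }
apply Rle_trans with ((2 * n) ^ e * exp (s / 2) * exp (- s)).
- apply Rmult_le_compat_r; [left; apply exp_pos|exact h2].
- rewrite Rmult_assoc, <- exp_plus; right; do 2 f_equal; field.
Qed.

Lemma decay_pow_exp (e : nat) (a : R) : 1 <= a -> decay (fun s => s ^ e * exp (- a * s)).
Proof.
intros ha; split.
- intros s _; apply (ex_derive_continuous (fun s => s ^ e * exp (- a * s))).
  auto_derive; trivial.
- destruct (pow_exp_bound e) as [C [_ hC]]; exists C; intros s hs.
  rewrite Rabs_pos_eq.
  2: { apply Rmult_le_pos; [apply pow_le; lra|left; apply exp_pos]. }
  apply Rle_trans with (2 := hC s hs).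
  apply Rmult_le_compat_l; [apply pow_le; lra|apply exp_le; nra].
Qed.

Lemma is_int_pow_exp (e : nat) (a : R) : 1 <= a ->
  is_int (fun s => s ^ e * exp (- a * s)) (INR (fact e) / a ^ (S e)).
Proof.
intros ha; induction e as [|e IH].
- replace (INR (fact 0) / a ^ 1) with (/ a) by (simpl; field; lra).
  apply (is_int_ext (fun s => exp (- a * s))); [intros; simpl; ring|].
  apply is_int_exp; lra.
- set (F := fun s => - / a * (s ^ (S e) * exp (- a * s))).
  assert (hF : forall s, is_derive F s
     (s ^ (S e) * exp (- a * s) - INR (S e) / a * (s ^ e * exp (- a * s)))).
  { intros s; unfold F; evar_last.
    - apply is_derive_scal_R, is_derive_mult_R.
      + apply (is_derive_pow (fun s => s) (S e) s _ (is_derive_id s)).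
      + auto_derive; [trivial|reflexivity].
    - cbv beta; change (@one R_AbsRing) with 1; simpl Nat.pred; field; lra. }
  assert (I : is_int (fun s => s ^ (S e) * exp (- a * s)
      - INR (S e) / a * (s ^ e * exp (- a * s))) (0 - F 0)).
  { apply (is_int_antiderivative F).
    - intros; apply hF.
    - intros s _; apply (ex_derive_continuous (fun s => s ^ (S e) * exp (- a * s)
        - INR (S e) / a * (s ^ e * exp (- a * s)))).
      auto_derive; trivial.
    - apply filterlim_at_right_continuous, (ex_derive_continuous F); eexists; apply hF.
    - apply decay_lim, decay_scal, decay_pow_exp, ha. }
  pose proof (is_int_plus _ _ _ _ I (is_int_scal (INR (S e) / a) _ _ IH)) as J.
  replace (INR (fact (S e)) / a ^ S (S e)) with
    (0 - F 0 + INR (S e) / a * (INR (fact e) / a ^ S e)).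
  + revert J; apply is_int_ext; intros; ring.
  + unfold F; rewrite fact_simpl, mult_INR, (pow_i (S e)) by lia.
    rewrite <- (tech_pow_Rmult a (S e)); field; split; [apply pow_nonzero|]; lra.
Qed.

Lemma csch_geometric (v : R) : 0 < v ->
  / sinh v * (1 - 1 * exp (- 2 * v)) = 2 * exp (- (1) * v).
Proof.
intros hv; pose proof (sinh_gt_0 v hv) as h; unfold sinh in *.
replace (- 2 * v) with (- v + - v) by ring; replace (- (1) * v) with (- v) by ring.
rewrite exp_plus; rewrite exp_Ropp in *; pose proof (exp_pos v).
field; split; [lra|].
intros E; assert (exp v - / exp v = (exp v * exp v - 1) / exp v) by (field; lra).
rewrite H0, E in h; unfold Rdiv in h; lra.
Qed.

(** The sign in the exponential expansions: alternating for [1/cosh], leading to beta values,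
    constant for [1/sinh], leading to the odd part of zeta. *)
Definition kernel_ratio (q : nat) : R := match q with 1%nat => -1 | _ => 1 end.

Lemma hyp_kernel_geometric (q : nat) (s : R) (N : nat) :
  (q = 1 \/ q = 2)%nat -> 0 < s ->
  hyp_kernel q s = psum (fun k => PI * kernel_ratio q ^ k
      * exp (- ((2 * INR k + 1) * PI / 2) * s)) N
    + kernel_ratio q ^ N * (exp (- (INR N * PI) * s) * hyp_kernel q s).
Proof.
intros hq hs; pose proof PI_RGT_0 as hPI; set (v := s / 2 * PI).
assert (hv : 0 < v) by (apply Rmult_lt_0_compat; lra).
assert (H : exists h : R -> R, hyp_kernel q s = PI / 2 * h v /\
  h v * (1 - kernel_ratio q * exp (- 2 * v)) = 2 * exp (- (1) * v)).
{ destruct hq as [-> | ->].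
  - exists sech; split; [reflexivity|apply sech_geometric].
  - exists (fun v => / sinh v); split; [reflexivity|apply csch_geometric, hv]. }
destruct H as [h [E1 E2]].
pose proof (geometric_expansion h (kernel_ratio q) 1 v N E2) as E.
rewrite E1; rewrite E at 1.
rewrite Rmult_plus_distr_l, <- psum_scal; f_equal.
- apply psum_ext; intros k _.
  replace (- ((2 * INR k + 1) * PI / 2) * s) with (- (2 * INR k + 1) * v)
    by (unfold v; field); field.
- replace (- (INR N * PI) * s) with (- (2 * INR N) * v) by (unfold v; field); ring.
Qed.

Lemma hyp_kernel_pos (q : nat) (s : R) : (q = 1 \/ q = 2)%nat -> 0 < s -> 0 < hyp_kernel q s.
Proof.
intros hq hs; pose proof PI_RGT_0 as hPI.
assert (hv : 0 < s / 2 * PI) by (apply Rmult_lt_0_compat; lra).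
destruct hq as [-> | ->]; apply Rdiv_lt_0_compat; try lra.
- apply cosh_gt_0.
- apply sinh_gt_0, hv.
Qed.

(** The factor [(INR q - 1) / s] is 0 for [1/cosh] and records the simple pole of [1/sinh] at 0.
    Since [PI / 2 >= 1], exponentials in [s / 2 * PI] are bounded by exponentials in [s]. *)
Lemma hyp_kernel_le (q : nat) (s : R) : (q = 1 \/ q = 2)%nat -> 0 < s ->
  hyp_kernel q s <= PI * (1 + (INR q - 1) / s) * exp (- s).
Proof.
intros hq hs; pose proof PI_RGT_0 as hPI; pose proof PI2_1 as hP2.
set (v := s / 2 * PI).
assert (hsv : s <= v) by (unfold v; nra).
assert (hev : exp (- v) <= exp (- s)) by (apply exp_le; lra).
pose proof (exp_pos (- v)) as he.
destruct hq as [-> | ->].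
- change (PI / 2 * sech v <= PI * (1 + (INR 1 - 1) / s) * exp (- s)).
  pose proof (sech_le_exp v); simpl INR.
  replace (1 + (1 - 1) / s) with 1 by (field; lra); nra.
- change (PI / 2 * / sinh v <= PI * (1 + (INR 2 - 1) / s) * exp (- s)).
  pose proof (csch_geometric v ltac:(lra)) as E.
  pose proof (sinh_gt_0 v ltac:(lra)) as hsh.
  replace (- (1) * v) with (- v) in E by ring.
  (* This yields [(1 - exp (- 2 v)) (1 + v) >= v], the inequality that bounds [v / sinh v] by
     [2 exp (- v) (1 + v)]. *)
  assert (h1 : exp (- 2 * v) * (1 + 2 * v) <= 1).
  { pose proof (exp_ineq1_le (2 * v)); pose proof (exp_pos (- 2 * v)).
    assert (exp (- 2 * v) * exp (2 * v) = 1).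
    { rewrite <- exp_plus; replace (- 2 * v + 2 * v) with 0 by ring; apply exp_0. }
    nra. }
  set (c := / sinh v) in *; assert (hc : 0 < c) by (apply Rinv_0_lt_compat, hsh).
  assert (h2 : c * v <= 2 * exp (- v) * (1 + v)).
  { rewrite <- E; set (x := exp (- 2 * v)) in *.
    assert (0 <= c * ((1 - x) * (1 + v) - v)); [|lra].
    apply Rmult_le_pos; [lra|].
    assert (0 < x) by apply exp_pos; nra. }
  assert (h3 : c <= 2 * exp (- v) * (1 + / v)).
  { apply (Rmult_le_reg_r v); [lra|].
    replace (2 * exp (- v) * (1 + / v) * v) with (2 * exp (- v) * (1 + v)) by (field; lra).
    exact h2. }
  assert (h4 : / v <= / s) by (apply Rinv_le_contravar; lra).
  simpl INR; replace ((1 + 1 - 1) / s) with (/ s) by (field; lra).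
  assert (0 < / v) by (apply Rinv_0_lt_compat; lra).
  assert (exp (- v) * (1 + / v) <= exp (- s) * (1 + / s)).
  { apply Rmult_le_compat; lra. }
  nra.
Qed.

(** The condition [q <= e + 1] supplies, for [q = 2], the factor [s] that cancels the pole. *)
Lemma pow_kernel_bound (q e : nat) : (q = 1 \/ q = 2)%nat -> (q <= e + 1)%nat ->
  exists C, 0 <= C /\ forall s, 0 < s -> Rabs (s ^ e * hyp_kernel q s) <= C * exp (- s / 2).
Proof.
intros hq he; pose proof PI_RGT_0 as hPI.
destruct (pow_exp_bound e) as [C [hC0 hC]].
destruct (pow_exp_bound (e - 1)) as [D [hD0 hD]].
exists (PI * (C + D)); split; [apply Rmult_le_pos; lra|]; intros s hs.
pose proof (hyp_kernel_pos q s hq hs); pose proof (pow_lt s e hs) as hp.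
rewrite Rabs_pos_eq by (apply Rmult_le_pos; lra).
apply Rle_trans with (s ^ e * (PI * (1 + (INR q - 1) / s) * exp (- s))).
- apply Rmult_le_compat_l; [lra|apply hyp_kernel_le; assumption].
- assert (hd : s ^ e * ((INR q - 1) / s) <= s ^ (e - 1)).
  { pose proof (pow_lt s (e - 1) hs).
    destruct hq as [-> | ->].
    - simpl INR; replace ((1 - 1) / s) with 0 by (field; lra); lra.
    - replace e with (S (e - 1)) at 1 by lia; rewrite <- tech_pow_Rmult.
      simpl INR; right; field; lra. }
  specialize (hC s hs); specialize (hD s hs); pose proof (exp_pos (- s)) as hes.
  assert (s ^ e * ((INR q - 1) / s) * exp (- s) <= D * exp (- s / 2)).
  { apply Rle_trans with (2 := hD); apply Rmult_le_compat_r; lra. }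
  replace (s ^ e * (PI * (1 + (INR q - 1) / s) * exp (- s)))
    with (PI * (s ^ e * exp (- s) + s ^ e * ((INR q - 1) / s) * exp (- s))) by ring.
  rewrite (Rmult_assoc PI (C + D)); apply Rmult_le_compat_l; lra.
Qed.

(** The integral [L] exists by decay, and the partial sums of the series are then shown to approach
    it. Convergence of the series is thus a conclusion, with no separate test. *)
Lemma kernel_moment_series (q e : nat) : (q = 1 \/ q = 2)%nat -> (q <= e + 1)%nat ->
  exists L : R, is_int (fun s => s ^ e * hyp_kernel q s) L /\
  is_series (fun k => kernel_ratio q ^ k / (2 * INR k + 1) ^ (e + 1))
    (L / (PI * INR (fact e) * (2 / PI) ^ (e + 1))).
Proof.
intros hq he; pose proof PI_RGT_0 as hPI; pose proof PI2_1 as hP2.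
destruct (pow_kernel_bound q e hq he) as [C [hC0 hC]].
assert (hd : decay (fun s => s ^ e * hyp_kernel q s)).
{ split; [|exists C; exact hC]; intros s hs.
  apply (continuous_mult (fun s => s ^ e) (hyp_kernel q)).
  - apply (ex_derive_continuous (fun s => s ^ e)); auto_derive; trivial.
  - apply continuous_hyp_kernel; assumption. }
destruct (decay_ex_int _ hd) as [L hL]; exists L; split; [exact hL|].
(* Each exponential [exp (- (2k+1) PI s / 2)] has [e]-th moment [e! (2 / PI)^(e+1) / (2k+1)^(e+1)]
   and weight [PI]. *)
set (M := PI * INR (fact e) * (2 / PI) ^ (e + 1)).
assert (hM : 0 < M).
{ unfold M; apply Rmult_lt_0_compat; [apply Rmult_lt_0_compat|].
  - exact hPI.
  - apply INR_fact_lt_0.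
  - apply pow_lt, Rdiv_lt_0_compat; lra. }
set (a := fun k : nat => kernel_ratio q ^ k / (2 * INR k + 1) ^ (e + 1)).
assert (hr : forall N, Rabs (kernel_ratio q ^ N) <= 1).
{ intros N; destruct hq as [-> | ->]; simpl kernel_ratio.
  - rewrite pow_1_abs; lra.
  - rewrite pow1, Rabs_R1; lra. }
(* The remainder is the original integrand, bounded by [C], times [exp (- (N + 1) PI s)]. *)
assert (B : forall N, Rabs (L - M * psum a (S N)) <= C / PI / (INR N + 1)).
{ intros N; pose proof (pos_INR N) as hN.
  assert (I : is_int (fun s => kernel_ratio q ^ (S N)
      * (exp (- (INR (S N) * PI) * s) * (s ^ e * hyp_kernel q s))) (L - M * psum a (S N))).
  { apply (is_int_ext (fun s => s ^ e * hyp_kernel q s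
      - psum (fun k => PI * kernel_ratio q ^ k
         * (s ^ e * exp (- ((2 * INR k + 1) * PI / 2) * s))) (S N))).
    - intros s hs; rewrite (hyp_kernel_geometric q s (S N) hq hs) at 1.
      rewrite Rmult_plus_distr_l, <- psum_scal.
      rewrite (psum_ext _ (fun k => PI * kernel_ratio q ^ k
         * (s ^ e * exp (- ((2 * INR k + 1) * PI / 2) * s)))) by (intros; ring).
      set (w := psum _ (S N)); set (x := hyp_kernel q s); set (y := exp _); ring.
    - apply is_int_minus; [exact hL|].
      rewrite <- psum_scal; apply is_int_psum; intros k; pose proof (pos_INR k).
      replace (M * a k) with (PI * kernel_ratio q ^ k
        * (INR (fact e) / ((2 * INR k + 1) * PI / 2) ^ (S e))).
      + apply is_int_scal, is_int_pow_exp; nra.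
      + unfold M, a; rewrite Nat.add_1_r.
        replace ((2 * INR k + 1) * PI / 2) with ((2 * INR k + 1) * / (2 / PI)) by (field; lra).
        assert (0 < 2 / PI) by (apply Rdiv_lt_0_compat; lra).
        rewrite Rpow_mult_distr, pow_inv by lra.
        field; split; apply pow_nonzero; lra. }
  replace (C / PI / (INR N + 1)) with (C * / (INR (S N) * PI)).
  2: { rewrite S_INR; field; lra. }
  refine (is_int_abs_le _ (fun s => C * exp (- (INR (S N) * PI) * s)) _ _ _ I _).
  - intros s hs; specialize (hC s hs).
    assert (exp (- s / 2) <= 1) by (rewrite <- exp_0; apply exp_le; lra).
    pose proof (exp_pos (- s / 2)); set (x := exp (- (INR (S N) * PI) * s)).
    assert (hx : 0 < x) by apply exp_pos.
    rewrite Rabs_mult, (Rabs_mult x), (Rabs_pos_eq x) by lra.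
    pose proof (hr (S N)) as h1; pose proof (Rabs_pos (kernel_ratio q ^ S N)).
    pose proof (Rabs_pos (s ^ e * hyp_kernel q s)).
    set (y := Rabs (s ^ e * hyp_kernel q s)) in *.
    set (z := Rabs (kernel_ratio q ^ S N)) in *.
    assert (y <= C) by nra; assert (0 <= x * y <= x * C) by (split; nra).
    nra.
  - apply is_int_scal, is_int_exp; rewrite S_INR; nra. }
assert (S1 : is_lim_seq (fun N => L - M * psum a (S N)) 0).
{ apply is_lim_seq_abs_0.
  apply (is_lim_seq_le_le (fun _ => 0) _ (fun N => C / PI * / (INR N + 1)) 0).
  - intros N; split; [apply Rabs_pos|apply B].
  - apply is_lim_seq_const.
  - replace (Finite 0) with (Rbar_mult (C / PI) 0) by (simpl; f_equal; ring).
    apply is_lim_seq_scal_l.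
    apply (is_lim_seq_ext (fun N => / INR (S N))); [intros; rewrite S_INR; reflexivity|].
    apply (is_lim_seq_incr_1 (fun N => / INR N)).
    replace (Finite 0) with (Rbar_inv p_infty) by reflexivity.
    apply is_lim_seq_inv; [apply is_lim_seq_INR|discriminate]. }
change (is_lim_seq (sum_n a) (Finite (L / M))).
apply (is_lim_seq_ext (fun N => / M * (L - (L - M * psum a (S N))))).
{ intros N; replace (/ M * (L - (L - M * psum a (S N)))) with (psum a (S N)) by (field; lra).
  induction N as [|N IH].
  - rewrite sum_O; simpl; ring.
  - rewrite sum_Sn, <- IH; reflexivity. }
replace (Finite (L / M)) with (Rbar_mult (/ M) (L - 0)) by (simpl; f_equal; field; lra).
apply is_lim_seq_scal_l, is_lim_seq_minus'; [apply is_lim_seq_const|exact S1].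
Qed.

(** * Zeta and beta values *)

Lemma psum_sum_n (a : nat -> R) (N : nat) : psum a (S N) = sum_n a N.
Proof.
induction N as [|N IH]; [rewrite sum_O; simpl; ring|].
rewrite sum_Sn, <- IH; reflexivity.
Qed.

Lemma is_series_psum (a : nat -> R) (l : R) :
  is_series a l <-> is_lim_seq (psum a) l.
Proof.
split; intros h.
- apply is_lim_seq_incr_1; apply (is_lim_seq_ext (sum_n a)); [|exact h].
  intros n; symmetry; apply psum_sum_n.
- change (is_lim_seq (sum_n a) (Finite l)).
  apply (is_lim_seq_ext (fun n => psum a (S n))); [intros; apply psum_sum_n|].
  apply (is_lim_seq_incr_1 (psum a)), h.
Qed.

Lemma is_lim_seq_double (u : nat -> R) (l : R) :
  is_lim_seq u l -> is_lim_seq (fun N => u (2 * N)%nat) l.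
Proof.
intros h; apply (is_lim_seq_subseq u l (fun N => (2 * N)%nat)); [|exact h].
apply eventually_subseq; intros n; lia.
Qed.

(** Splitting the zeta series by parity gives [Z = O + Z / 2 ^ n]. *)
Lemma zeta_of_odd_series (n : nat) (O : R) : (1 <= n)%nat ->
  is_series (fun k => / (2 * INR k + 1) ^ n) O ->
  is_series (fun k => / (INR k + 1) ^ n) (O * 2 ^ n / (2 ^ n - 1)).
Proof.
intros hn hO; apply is_series_psum in hO; apply is_series_psum.
set (o := fun k : nat => / (2 * INR k + 1) ^ n) in *.
set (z := fun k : nat => / (INR k + 1) ^ n).
assert (h2 : 2 <= 2 ^ n).
{ replace 2 with (2 ^ 1) at 1 by ring; apply Rle_pow; [lra|exact hn]. }
assert (hz : forall k, 0 < z k).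
{ intros k; pose proof (pos_INR k); apply Rinv_0_lt_compat, pow_lt; lra. }
assert (ho : forall k, 0 < o k).
{ intros k; pose proof (pos_INR k); apply Rinv_0_lt_compat, pow_lt; lra. }
assert (E : forall N, psum z (2 * N) = psum o N + / 2 ^ n * psum z N).
{ induction N as [|N IH]; [simpl; ring|].
  replace (2 * S N)%nat with (S (S (2 * N))) by lia; simpl psum at 1.
  replace (N + (N + 0))%nat with (2 * N)%nat by lia; rewrite IH; simpl psum.
  replace (z (2 * N)%nat) with (o N).
  2: { unfold z, o; rewrite mult_INR; reflexivity. }
  replace (z (S (2 * N))) with (/ 2 ^ n * z N); [ring|].
  unfold z; rewrite <- Rinv_mult, <- Rpow_mult_distr, S_INR, mult_INR.
  simpl (INR 2); do 2 f_equal; ring. }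
assert (hoO : forall N, psum o N <= O).
{ intros N; apply (is_lim_seq_incr_compare (psum o)); [exact hO|].
  intros k; simpl; pose proof (ho k); lra. }
assert (inc : forall N, psum z N <= psum z (S N)).
{ intros k; simpl; pose proof (hz k); lra. }
assert (inc2 : forall N M, psum z N <= psum z (N + M)).
{ intros N M; induction M as [|M IH]; [rewrite Nat.add_0_r; lra|].
  rewrite Nat.add_succ_r; pose proof (inc (N + M)%nat); lra. }
assert (hr : / 2 ^ n <= / 2) by (apply Rinv_le_contravar; lra).
assert (hr0 : 0 < / 2 ^ n) by (apply Rinv_0_lt_compat; lra).
assert (pz : forall N, 0 <= psum z N).
{ intros N; induction N as [|N IH]; [simpl; lra|]; pose proof (inc N); lra. }
(* [Z_N <= Z_(2N) = O_N + Z_N / 2^n <= O + Z_N / 2], so the partial sums are bounded, and being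
   increasing they converge. *)
assert (bd : forall N, psum z N <= 2 * O).
{ intros N; pose proof (inc2 N N) as h; replace (N + N)%nat with (2 * N)%nat in h by lia.
  rewrite E in h; pose proof (hoO N); pose proof (pz N); nra. }
destruct (ex_finite_lim_seq_incr (psum z) (2 * O) inc bd) as [Z hZ].
replace (O * 2 ^ n / (2 ^ n - 1)) with Z; [exact hZ|].
assert (EZ : Z = O + / 2 ^ n * Z).
{ pose proof (is_lim_seq_double _ _ hZ) as h1.
  assert (h3 : is_lim_seq (fun N => psum z (2 * N)) (O + / 2 ^ n * Z)).
  { apply (is_lim_seq_ext (fun N => psum o N + / 2 ^ n * psum z N));
      [intros; symmetry; apply E|].
    apply is_lim_seq_plus'; [exact hO|].
    apply (is_lim_seq_scal_l _ (/ 2 ^ n) (Finite Z)), hZ. }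
  pose proof (is_lim_seq_unique _ _ h1) as u1.
  rewrite (is_lim_seq_unique _ _ h3) in u1; injection u1; lra. }
apply (Rmult_eq_reg_r ((2 ^ n - 1) / 2 ^ n)); [|apply Rgt_not_eq, Rdiv_lt_0_compat; lra].
transitivity (Z - / 2 ^ n * Z); [field; lra|].
transitivity O; [lra|field; lra].
Qed.

(** Closed form of the moment of order [e = q + 2p]. In the second case the series runs over odd
    integers only, and [2^(e+1)] times the odd part of zeta is [(2^(e+1) - 1)] times zeta. *)
Definition moment (q p : nat) : R :=
  match q with
  | 1%nat => INR (fact (2 * p + 1)) * 2 ^ (2 * p + 2)
     * (dirichlet_beta (INR (2 * p + 2)) / PI ^ (2 * p + 1))
  | _ => INR (fact (2 * p + 2)) * (2 ^ (2 * p + 3) - 1)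
     * (riemann_zeta (INR (2 * p + 3)) / PI ^ (2 * p + 2))
  end.

Lemma is_int_moment (q p : nat) : (q = 1 \/ q = 2)%nat ->
  is_int (fun s => s ^ (q + 2 * p) * hyp_kernel q s) (moment q p).
Proof.
intros hq; pose proof PI_RGT_0 as hPI.
destruct (kernel_moment_series q (q + 2 * p) hq ltac:(lia)) as [L [hL hS]].
replace (moment q p) with L; [exact hL|].
set (e := (q + 2 * p)%nat) in *.
pose proof (INR_fact_neq_0 e) as hf.
assert (hPn : forall n, PI ^ n <> 0) by (intros; apply pow_nonzero; lra).
assert (h2n : forall n, 2 ^ n <> 0) by (intros; apply pow_nonzero; lra).
assert (EM : PI * INR (fact e) * (2 / PI) ^ (e + 1) = INR (fact e) * 2 ^ (e + 1) / PI ^ e).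
{ unfold Rdiv at 1; rewrite Rpow_mult_distr, pow_inv, (Nat.add_1_r e).
  rewrite <- (tech_pow_Rmult PI); field; repeat split; first [apply hPn | lra]. }
rewrite EM in hS.
destruct hq as [-> | ->].
- assert (B : dirichlet_beta (INR (2 * p + 2)) = L / (INR (fact e) * 2 ^ (e + 1) / PI ^ e)).
  { rewrite <- (is_series_unique _ _ hS); unfold dirichlet_beta; apply Series_ext.
    intros k; rewrite Rpower_pow by (apply lt_0_INR; lia).
    rewrite plus_INR, mult_INR; simpl (INR 2); simpl (INR 1).
    replace (e + 1)%nat with (2 * p + 2)%nat by lia; reflexivity. }
  unfold moment; rewrite B.
  replace (2 * p + 1)%nat with e by lia; replace (2 * p + 2)%nat with (e + 1)%nat by lia.
  field; repeat split; auto.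
- assert (B : riemann_zeta (INR (2 * p + 3))
    = L / (INR (fact e) * 2 ^ (e + 1) / PI ^ e) * 2 ^ (e + 1) / (2 ^ (e + 1) - 1)).
  { pose proof (zeta_of_odd_series (e + 1) (L / (INR (fact e) * 2 ^ (e + 1) / PI ^ e))
      ltac:(lia)) as Z.
    rewrite <- (is_series_unique _ _ (Z ltac:(
      revert hS; apply is_series_ext; intros k; simpl kernel_ratio; rewrite pow1;
      unfold Rdiv; apply Rmult_1_l))).
    unfold riemann_zeta; apply Series_ext.
    intros k; rewrite Rpower_pow by (apply lt_0_INR; lia).
    rewrite plus_INR; simpl (INR 1).
    replace (e + 1)%nat with (2 * p + 3)%nat by lia; reflexivity. }
  unfold moment; rewrite B.
  replace (2 * p + 2)%nat with e by lia; replace (2 * p + 3)%nat with (e + 1)%nat by lia.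
  assert (2 <= 2 ^ (e + 1)).
  { replace 2 with (2 ^ 1) at 1 by ring; apply Rle_pow; [lra|lia]. }
  field; repeat split; auto; lra.
Qed.

Lemma hyp_kernel_ge (q : nat) (s : R) : (q = 1 \/ q = 2)%nat -> 0 < s ->
  PI / 2 * exp (- (PI / 2) * s) <= hyp_kernel q s.
Proof.
intros hq hs; pose proof PI_RGT_0 as hPI; set (v := s / 2 * PI).
assert (hv : 0 < v) by (apply Rmult_lt_0_compat; lra).
replace (- (PI / 2) * s) with (- v) by (unfold v; field); rewrite exp_Ropp.
pose proof (exp_pos v); pose proof (exp_pos (- v)).
assert (exp (- v) <= exp v) by (apply exp_le; lra).
destruct hq as [-> | ->]; (apply Rmult_le_compat_l; [lra|]); fold v;
  apply Rinv_le_contravar.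
- apply cosh_gt_0.
- unfold cosh; lra.
- apply sinh_gt_0, hv.
- unfold sinh; lra.
Qed.

(** Read off from the integral: [cosh v] and [sinh v] are at most [exp v], so the moment dominates
    an explicit positive integral. No estimate of beta or zeta is needed. *)
Lemma moment_pos (q p : nat) : (q = 1 \/ q = 2)%nat -> 0 < moment q p.
Proof.
intros hq; pose proof PI2_1 as hP; set (e := (q + 2 * p)%nat).
pose proof (is_int_scal (PI / 2) _ _ (is_int_pow_exp e (PI / 2) ltac:(lra))) as I.
set (c := PI / 2 * _) in I.
assert (hc : 0 < c).
{ unfold c; apply Rmult_lt_0_compat; [lra|]; apply Rdiv_lt_0_compat.
  - apply INR_fact_lt_0.
  - apply pow_lt; lra. }
apply Rlt_le_trans with (1 := hc); rewrite <- (Rabs_pos_eq c) by lra.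
refine (is_int_abs_le _ _ _ _ _ I (is_int_moment q p hq)); intros s hs; fold e.
pose proof (pow_lt s e hs); pose proof (exp_pos (- (PI / 2) * s)).
rewrite Rabs_pos_eq by (apply Rmult_le_pos; [lra|apply Rmult_le_pos; lra]).
pose proof (hyp_kernel_ge q s hq hs).
replace (PI / 2 * (s ^ e * exp (- (PI / 2) * s)))
  with (s ^ e * (PI / 2 * exp (- (PI / 2) * s))) by ring.
apply Rmult_le_compat_l; lra.
Qed.

(** The factorial dividing [s^(q+2p)] in [mix_term] cancels the one in [moment], leaving the
    summands of the statement. *)
Definition moment_summand (q j p : nat) : R :=
  asin_mix q j (q + 2 * p) * (moment q p / INR (fact (q + 2 * p))).

Lemma zeta_summand_eq (j p : nat) : zeta_summand (S j) (S p) = moment_summand 2 j p.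
Proof.
unfold zeta_summand, moment_summand, coef_a, moment.
replace (S j - 1)%nat with j by lia.
replace (2 * S j)%nat with (2 * j + 2)%nat by lia.
rewrite taylor_coef_asin_mix.
replace (2 * S p)%nat with (2 * p + 2)%nat by lia.
replace (2 + 2 * p)%nat with (2 * p + 2)%nat by lia.
replace (2 * p + 2 + 1)%nat with (2 * p + 3)%nat by lia.
pose proof PI_RGT_0; field; split; [apply pow_nonzero; lra|apply INR_fact_neq_0].
Qed.

Lemma beta_summand_eq (j p : nat) : beta_summand (S j) (S p) = moment_summand 1 j p.
Proof.
unfold beta_summand, moment_summand, coef_b, moment.
replace (S j - 1)%nat with j by lia.
replace (2 * S j - 1)%nat with (2 * j + 1)%nat by lia.
rewrite taylor_coef_asin_mix.
replace (2 * S p - 1)%nat with (2 * p + 1)%nat by lia.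
replace (2 * S p)%nat with (2 * p + 2)%nat by lia.
replace (1 + 2 * p)%nat with (2 * p + 1)%nat by lia.
pose proof PI_RGT_0; field; split; [apply pow_nonzero; lra|apply INR_fact_neq_0].
Qed.

(** The inversion at the origin presupposes that the integral exists, so a value is first obtained
    from decay; the integral of the sine transform is then computed a second time, monomial by
    monomial. *)
Lemma is_int_hyp_moments (q j : nat) : (q = 1 \/ q = 2)%nat ->
  is_int (fun u => hyp q (2 * j) u * tanhc u) (psum (moment_summand q j) (S j)).
Proof.
intros hq; destruct (decay_ex_int _ (decay_hyp_div q (2 * j) ltac:(lia))) as [l hl].
replace (psum (moment_summand q j) (S j)) with l; [exact hl|].
apply (is_int_unique _ _ _ (is_int_hyp_div q j (S j) l hq ltac:(lia) hl)).
apply (is_int_ext (fun s => psum (fun p => asin_mix q j (q + 2 * p)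
   / INR (fact (q + 2 * p)) * (s ^ (q + 2 * p) * hyp_kernel q s)) (S j))).
- intros s _; rewrite <- psum_scal; apply psum_ext; intros p _.
  unfold mix_term, Rdiv; ring.
- replace (psum (moment_summand q j) (S j)) with (psum (fun p => asin_mix q j (q + 2 * p)
   / INR (fact (q + 2 * p)) * moment q p) (S j)).
  + apply is_int_psum; intros p; apply is_int_scal, is_int_moment, hq.
  + apply psum_ext; intros p _; unfold moment_summand, Rdiv; ring.
Qed.

Lemma sum_n_m_psum (u : nat -> R) (n : nat) :
  sum_n_m u 1 n = psum (fun p => u (S p)) n.
Proof.
induction n as [|n IH]; [rewrite sum_n_m_zero by lia; reflexivity|].
rewrite sum_n_Sm by lia; rewrite IH; reflexivity.
Qed.

(** * The substitution [u = arctanh x] *)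

Lemma exp_arctanh (x : R) : -1 < x < 1 -> exp (2 * arctanh x) = (1 + x) / (1 - x).
Proof.
intros hx; unfold arctanh; rewrite <- Rmult_assoc, Rinv_r, Rmult_1_l by lra.
apply exp_ln, Rdiv_lt_0_compat; lra.
Qed.

Lemma tanh_exp (u : R) : tanh u = (exp (2 * u) - 1) / (exp (2 * u) + 1).
Proof.
unfold tanh, sinh, cosh; replace (2 * u) with (u + u) by ring.
rewrite exp_plus, exp_Ropp; pose proof (exp_pos u); field; split; nra.
Qed.

Lemma tanh_arctanh (x : R) : -1 < x < 1 -> tanh (arctanh x) = x.
Proof.
intros hx; rewrite tanh_exp, exp_arctanh by exact hx; field; lra.
Qed.

Lemma sech_arctanh (x : R) : -1 < x < 1 -> sech (arctanh x) = sqrt (1 - x ^ 2).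
Proof.
intros hx; pose proof (sech_gt_0 (arctanh x)).
rewrite <- (sqrt_square (sech _)) by lra.
rewrite sech_sqr, tanh_arctanh by exact hx; f_equal; ring.
Qed.

Lemma is_derive_arctanh (x : R) : -1 < x < 1 -> is_derive arctanh x (/ (1 - x ^ 2)).
Proof.
intros hx; unfold arctanh; auto_derive.
- split; [lra|]; split; [|trivial]; apply Rdiv_lt_0_compat; lra.
- field; repeat split; nra.
Qed.

Lemma arctanh_0 : arctanh 0 = 0.
Proof.
unfold arctanh; replace ((1 + 0) / (1 - 0)) with 1 by field; rewrite ln_1; ring.
Qed.

Lemma arctanh_pos (x : R) : 0 < x < 1 -> 0 < arctanh x.
Proof.
intros hx; unfold arctanh; apply Rmult_lt_0_compat; [lra|].
rewrite <- ln_1; apply ln_increasing; [lra|]; apply Rlt_div_r; lra.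
Qed.

Lemma filterlim_arctanh_0 : filterlim arctanh (at_right 0) (at_right 0).
Proof.
intros P hP.
pose proof (ex_derive_continuous arctanh 0
  (ex_intro _ _ (is_derive_arctanh 0 ltac:(lra)))) as hc.
unfold continuous in hc; rewrite arctanh_0 in hc.
pose proof (filter_le_within (F := locally 0) (fun u => 0 < u) _ (hc _ hP)) as h.
unfold filtermap; eapply filter_imp;
  [|exact (filter_and _ _ (at_right_0_between 1 Rlt_0_1) h)].
intros x [hx hx']; apply hx', arctanh_pos, hx.
Qed.

Lemma at_left_1_between (d : R) : 0 < d -> at_left 1 (fun b => 1 - d < b < 1).
Proof.
intros hd; exists (mkposreal d hd); intros y hy hy1.
change (Rabs (y - 1) < d) in hy; apply Rabs_lt_between in hy; lra.
Qed.

Lemma filterlim_arctanh_1 : filterlim arctanh (at_left 1) (Rbar_locally p_infty).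
Proof.
intros P [M hM]; unfold filtermap.
pose proof (exp_pos (- (2 * M))) as he.
(* The cap at 1 keeps [x > 0], so that [(1 + x) / (1 - x)] exceeds [1 / (1 - x) > exp (2 M)]. *)
eapply filter_imp; [|exact (at_left_1_between (Rmin 1 (exp (- (2 * M)))) (Rmin_pos _ _ Rlt_0_1 he))].
intros x hx; apply hM.
pose proof (Rmin_l 1 (exp (- (2 * M)))); pose proof (Rmin_r 1 (exp (- (2 * M)))).
unfold arctanh; apply (Rmult_lt_reg_l 2); [lra|].
rewrite <- Rmult_assoc, Rinv_r, Rmult_1_l by lra.
rewrite <- (ln_exp (2 * M)); apply ln_increasing; [apply exp_pos|].
apply Rlt_div_r; [lra|].
rewrite exp_Ropp in *; pose proof (exp_pos (2 * M)).
apply Rlt_le_trans with (exp (2 * M) * / exp (2 * M)).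
- apply Rmult_lt_compat_l; lra.
- rewrite Rinv_r; lra.
Qed.

(** [arctanh] carries the filters at [0+] and [1-] to those at [0+] and infinity, so the proper
    change of variables on each [[a, b]] passes to the improper integral. *)
Lemma is_RInt_gen_arctanh (k f : R -> R) (l : R) :
  (forall u, 0 < u -> continuous k u) ->
  (forall x, 0 < x < 1 -> / (1 - x ^ 2) * k (arctanh x) = f x) ->
  is_int k l ->
  is_RInt_gen (V := R_NormedModule) f (at_right 0) (at_left 1) l.
Proof.
intros hc hf hk P hP; specialize (hk P hP); unfold filtermapi in hk |- *.
destruct hk as [Q1 Q2 hQ1 hQ2 hQ].
apply (Filter_prod _ _ _ (fun a => 0 < a < 1 /\ Q1 (arctanh a))
  (fun b => 0 < b < 1 /\ Q2 (arctanh b))).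
- apply filter_and; [apply at_right_0_between; lra|].
  exact (filterlim_arctanh_0 _ hQ1).
- apply filter_and; [|exact (filterlim_arctanh_1 _ hQ2)].
  generalize (at_left_1_between 1 Rlt_0_1); apply filter_imp; intros; lra.
- intros a b [ha hqa] [hb hqb]; destruct (hQ _ _ hqa hqb) as [y [hy hPy]].
  exists y; split; [|exact hPy]; simpl in hy |- *.
  assert (hx : forall x, Rmin a b <= x <= Rmax a b -> 0 < x < 1).
  { intros x; unfold Rmin, Rmax; destruct (Rle_dec a b); lra. }
  rewrite <- (is_RInt_unique _ _ _ _ hy).
  apply (is_RInt_ext (fun x => scal (/ (1 - x ^ 2)) (k (arctanh x)))).
  { intros x hx'; apply hf, hx; lra. }
  apply (is_RInt_comp k arctanh (fun x => / (1 - x ^ 2))); intros x hx'; apply hx in hx'.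
  + apply hc, arctanh_pos, hx'.
  + split; [apply is_derive_arctanh; lra|].
    apply (ex_derive_continuous (fun x => / (1 - x ^ 2))); auto_derive; nra.
Qed.

Lemma integrand_zeta (j : nat) (x : R) : 0 < x < 1 ->
  / (1 - x ^ 2) * (hyp 2 (2 * j) (arctanh x) * tanhc (arctanh x))
  = x ^ (2 * S j - 1) / arctanh x.
Proof.
intros hx; pose proof (arctanh_pos x hx).
unfold hyp, tanhc; replace (sech (arctanh x) ^ 2) with (1 - x ^ 2).
2: { transitivity (sech (arctanh x) * sech (arctanh x)); [|ring].
     rewrite sech_sqr, tanh_arctanh by lra; ring. }
rewrite tanh_arctanh by lra; replace (2 * S j - 1)%nat with (S (2 * j)) by lia.
rewrite <- (tech_pow_Rmult x (2 * j)); field; split; nra.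
Qed.

(** With [q = 1] a single factor [sqrt (1 - x ^ 2)] cancels against the derivative of [arctanh],
    which leaves the square root in the denominator. *)
Lemma integrand_beta (j : nat) (x : R) : 0 < x < 1 ->
  / (1 - x ^ 2) * (hyp 1 (2 * j) (arctanh x) * tanhc (arctanh x))
  = x ^ (2 * S j - 1) / (sqrt (1 - x ^ 2) * arctanh x).
Proof.
intros hx; pose proof (arctanh_pos x hx).
assert (hp : 0 < 1 - x ^ 2) by nra.
pose proof (sqrt_lt_R0 _ hp) as hs; pose proof (sqrt_sqrt _ (Rlt_le _ _ hp)) as hss.
unfold hyp, tanhc; rewrite sech_arctanh, pow_1 by lra.
rewrite tanh_arctanh by lra; replace (2 * S j - 1)%nat with (S (2 * j)) by lia.
rewrite <- (tech_pow_Rmult x (2 * j)).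
rewrite <- hss at 1; field; lra.
Qed.

(** * Signs of the summands and conclusion *)

Lemma alternates_of_signed (u : nat -> R) (j : nat) :
  (forall p, (p <= j)%nat -> 0 < (-1) ^ p * u (S p)) ->
  alternates_from_positive u (S j).
Proof.
intros h; split.
- pose proof (h 0%nat ltac:(lia)) as h0; simpl in h0; lra.
- intros [|p] h1 h2; [lia|].
  pose proof (h p ltac:(lia)) as a; pose proof (h (S p) ltac:(lia)) as b.
  replace (S p + 1)%nat with (S (S p)) by lia.
  rewrite <- tech_pow_Rmult in b.
  pose proof (Rmult_lt_0_compat _ _ a b) as c.
  assert (e : (-1) ^ p * (-1) ^ p = 1).
  { rewrite <- Rpow_mult_distr; replace (-1 * -1) with 1 by ring; apply pow1. }
  replace ((-1) ^ p * u (S p) * (-1 * (-1) ^ p * u (S (S p))))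
    with (- (((-1) ^ p * (-1) ^ p) * (u (S p) * u (S (S p))))) in c by ring.
  rewrite e in c; lra.
Qed.

Lemma moment_summand_sign (q j p : nat) : (q = 1 \/ q = 2)%nat -> (p <= j)%nat ->
  0 < (-1) ^ p * moment_summand q j p.
Proof.
intros hq hp; unfold moment_summand; rewrite <- Rmult_assoc.
apply Rmult_lt_0_compat; [exact (signed_mix_pos q hq j p hp)|].
apply Rdiv_lt_0_compat; [apply moment_pos, hq|apply INR_fact_lt_0].
Qed.

Theorem proposition2p2 (n : nat) (hn : (1 <= n)%nat) :
  is_RInt_gen (fun x : R => x ^ (2 * n - 1) / arctanh x)
    (at_right 0) (at_left 1)
    (sum_n_m (zeta_summand n) 1 n) /\
  is_RInt_gen (fun x : R => x ^ (2 * n - 1) / (sqrt (1 - x ^ 2) * arctanh x))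
    (at_right 0) (at_left 1)
    (sum_n_m (beta_summand n) 1 n) /\
  (forall p : nat, (1 <= p)%nat -> (p <= n)%nat ->
     0 < (-1) ^ (p - 1) * coef_a p n /\ 0 < (-1) ^ (p - 1) * coef_b p n) /\
  alternates_from_positive (zeta_summand n) n /\
  alternates_from_positive (beta_summand n) n.
Proof.
(* With [n = j + 1] the truncated subtractions of the statement become exact, and the summation
   index moves down by one as well. *)
destruct n as [|j]; [lia|].
assert (hq1 : (1 = 1 \/ 1 = 2)%nat) by lia.
assert (hq2 : (2 = 1 \/ 2 = 2)%nat) by lia.
rewrite !sum_n_m_psum.
rewrite (psum_ext _ _ _ (fun p _ => zeta_summand_eq j p)).
rewrite (psum_ext _ _ _ (fun p _ => beta_summand_eq j p)).
split; [|split; [|split; [|split]]].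
- apply (is_RInt_gen_arctanh (fun u => hyp 2 (2 * j) u * tanhc u)).
  + apply decay_hyp_div; lia.
  + apply integrand_zeta.
  + apply is_int_hyp_moments, hq2.
- apply (is_RInt_gen_arctanh (fun u => hyp 1 (2 * j) u * tanhc u)).
  + apply decay_hyp_div; lia.
  + apply integrand_beta.
  + apply is_int_hyp_moments, hq1.
- intros [|p] h1 h2; [lia|].
  unfold coef_a, coef_b.
  replace (S p - 1)%nat with p by lia; replace (S j - 1)%nat with j by lia.
  replace (2 * S j - 1)%nat with (2 * j + 1)%nat by lia.
  replace (2 * S j)%nat with (2 * j + 2)%nat by lia.
  rewrite !taylor_coef_asin_mix.
  replace (2 * S p - 1)%nat with (1 + 2 * p)%nat by lia.
  replace (2 * S p)%nat with (2 + 2 * p)%nat by lia.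
  split; [apply (signed_mix_pos 2 hq2)|apply (signed_mix_pos 1 hq1)]; lia.
- apply alternates_of_signed; intros p hp; rewrite zeta_summand_eq.
  apply moment_summand_sign; assumption.
- apply alternates_of_signed; intros p hp; rewrite beta_summand_eq.
  apply moment_summand_sign; assumption.
Qed.
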